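(* Let $\Bbbk$ be an algebraically closed field of arbitrary characteristic, let $d\ge 3$ and $n\ge d+4$, and let $V_{d,n}$, $Y_{d,n}$, $W_{d,n}\subseteq(\mathbb{P}^d)^n$ be the closed subschemes defined in the context. Then: (1) scheme-theoretically, $V_{d,n}\cup Y_{d,n}\subseteq W_{d,n}$; (2) if $d=3$ or $n=d+4$, then set-theoretically $V_{d,n}\cup Y_{d,n}=W_{d,n}$.
   Context: Notation: $[n]=\{1,\dots,n\}$, and $\binom{[n]}{m}$ is the set of subsets of $[n]$ of cardinality $m$. A rational normal curve in $\mathbb{P}^d$ is the image of the $d$-th Veronese embedding $\mathbb{P}^1\hookrightarrow\mathbb{P}^d$ up to projective automorphism. Let $U_{d,n}\subseteq(\mathbb{P}^d)^n$ be the locus of configurations $(p_1,\dots,p_n)$ of $n$ distinct points such that some rational normal curve in $\mathbb{P}^d$ contains all the $p_i$. $V_{d,n}\subseteq(\mathbb{P}^d)^n$ (the Veronese compactification) is the Zariski closure of $U_{d,n}$ with the reduced induced scheme structure. $Y_{d,n}\subseteq(\mathbb{P}^d)^n$ (degenerate configurations) is the closed subscheme defined by all $(d+1)\times(d+1)$ minors of the $(d+1)\times n$ matrix whose columns are the homogeneous coordinates of the $n$ factors. Definition of $W_{d,n}$. For $J=\{j_1<\dots<j_k\}$ put $S_J=\sum_{l=1}^k(j_l-l)$. First let $n=d+4$. For a set $K\in\binom{[d+4]}{d+1}$ let $m_K$ be the maximal minor, with columns indexed by $K$, of the $(d+1)\times(d+4)$ matrix of homogeneous coordinates on $(\mathbb{P}^d)^{d+4}$.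 For $J\in\binom{[d+4]}{3}$ put $\widehat{m}_J:=(-1)^{S_J+d+1}m_{J^c}$, where $J^c=[d+4]\setminus J$. For $I=\{i_1<\dots<i_6\}\in\binom{[d+4]}{6}$ define $$\psi_I:=\widehat m_{\{i_1,i_2,i_3\}}\widehat m_{\{i_1,i_4,i_5\}}\widehat m_{\{i_2,i_4,i_6\}}\widehat m_{\{i_3,i_5,i_6\}}-\widehat m_{\{i_1,i_2,i_4\}}\widehat m_{\{i_1,i_3,i_5\}}\widehat m_{\{i_2,i_3,i_6\}}\widehat m_{\{i_4,i_5,i_6\}}.$$ (This is obtained by the substitution $m_J\mapsto(-1)^{S_J+d+1}m_{J^c}$ from the expression in $3\times3$ minors of the equation for six points in $\mathbb{P}^2$ to lie on a conic.) $W_{d,d+4}\subseteq(\mathbb{P}^d)^{d+4}$ is the closed subscheme defined by all $\psi_I$, $I\in\binom{[d+4]}{6}$. For general $n\ge d+4$ and $J\in\binom{[n]}{d+4}$, let $\pi_J:(\mathbb{P}^d)^n\to(\mathbb{P}^d)^{d+4}$, $(p_i)\mapsto(p_i)_{i\in J}$ (indices in increasing order), and $\psi_{I,J}:=\pi_J^*\psi_I$. $W_{d,n}\subseteq(\mathbb{P}^d)^n$ is the closed subscheme defined by all $\psi_{I,J}$, $I\in\binom{[d+4]}{6}$, $J\in\binom{[n]}{d+4}$. *)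

(* Defs.v *)
From HB Require Import structures.
From mathcomp Require Import all_boot all_order all_algebra zify.
From mathcomp Require Import perm mpoly.

Set Implicit Arguments.
Unset Strict Implicit.
Unset Printing Implicit Defensive.

Import GRing.Theory.

Local Open Scope ring_scope.

(* P^d(k) is the set of lines of k^(d+1).  Indices start at 0. *)
Definition proj_space (k : fieldType) (d : nat) : Type :=
  {L : {vspace 'cV[k]_d.+1} | \dim L == 1%N}.

Definition config (k : fieldType) (d n : nat) : Type := 'I_n -> proj_space k d.

Definition hcoords (k : fieldType) (d n : nat)
    (x : 'M[k]_(d.+1, n)) (p : config k d n) : Prop :=
  forall j, val (p j) = <[col j x]>%VS.

Definition veronese_map (k : fieldType) (d : nat) (v : 'cV[k]_2) : 'cV[k]_d.+1 :=
  \col_i (v 0 0 ^+ (d - i) * v 1 0 ^+ i).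

Definition rational_normal_curve (k : fieldType) (d : nat)
    (C : proj_space k d -> Prop) : Prop :=
  exists2 A : 'M[k]_d.+1, A \in unitmx &
    forall q, C q <-> exists2 v : 'cV[k]_2, v != 0 &
      val q = <[A *m veronese_map d v]>%VS.

Definition U_locus (k : fieldType) (d n : nat) (p : config k d n) : Prop :=
  injective p /\
  exists2 C : proj_space k d -> Prop, rational_normal_curve C &
    forall j, C (p j).

(* The Z^n-graded homogeneous coordinate ring of (P^d)^n: the variable of    *)
(* index mxvec_index i j is the i-th homogeneous coordinate on the j-th      *)
(* factor.                                                                  *)

Definition coord_ring (k : fieldType) (d n : nat) := {mpoly k[d.+1 * n]}.

Definition coord_mx (k : fieldType) (d n : nat) :
    'M[{mpoly k[d.+1 * n]}]_(d.+1, n) :=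
  \matrix_(i, j) 'X_(mxvec_index i j).

Definition eval_at (k : fieldType) (d n : nat)
    (x : 'M[k]_(d.+1, n)) (f : coord_ring k d n) : k :=
  f.@[fun l => mxvec x 0 l].

Definition coldeg (d n : nat) (j : 'I_n) (m : 'X_{1..d.+1 * n}) : nat :=
  (\sum_(i < d.+1) m (mxvec_index i j))%N.

Fact coldeg0 d n (j : 'I_n) : coldeg j (0%MM : 'X_{1..d.+1 * n}) = 0%N.
Proof. by apply: big1 => i _; rewrite mnm0E. Qed.

Fact coldegD d n (j : 'I_n) :
  {morph @coldeg d n j : m1 m2 / (m1 + m2)%MM >-> (m1 + m2)%N}.
Proof.
by move=> m1 m2; rewrite /coldeg -big_split; apply: eq_bigr => i _; rewrite mnmDE.
Qed.

HB.instance Definition _ d n (j : 'I_n) :=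
  isMeasure.Build _ (@coldeg d n j) (coldeg0 d j) (@coldegD d n j).

Definition multihomog (k : fieldType) (d n : nat) (f : coord_ring k d n) : Prop :=
  forall j : 'I_n, f \is homog (@coldeg d n j).

(* The monomials chart_mon c generate the irrelevant ideal of (P^d)^n; the   *)
(* open set where chart_mon c is invertible is the product of the standard   *)
(* affine charts D_+(x_(c j)).                                              *)
Definition chart_mon (k : fieldType) (d n : nat) (c : 'I_n -> 'I_d.+1) :
    coord_ring k d n :=
  \prod_j coord_mx k d n (c j) j.

(* Closed subschemes of (P^d)^n, given by their multihomogeneous ideals       *)
(* saturated with respect to the irrelevant ideal.  These correspond          *)
(* bijectively to the quasi-coherent ideal sheaves on (P^d)^n, an inclusion   *)
(* of ideals being a reversed inclusion of subschemes.                       *)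

Record closed_subscheme (k : fieldType) (d n : nat) : Type := ClosedSubscheme {
  sideal :> coord_ring k d n -> Prop;
  sideal0 : sideal 0;
  sidealD : forall f g, sideal f -> sideal g -> sideal (f + g);
  sidealM : forall a f, sideal f -> sideal (a * f);
  sideal_homog : forall f j e, sideal f -> sideal (pihomog (@coldeg d n j) e f);
  sideal_sat : forall f,
    (forall c : 'I_n -> 'I_d.+1, exists N, sideal (chart_mon k c ^+ N * f)) ->
    sideal f
}.

Definition subscheme (k : fieldType) (d n : nat)
    (X Z : closed_subscheme k d n) : Prop :=
  forall f, Z f -> X f.

(* The closed points of X; k is meant to be algebraically closed. *)
Definition point_of (k : fieldType) (d n : nat)
    (X : closed_subscheme k d n) (p : config k d n) : Prop :=
  forall f, X f -> forall x, hcoords x p -> eval_at x f = 0.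

Section Constructions.

Variables (k : fieldType) (d n : nat).

Local Notation S := (coord_ring k d n).

Definition sunion_ideal (X Z : closed_subscheme k d n) : S -> Prop :=
  fun f => X f /\ Z f.

Fact sunion0 X Z : sunion_ideal X Z 0.
Proof. by split; exact: sideal0. Qed.

Fact sunionD X Z f g :
  sunion_ideal X Z f -> sunion_ideal X Z g -> sunion_ideal X Z (f + g).
Proof. by move=> [? ?] [? ?]; split; exact: sidealD. Qed.

Fact sunionM X Z a f : sunion_ideal X Z f -> sunion_ideal X Z (a * f).
Proof. by move=> [? ?]; split; exact: sidealM. Qed.

Fact sunion_homog X Z f (j : 'I_n) e :
  sunion_ideal X Z f -> sunion_ideal X Z (pihomog (@coldeg d n j) e f).
Proof. by move=> [? ?]; split; exact: sideal_homog. Qed.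

Fact sunion_sat X Z f :
  (forall c : 'I_n -> 'I_d.+1, exists N, sunion_ideal X Z (chart_mon k c ^+ N * f)) ->
  sunion_ideal X Z f.
Proof. by move=> h; split; apply: sideal_sat => c; case: (h c) => N []; exists N. Qed.

Definition sunion (X Z : closed_subscheme k d n) : closed_subscheme k d n :=
  ClosedSubscheme (sunion0 X Z) (@sunionD X Z) (@sunionM X Z)
    (@sunion_homog X Z) (@sunion_sat X Z).

(* The closed subscheme defined by multihomogeneous equations E has as ideal *)
(* the saturation of the ideal generated by E.                              *)

Definition ideal_gen (E : S -> Prop) (f : S) : Prop :=
  exists2 s : seq (S * S), {in s, forall ag, E ag.2} &
    f = \sum_(ag <- s) ag.1 * ag.2.

Definition zeros_ideal (E : S -> Prop) (f : S) : Prop :=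
  forall c : 'I_n -> 'I_d.+1, exists N, ideal_gen E (chart_mon k c ^+ N * f).

Lemma ideal_gen0 E : ideal_gen E 0.
Proof. by exists [::] => //; rewrite big_nil. Qed.

Lemma ideal_genD E f g : ideal_gen E f -> ideal_gen E g -> ideal_gen E (f + g).
Proof.
move=> [s hs ->] [t ht ->]; exists (s ++ t); last by rewrite big_cat.
by move=> ag; rewrite mem_cat => /orP[/hs|/ht].
Qed.

Lemma ideal_genM E a f : ideal_gen E f -> ideal_gen E (a * f).
Proof.
move=> [s hs ->]; exists [seq (a * ag.1, ag.2) | ag <- s].
  by move=> _ /mapP[ag /hs hag ->].
by rewrite big_map mulr_sumr; apply: eq_bigr => ag _; rewrite mulrA.
Qed.

Lemma pihomogMl (mf : measure (d.+1 * n)) b e (h f : S) :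
  h \is b.-homog for mf -> pihomog mf (b + e) (h * f) = h * pihomog mf e f.
Proof.
move=> hh; have fE := pihomog_partitionE (leqnn (mmeasure mf f)).
have -> : h * f = \sum_(i < mmeasure mf f) h * pihomog mf i f.
  by rewrite -mulr_sumr -fE.
have -> : pihomog mf e f = \sum_(i < mmeasure mf f) pihomog mf e (pihomog mf i f).
  by rewrite -linear_sum -fE.
rewrite linear_sum mulr_sumr; apply: eq_bigr => i _ /=.
have hi : h * pihomog mf i f \is (b + i).-homog for mf.
  by apply: dhomogM => //; exact: pihomogP.
have [->|nei] := eqVneq (i : nat) e.
  by rewrite pihomog_dE ?pihomog_id // dhomogM // pihomogP.
rewrite (pihomog_ne0 _ hi) ?eqn_add2l // (pihomog_ne0 nei) ?mulr0 //.
exact: pihomogP.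
Qed.

Lemma pihomog_mul_lt (mf : measure (d.+1 * n)) b e (h f : S) :
  h \is b.-homog for mf -> (e < b)%N -> pihomog mf e (h * f) = 0.
Proof.
move=> hh ltb; have fE := pihomog_partitionE (leqnn (mmeasure mf f)).
have -> : h * f = \sum_(i < mmeasure mf f) h * pihomog mf i f.
  by rewrite -mulr_sumr -fE.
rewrite linear_sum; apply: big1 => i _ /=.
have hi : h * pihomog mf i f \is (b + i).-homog for mf.
  by apply: dhomogM => //; exact: pihomogP.
by apply: (pihomog_ne0 _ hi); lia.
Qed.

Lemma ideal_gen_homog E (j : 'I_n) e f : (forall g, E g -> multihomog g) ->
  ideal_gen E f -> ideal_gen E (pihomog (@coldeg d n j) e f).
Proof.
move=> hE [s hs ->]; rewrite linear_sum big_seq.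
apply: (big_ind (ideal_gen E)); [exact: ideal_gen0|exact: ideal_genD|].
move=> [a g] /hs /= Eg; have /homogP[b hb] := hE _ Eg j.
have gE h : ideal_gen E (g * h).
  rewrite mulrC; apply: ideal_genM; exists [:: (1, g)]; last first.
    by rewrite big_seq1 mul1r.
  by move=> ag; rewrite inE => /eqP->.
rewrite mulrC; have [lt|le] := ltnP e b.
  by rewrite (pihomog_mul_lt _ hb lt); exact: ideal_gen0.
by rewrite -(subnKC le) (pihomogMl _ _ hb).
Qed.

Lemma mxvec_index_inj m r (i i' : 'I_m) (j j' : 'I_r) :
  mxvec_index i j = mxvec_index i' j' -> (i, j) = (i', j').
Proof. by move=> /cast_ord_inj/enum_rank_inj. Qed.

Lemma dhomog_coord (j : 'I_n) i l :
  coord_mx k d n i l \is (l == j : nat).-homog for @coldeg d n j.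
Proof.
rewrite mxE dhomogX /= /coldeg; apply/eqP; have [->|ne] := eqVneq l j.
  rewrite (bigD1 i) //= mnm1E eqxx big1 // => i' ne'.
  rewrite mnm1E; apply/eqP; rewrite eqb0.
  by apply: contra ne' => /eqP/mxvec_index_inj[->].
apply: big1 => i' _; rewrite mnm1E; apply/eqP; rewrite eqb0.
by apply: contra ne => /eqP/mxvec_index_inj[_ ->].
Qed.

Lemma dhomog_bigprod (I : Type) (r : seq I) (mf : measure (d.+1 * n))
    (F : I -> S) (a : I -> nat) :
  (forall i, F i \is (a i).-homog for mf) ->
  \prod_(i <- r) F i \is (\sum_(i <- r) a i)%N.-homog for mf.
Proof.
move=> hF; elim/big_rec2: _ => [|i p q _ hq]; first exact: dhomog1.
exact: dhomogM.
Qed.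

Lemma dhomog_chart (j : 'I_n) c N :
  chart_mon k c ^+ N \is N.-homog for @coldeg d n j.
Proof.
rewrite -[X in X.-homog for _]mul1n; apply: dhomogMn.
have -> : 1%N = (\sum_(l < n) (l == j : nat))%N.
  by rewrite (bigD1 j) //= eqxx big1 // => l /negPf->.
by apply: dhomog_bigprod => l; exact: dhomog_coord.
Qed.

Fact zeros0 E : zeros_ideal E 0.
Proof. by move=> c; exists 0%N; rewrite mulr0; exact: ideal_gen0. Qed.

Fact zerosD E f g : zeros_ideal E f -> zeros_ideal E g -> zeros_ideal E (f + g).
Proof.
move=> hf hg c; have [N hN] := hf c; have [M hM] := hg c.
exists (M + N)%N; rewrite mulrDr; apply: ideal_genD.
  by rewrite exprD -mulrA; exact: ideal_genM.
by rewrite addnC exprD -mulrA; exact: ideal_genM.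
Qed.

Fact zerosM E a f : zeros_ideal E f -> zeros_ideal E (a * f).
Proof.
by move=> hf c; have [N hN] := hf c; exists N; rewrite mulrCA; exact: ideal_genM.
Qed.

Fact zeros_homog E : (forall f, E f -> multihomog f) ->
  forall f (j : 'I_n) e, zeros_ideal E f ->
    zeros_ideal E (pihomog (@coldeg d n j) e f).
Proof.
move=> hE f j e hf c; have [N hN] := hf c; exists N.
rewrite -(pihomogMl _ _ (dhomog_chart j c N)); exact: ideal_gen_homog.
Qed.

Fact zeros_sat E f :
  (forall c : 'I_n -> 'I_d.+1, exists N, zeros_ideal E (chart_mon k c ^+ N * f)) ->
  zeros_ideal E f.
Proof.
move=> h c; have [N /(_ c)[M hM]] := h c.
by exists (M + N)%N; rewrite exprD -mulrA.
Qed.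

Definition zeros (E : S -> Prop) (hE : forall f, E f -> multihomog f) :
    closed_subscheme k d n :=
  ClosedSubscheme (zeros0 E) (@zerosD E) (@zerosM E) (zeros_homog hE)
    (@zeros_sat E).

(* The Zariski closure of a set of closed points, with its reduced induced  *)
(* structure: it is defined by all the forms that vanish on the set.        *)

Definition vanishing_forms (P : config k d n -> Prop) (f : S) : Prop :=
  multihomog f /\ forall p x, P p -> hcoords x p -> eval_at x f = 0.

Fact vanishing_forms_homog P f : vanishing_forms P f -> multihomog f.
Proof. by case. Qed.

Definition reduced_closure (P : config k d n -> Prop) : closed_subscheme k d n :=
  zeros (@vanishing_forms_homog P).

End Constructions.

(* When #|K| = r, the columns of M indexed by K in increasing order (image   *)
(* lists K through enum, which is increasing on ordinals).                  *)
Definition cols (R : nzRingType) (m n r : nat) (M : 'M[R]_(m, n))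
    (K : {set 'I_n}) : 'M[R]_(m, r) :=
  \matrix_(i, l) [seq M i j | j in K]`_l.

Definition max_minor (R : nzRingType) (d n : nat) (M : 'M[R]_(d.+1, n))
    (K : {set 'I_n}) : R :=
  \det (cols d.+1 M K).

(* Sum of the j_l - l: the shift between indexing from 0 and from 1 cancels. *)
Definition S_ (n : nat) (J : {set 'I_n}) : nat :=
  (\sum_(l < #|J|) (enum_val l - l))%N.

Definition mhat (R : nzRingType) (d : nat) (M : 'M[R]_(d.+1, d.+4))
    (J : {set 'I_d.+4}) : R :=
  (-1) ^+ (S_ J + d + 1) * max_minor M (~: J).

Definition psi (R : nzRingType) (d : nat) (M : 'M[R]_(d.+1, d.+4))
    (I : {set 'I_d.+4}) : R :=
  let i l := nth ord0 (enum I) l.-1 in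
  let m a b c := mhat M [set i a; i b; i c] in
  m 1 2 3 * m 1 4 5 * m 2 4 6 * m 3 5 6
  - m 1 2 4 * m 1 3 5 * m 2 3 6 * m 4 5 6.

Section Subschemes.

Variables (k : fieldType) (d n : nat).

Definition V_scheme : closed_subscheme k d n :=
  reduced_closure (@U_locus k d n).

Definition Y_equations (f : coord_ring k d n) : Prop :=
  exists2 K : {set 'I_n}, #|K| = d.+1 & f = max_minor (coord_mx k d n) K.

(* The pullback of psi_I by the projection to the factors in J is obtained by *)
(* substituting the columns in J for the generic columns.                    *)
Definition W_equations (f : coord_ring k d n) : Prop :=
  exists J : {set 'I_n}, exists I : {set 'I_d.+4},
    [/\ #|J| = d.+4, #|I| = 6 & f = psi (cols d.+4 (coord_mx k d n) J) I].

Lemma dhomog_cols (mf : measure (d.+1 * n)) m l r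
    (M : 'M[{mpoly k[d.+1 * n]}]_(m, l)) (a : 'I_l -> nat) (K : {set 'I_l}) :
  (forall i j, M i j \is (a j).-homog for mf) ->
  forall i j, cols r M K i j \is (nth 0%N [seq a j | j in K] j).-homog for mf.
Proof.
move=> hM i j; rewrite mxE.
have [lt|ge] := ltnP j #|K|; last by rewrite nth_default ?size_map -?cardE ?rpred0.
have j0 : 'I_l by case: (enum_val (Ordinal lt)) => u hu; exists u.
by rewrite !(nth_map j0) -?cardE.
Qed.

Lemma dhomog_minor (mf : measure (d.+1 * n)) l
    (M : 'M[{mpoly k[d.+1 * n]}]_(d.+1, l)) (a : 'I_l -> nat) (K : {set 'I_l}) :
  (forall i j, M i j \is (a j).-homog for mf) -> #|K| = d.+1 ->
  max_minor M K \is (\sum_(j in K) a j)%N.-homog for mf.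
Proof.
move=> hM cK; rewrite /max_minor /determinant; apply: rpred_sum => s _.
rewrite rpredMsign; pose b (i : 'I_d.+1) := nth 0%N [seq a j | j in K] i.
have -> : (\sum_(j in K) a j = \sum_(i < d.+1) b (s i))%N.
  rewrite -[RHS](reindex_inj (h := s) (P := predT)); last exact: perm_inj.
  rewrite -big_enum /= -(big_map a predT id) (big_nth 0%N) size_map -cardE cK.
  by rewrite big_mkord.
by apply: dhomog_bigprod => i; exact: dhomog_cols.
Qed.

Fact Y_equations_homog f : Y_equations f -> multihomog f.
Proof.
move=> [K cK ->] j; apply/homogP; eexists.
exact: (dhomog_minor (fun i l => dhomog_coord k j i l)).
Qed.

Lemma dhomog_mhat (mf : measure (d.+1 * n))
    (M : 'M[{mpoly k[d.+1 * n]}]_(d.+1, d.+4)) (a : 'I_d.+4 -> nat) x y z :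
  (forall i j, M i j \is (a j).-homog for mf) -> uniq [:: x; y; z] ->
  mhat M [set x; y; z] \is (\sum_j a j - (a x + a y + a z))%N.-homog for mf
  /\ (a x + a y + a z <= \sum_j a j)%N.
Proof.
move=> hM /=; rewrite !inE !andbT negb_or => /andP[/andP[xy xz] yz].
have c3 : #|[set x; y; z]| = 3.
  by rewrite -setUA cardsU1 cards2 !inE negb_or xy xz yz.
have eS : (\sum_j a j = a x + a y + a z + \sum_(j in ~: [set x; y; z]) a j)%N.
  rewrite (bigID (mem [set x; y; z])) /=; congr (_ + _)%N; last first.
    by apply: eq_bigl => j; rewrite !inE.
  rewrite -setUA big_setU1 /= ?inE ?negb_or ?xy ?xz //.
  by rewrite big_setU1 ?inE //= big_set1 addnA.
split; last by rewrite eS leq_addr.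
rewrite eS addKn /mhat rpredMsign; apply: dhomog_minor => //.
by have := cardsC [set x; y; z]; rewrite c3 card_ord => -[].
Qed.

Lemma psi_homog (mf : measure (d.+1 * n))
    (M : 'M[{mpoly k[d.+1 * n]}]_(d.+1, d.+4)) (a : 'I_d.+4 -> nat)
    (I : {set 'I_d.+4}) :
  (forall i j, M i j \is (a j).-homog for mf) -> #|I| = 6 ->
  psi M I \is homog mf.
Proof.
move=> hM cI; have uI : uniq (enum I) by exact: enum_uniq.
have sI : size (enum I) = 6 by rewrite -cardE.
rewrite /psi; move: uI sI.
case: (enum I) => [|i1 [|i2 [|i3 [|i4 [|i5 [|i6 [|? ?]]]]]]] // uI _.
have h m x y z (e : mask m [:: i1; i2; i3; i4; i5; i6] = [:: x; y; z]) :=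
  dhomog_mhat hM (eq_ind _ is_true (mask_uniq uI m) _ (congr1 uniq e)).
have [h123 l123] := h [:: true; true; true; false; false; false] _ _ _ erefl.
have [h145 l145] := h [:: true; false; false; true; true; false] _ _ _ erefl.
have [h246 l246] := h [:: false; true; false; true; false; true] _ _ _ erefl.
have [h356 l356] := h [:: false; false; true; false; true; true] _ _ _ erefl.
have [h124 l124] := h [:: true; true; false; true; false; false] _ _ _ erefl.
have [h135 l135] := h [:: true; false; true; false; true; false] _ _ _ erefl.
have [h236 l236] := h [:: false; true; true; false; false; true] _ _ _ erefl.
have [h456 l456] := h [:: false; false; false; true; true; true] _ _ _ erefl.
have hl := dhomogM (dhomogM (dhomogM h123 h145) h246) h356.
have hr := dhomogM (dhomogM (dhomogM h124 h135) h236) h456.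
apply/homogP; eexists; apply: rpredB; first exact: hl.
by move: hr; congr (_ \is _.-homog for mf); lia.
Qed.

Fact W_equations_homog f : W_equations f -> multihomog f.
Proof.
move=> [J [I [_ cI ->]]] j; apply: psi_homog cI.
by apply: dhomog_cols => i l; exact: dhomog_coord.
Qed.

Definition Y_scheme : closed_subscheme k d n := zeros Y_equations_homog.

Definition W_scheme : closed_subscheme k d n := zeros W_equations_homog.

End Subschemes.

(* Main.v *)
(* Two facts drive the proof.  First, if x is a (d+1) x (d+4) matrix of rank   *)
(* d + 1 with Gale dual y (3 x (d+4), x y^T = 0), then the complementary minors*)
(* of x are a constant times the 3 x 3 minors of y, and psi_I is, up to sign,  *)
(* the 6 x 6 determinant expressing that six columns of y lie on a conic.      *)
(* Points l_j of a rational normal curve have Gale dual points on a conic with *)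
(* the same parameters (Lagrange interpolation), so psi_I vanishes on V; and   *)
(* psi_I is in the ideal of the maximal minors.  Second, membership in V is    *)
(* preserved by limits along polynomial arcs, as a polynomial in one variable  *)
(* with infinitely many zeros vanishes.                                        *)
(*                                                                             *)
(* If n = d + 4 and x is nondegenerate, vanishing of the psi_I puts all of y   *)
(* on one conic; y is then a limit of points on smooth conics, and kernels of  *)
(* matrices of full rank vary polynomially, so x is a limit of points on       *)
(* rational normal curves.                                                     *)
(*                                                                             *)
(* If d = 3, vanishing of the psi_(I,J) means that the projection of the       *)
(* points from any one of them lies on a plane conic.  If all these conics are *)
(* line pairs, the points lie on three lines forming a chain or meeting in a   *)
(* point.  If the cone over the points from some p is irreducible, comparing   *)
(* it with the cone of vertex another point m, alone on its ruling, puts the   *)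
(* points on a twisted cubic or on a conic and a line meeting it; if there is  *)
(* no such m, they lie on three lines through p.  All these curves are limits  *)
(* of twisted cubics, together with any finite set of points on them.          *)

Require Import Defs.
From Stdlib Require Import Classical.
From mathcomp Require Import all_boot all_order all_algebra.
From mathcomp Require Import ring zify.
From mathcomp Require Import mpoly.

Set Implicit Arguments.
Unset Strict Implicit.
Unset Printing Implicit Defensive.

Import GRing.Theory.

Local Open Scope ring_scope.

(** All the geometry takes place on a matrix x of homogeneous coordinates of the configuration. The
    closure V is never described by equations; it is replaced by the class [rnc_limit], generated
    from distinct points on rational normal curves by limits along polynomial arcs. A form vanishing
    on U vanishes on the whole class ([vanishing_rnc_limit]), so [rnc_limit x] puts a configuration
    in V.

    That V lies in W is Gale duality. [cominor_gale] turns complementary minors of x into 3 x 3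
    minors of the dual y, [det_quad_mx] reads [conic_expr] as the condition that six points lie on a
    conic, and the dual of points on a rational normal curve lies on a conic ([curve_gale]); this
    gives [rnc_limit_psi]. That Y lies in W is [W_equations_Y]: every product in psi contains
    maximal minors.

    Conversely, a point of W with x of rank below d + 1 is in Y. For full rank and n = d + 4,
    [rnc_limit_of_psi] finds a conic through the dual points, deforms it to a smooth one, and
    [gale_limit0] carries the deformation back to x. For d = 3, [cone_cond_of_psi] gives a quadric
    cone with vertex at each point. If all these cones are pairs of planes, [limit_two_planes] finds
    three lines carrying the points; otherwise [rnc_limit_of_cones] compares two cones. The explicit
    degenerations [chain_limit], [star_limit] and [cone_curve_limit] show that the resulting
    configurations are limits. *)

Section Limits.

(** * Polynomial arcs and generic parameters *)

Variable k : closedFieldType.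

(** A non-constant p takes the value 1, because p - 1 has a root. *)
Lemma nonzero_poly_nonroot (p : {poly k}) : p != 0 -> exists t, p.[t] != 0.
Proof.
move=> p0; have [/eqP/size_poly1P[c c0 ->]|sp] := eqVneq (size p) 1%N.
  by exists 0; rewrite hornerC.
have /closed_rootP[t] : size (p - 1) != 1%N.
  rewrite size_polyDl // size_polyN size_poly1.
  by have := size_poly_eq0 p; case: (size p) sp p0 => [|[|]] // _ /negPf->.
by rewrite rootE !hornerE subr_eq0 => /eqP e; exists t; rewrite e oner_neq0.
Qed.

(** The value t = 0 may be among the finitely many exceptions, as needed for limits at 0. *)
Definition generically (P : k -> Prop) :=
  exists2 D : {poly k}, D != 0 & forall t, D.[t] != 0 -> P t.

Lemma genericallyW (P : k -> Prop) : (forall t, P t) -> generically P.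
Proof. by exists 1 => //; exact: oner_neq0. Qed.

Lemma generically_impl (P Q : k -> Prop) :
  generically P -> (forall t, P t -> Q t) -> generically Q.
Proof. by move=> [D D0 DP] PQ; exists D => // t /DP/PQ. Qed.

Lemma generically_and (P Q : k -> Prop) :
  generically P -> generically Q -> generically (fun t => P t /\ Q t).
Proof.
move=> [D D0 DP] [E E0 EQ]; exists (D * E) => [|t]; first exact: mulf_neq0.
by rewrite hornerM mulf_eq0 negb_or => /andP[/DP ? /EQ].
Qed.

Lemma generically_forall (I : finType) (P : I -> k -> Prop) :
  (forall i, generically (P i)) -> generically (fun t => forall i, P i t).
Proof.
move=> gP; suff: generically (fun t => {in enum I, forall i, P i t}).
  by move=> g; apply: (generically_impl g) => t h i; apply: h; rewrite mem_enum.
elim: (enum I) => [|i s IHs]; first exact: genericallyW.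
apply: (generically_impl (generically_and (gP i) IHs)) => t [Pi Ps] j.
by rewrite inE => /predU1P[->|/Ps].
Qed.

Lemma generically_ex (P : k -> Prop) : generically P -> exists t, P t.
Proof. by move=> [D /nonzero_poly_nonroot[t Dt] DP]; exists t; exact: DP. Qed.

(** Arcs remain functions of t, so that they can be written as formulas; only the existence of a
    representing polynomial is recorded. *)
Definition polyfun (f : k -> k) := exists p : {poly k}, forall t, f t = p.[t].

Lemma polyfun_cst c : polyfun (fun=> c).
Proof. by exists c%:P => t; rewrite hornerC. Qed.

Lemma polyfun_id : polyfun id.
Proof. by exists 'X => t; rewrite hornerX. Qed.

Lemma polyfunD f g : polyfun f -> polyfun g -> polyfun (fun t => f t + g t).
Proof. by move=> [p fp] [q gq]; exists (p + q) => t; rewrite hornerD fp gq. Qed.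

Lemma polyfunN f : polyfun f -> polyfun (fun t => - f t).
Proof. by move=> [p fp]; exists (- p) => t; rewrite hornerN fp. Qed.

Lemma polyfunM f g : polyfun f -> polyfun g -> polyfun (fun t => f t * g t).
Proof. by move=> [p fp] [q gq]; exists (p * q) => t; rewrite hornerM fp gq. Qed.

Lemma polyfunX f m : polyfun f -> polyfun (fun t => f t ^+ m).
Proof. by move=> [p fp]; exists (p ^+ m) => t; rewrite horner_exp fp. Qed.

Lemma polyfun_ext f g : polyfun f -> f =1 g -> polyfun g.
Proof. by move=> [p fp] fg; exists p => t; rewrite -fg. Qed.

Lemma polyfun_sum (I : Type) (r : seq I) (P : pred I) (f : I -> k -> k) :
  (forall i, polyfun (f i)) -> polyfun (fun t => \sum_(i <- r | P i) f i t).
Proof.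
move=> fp; elim: r => [|i r IHr].
  by apply: (polyfun_ext (polyfun_cst 0)) => t; rewrite big_nil.
have : polyfun (fun t => (if P i then f i t else 0) + \sum_(j <- r | P j) f j t).
  by apply: polyfunD => //; case: (P i) => //; exact: polyfun_cst.
by move=> g; apply: (polyfun_ext g) => t; rewrite big_cons; case: ifP; rewrite ?add0r.
Qed.

Lemma polyfun_prod (I : Type) (r : seq I) (P : pred I) (f : I -> k -> k) :
  (forall i, polyfun (f i)) -> polyfun (fun t => \prod_(i <- r | P i) f i t).
Proof.
move=> fp; elim: r => [|i r IHr].
  by apply: (polyfun_ext (polyfun_cst 1)) => t; rewrite big_nil.
have : polyfun (fun t => (if P i then f i t else 1) * \prod_(j <- r | P j) f j t).
  by apply: polyfunM => //; case: (P i) => //; exact: polyfun_cst.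
by move=> g; apply: (polyfun_ext g) => t; rewrite big_cons; case: ifP; rewrite ?mul1r.
Qed.

Lemma polyfun_neq0 f t0 : polyfun f -> f t0 != 0 -> generically (fun t => f t != 0).
Proof.
move=> [p fp] f0; exists p => [|t]; last by rewrite fp.
by apply: contraNneq f0 => p0; rewrite fp p0 horner0.
Qed.

(** The continuity principle behind every limit: if p were nonzero, the product of p with the
    exceptional polynomial D would have a nonroot. *)
Lemma polyfun_eq0 f : polyfun f -> generically (fun t => f t = 0) -> f =1 fun=> 0.
Proof.
move=> [p fp] [D D0 Df]; suff p0 : p = 0 by move=> t; rewrite fp p0 horner0.
apply/eqP/contraT => p0; have [t] := nonzero_poly_nonroot (mulf_neq0 D0 p0).
by rewrite hornerM mulf_eq0 negb_or -fp => /andP[/Df->]; rewrite eqxx.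
Qed.

Definition polymx m n (X : k -> 'M[k]_(m, n)) :=
  forall i j, polyfun (fun t => X t i j).

Lemma polymx_cst m n (A : 'M[k]_(m, n)) : polymx (fun=> A).
Proof. by move=> i j; exact: polyfun_cst. Qed.

Lemma polymxM m n p (X : k -> 'M[k]_(m, n)) (Y : k -> 'M[k]_(n, p)) :
  polymx X -> polymx Y -> polymx (fun t => X t *m Y t).
Proof.
move=> pX pY i j; apply: (@polyfun_ext (fun t => \sum_l X t i l * Y t l j)).
  by apply: polyfun_sum => l; exact: polyfunM.
by move=> t; rewrite mxE.
Qed.

Lemma polymxD m n (X Y : k -> 'M[k]_(m, n)) :
  polymx X -> polymx Y -> polymx (fun t => X t + Y t).
Proof.
move=> pX pY i j; apply: (@polyfun_ext (fun t => X t i j + Y t i j)).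
  exact: polyfunD.
by move=> t; rewrite mxE.
Qed.

Lemma polymxN m n (X : k -> 'M[k]_(m, n)) : polymx X -> polymx (fun t => - X t).
Proof.
move=> pX i j; apply: (@polyfun_ext (fun t => - X t i j)).
  exact: polyfunN.
by move=> t; rewrite mxE.
Qed.

Lemma polymxZ m n f (X : k -> 'M[k]_(m, n)) :
  polyfun f -> polymx X -> polymx (fun t => f t *: X t).
Proof.
move=> pf pX i j; apply: (@polyfun_ext (fun t => f t * X t i j)).
  exact: polyfunM.
by move=> t; rewrite mxE.
Qed.

Lemma polymx_tr m n (X : k -> 'M[k]_(m, n)) :
  polymx X -> polymx (fun t => (X t)^T).
Proof.
by move=> pX i j; apply: (@polyfun_ext (fun t => X t j i)) => // t; rewrite mxE.
Qed.

Lemma polyfun_det n (X : k -> 'M[k]_n) : polymx X -> polyfun (fun t => \det (X t)).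
Proof.
move=> pX; apply: polyfun_sum => s; apply: polyfunM; first exact: polyfun_cst.
by apply: polyfun_prod => i.
Qed.

Lemma polymx_adj n (X : k -> 'M[k]_n) : polymx X -> polymx (fun t => \adj (X t)).
Proof.
move=> pX i j; apply: (@polyfun_ext (fun t => cofactor (X t) j i)).
  apply: polyfunM; first exact: polyfun_cst; apply: polyfun_det => a b.
  by apply: (@polyfun_ext (fun t => X t (lift j a) (lift i b))) => // t; rewrite !mxE.
by move=> t; rewrite mxE.
Qed.

Lemma exists_injective n : exists l : 'I_n -> k, injective l.
Proof.
suff [s us ss] : exists2 s : seq k, uniq s & size s = n.
  exists (fun i => s`_i) => i j /eqP; rewrite nth_uniq ?ss // => /eqP.
  exact: val_inj.
elim: n => [|n [s us ss]]; first by exists [::].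
have [|t] := @nonzero_poly_nonroot (\prod_(x <- s) ('X - x%:P)).
  by apply: monic_neq0; exact: monic_prod_XsubC.
rewrite -rootE root_prod_XsubC => ts.
by exists (t :: s); rewrite /= ?ts ?ss.
Qed.

(** * Limits of points on rational normal curves *)

Definition curve_mx d n (c u v : 'I_n -> k) : 'M[k]_(d.+1, n) :=
  \matrix_(i, j) (c j * (u j ^+ (d - i) * v j ^+ i)).

(* The configurations obtained from distinct points on a rational normal curve *)
(* (none of them at infinity) by iterating limits along polynomial arcs.       *)
Inductive rnc_limit d n : 'M[k]_(d.+1, n) -> Prop :=
| rnc_limit_curve A c l : A \in unitmx -> (forall j, c j != 0) -> injective l ->
    rnc_limit (A *m curve_mx d c (fun=> 1) l)
| rnc_limit_lim X (D : {poly k}) : polymx X -> D != 0 ->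
    (forall t, D.[t] != 0 -> rnc_limit (X t)) -> rnc_limit (X 0).

Lemma rnc_limit0 d n (X : k -> 'M[k]_(d.+1, n)) (x : 'M[k]_(d.+1, n)) : polymx X ->
  generically (fun t => rnc_limit (X t)) -> X 0 = x -> rnc_limit x.
Proof. by move=> pX [D D0 DX] <-; exact: rnc_limit_lim pX D0 DX. Qed.

Lemma polyfun_line a b : polyfun (fun t => (1 - t) * a + t * b).
Proof.
apply: polyfunD; last by apply: polyfunM polyfun_id (polyfun_cst b).
apply: polyfunM (polyfun_cst a).
by apply: polyfunD (polyfun_cst 1) (polyfunN polyfun_id).
Qed.

Lemma generic_line a b : b != 0 -> generically (fun t => (1 - t) * a + t * b != 0).
Proof.
by move=> b0; apply: (@polyfun_neq0 _ 1 (polyfun_line a b)); rewrite subrr mul0r add0r mul1r.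
Qed.

(** A singular A is the value at t = 0 of the arc (1 - t) A + t I, whose determinant is 1 at t = 1
    and hence generically nonzero; invertible factors pass through both constructors. *)
Lemma rnc_limit_mull d n (A : 'M[k]_d.+1) (x : 'M[k]_(d.+1, n)) :
  rnc_limit x -> rnc_limit (A *m x).
Proof.
have unitP B : B \in unitmx -> rnc_limit x -> rnc_limit (B *m x).
  move=> uB; elim=> [A' c l uA c0 il|X D pX D0 _ IH].
    by rewrite mulmxA; apply: rnc_limit_curve => //; rewrite unitmx_mul uB.
  apply: (rnc_limit_lim (X := fun t => B *m X t) _ D0) => //.
  exact: polymxM (polymx_cst B) pX.
move=> gx; pose B t := (1 - t) *: A + t *: 1%:M.
have pB : polymx B.
  move=> i j; apply: (polyfun_ext (polyfun_line (A i j) ((1%:M : 'M_d.+1) i j))) => t.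
  by rewrite !mxE.
have gB : generically (fun t => \det (B t) != 0).
  apply: (@polyfun_neq0 _ 1 (polyfun_det pB)).
  by rewrite /B subrr scale0r add0r scale1r det1 oner_neq0.
apply: (@rnc_limit0 _ _ (fun t => B t *m x)).
- exact: polymxM pB (polymx_cst x).
- by apply: (generically_impl gB) => t Bt; apply: unitP; rewrite // unitmxE unitfE.
- by rewrite /B subr0 scale1r scale0r addr0.
Qed.

Lemma rnc_limit_unscale d n c (x y : 'M[k]_(d.+1, n)) : (forall j, c j != 0) ->
  (forall j, col j y = c j *: col j x) -> rnc_limit y -> rnc_limit x.
Proof.
move=> c0 yx gy; pose e : 'rV[k]_n := \row_j (c j)^-1.
have -> : x = y *m diag_mx e.
  apply/matrixP=> i j; have /matrixP/(_ i 0) := yx j.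
  by rewrite mul_mx_diag !mxE => ->; rewrite mulrAC divff ?mul1r.
elim: gy => [A c' l uA c'0 il|X D pX D0 _ IH].
  rewrite -mulmxA; have -> : curve_mx d c' (fun=> 1) l *m diag_mx e
      = curve_mx d (fun j => c' j / c j) (fun=> 1) l.
    by apply/matrixP => i j; rewrite mul_mx_diag !mxE mulrAC.
  by apply: rnc_limit_curve => // j; rewrite mulf_neq0 ?invr_neq0.
apply: (rnc_limit_lim (X := fun t => X t *m diag_mx e) _ D0) => //.
exact: polymxM pX (polymx_cst _).
Qed.

Lemma polyfun_curve d n (c u v : k -> 'I_n -> k) :
  (forall j, polyfun (c^~ j)) -> (forall j, polyfun (u^~ j)) ->
  (forall j, polyfun (v^~ j)) -> polymx (fun t => curve_mx d (c t) (u t) (v t)).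
Proof.
move=> pc pu pv i j.
apply: (@polyfun_ext (fun t => c t j * (u t j ^+ (d - i) * v t j ^+ i))).
  by apply: polyfunM => //; apply: polyfunM; apply: polyfunX.
by move=> t; rewrite mxE.
Qed.

Lemma curve_mx_affine d n (c u v : 'I_n -> k) : (forall j, u j != 0) ->
  curve_mx d c u v = curve_mx d (fun j => c j * u j ^+ d) (fun=> 1) (fun j => v j / u j).
Proof.
move=> u0; apply/matrixP => i j; rewrite !mxE expr1n mul1r -mulrA; congr (_ * _).
have -> : u j ^+ d = u j ^+ (d - i) * u j ^+ i by rewrite -exprD subnK // -ltnS.
by rewrite expr_div_n -mulrA; congr (_ * _); rewrite mulrC divfK ?expf_neq0.
Qed.

(** The segment from (c, u, v) to (1, 1, l) ends at t = 1 in distinct affine points of nonzero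
    weight. Each inequality is a polynomial condition true at t = 1, hence generic; [E] expresses
    distinctness of the quotients without division. *)
Lemma generic_curve n (c u v : 'I_n -> k) (l : 'I_n -> k) : injective l ->
  let L (f g : 'I_n -> k) t j := (1 - t) * f j + t * g j in
  generically (fun t => [/\ forall j, L c (fun=> 1) t j != 0,
    forall j, L u (fun=> 1) t j != 0 &
    injective (fun j => L v l t j / L u (fun=> 1) t j)]).
Proof.
move=> il L.
have gc := generically_forall (fun j => generic_line (c j) (oner_neq0 k)).
have gu := generically_forall (fun j => generic_line (u j) (oner_neq0 k)).
pose E i j t := L v l t i * L u (fun=> 1) t j - L v l t j * L u (fun=> 1) t i.
have gv : generically (fun t => forall i j, i != j -> E i j t != 0).
  apply: generically_forall => i; apply: generically_forall => j.
  have [<-|ne] := eqVneq i j; first exact: genericallyW.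
  have pE : polyfun (E i j).
    by apply: polyfunD; [|apply: polyfunN]; apply: polyfunM; exact: polyfun_line.
  have E1 : E i j 1 != 0.
    rewrite /E /L subrr !mul0r !add0r !mul1r !mulr1 subr_eq0.
    by apply: contra ne => /eqP/il->.
  by apply: (generically_impl (polyfun_neq0 pE E1)).
apply: (generically_impl (generically_and gc (generically_and gu gv))) => t [hc [hu hv]].
split=> // i j; move: (hu i) (hu j); rewrite -/(L u (fun=> 1) t i) -/(L u (fun=> 1) t j).
move=> ui uj /eqP; rewrite eqr_div // -subr_eq0 => Eij; apply/eqP/contraT => ne.
by have := hv i j ne; rewrite /E Eij.
Qed.

(** Removes all genericity from the first constructor: A may be singular, and points may coincide,
    lie at infinity or have weight zero. *)
Lemma rnc_limit_curve_mx d n (A : 'M[k]_d.+1) c u v : rnc_limit (A *m curve_mx d (n := n) c u v).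
Proof.
apply: rnc_limit_mull; have [l il] := exists_injective n.
pose L (f g : 'I_n -> k) t j := (1 - t) * f j + t * g j.
pose X t := curve_mx d (L c (fun=> 1) t) (L u (fun=> 1) t) (L v l t).
apply: (@rnc_limit0 _ _ X).
- by apply: polyfun_curve => j; exact: polyfun_line.
- apply: (generically_impl (generic_curve c u v il)) => t [hc hu hv].
  rewrite /X curve_mx_affine // -[curve_mx _ _ _ _]mul1mx.
  apply: rnc_limit_curve => // [|j]; first exact: unitmx1.
  by rewrite mulf_neq0 ?hc ?expf_neq0 ?hu.
- by apply/matrixP => i j; rewrite !mxE /L !subr0 !mul1r !mul0r !addr0.
Qed.

Lemma rnc_limit_cols d n (A : 'M[k]_d.+1) (x : 'M[k]_(d.+1, n)) :
  (forall j, exists c u v, forall i,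
     x i j = \sum_(l < d.+1) A i l * (c * (u ^+ (d - l) * v ^+ l))) -> rnc_limit x.
Proof.
move=> /fin_all_exists[c] /fin_all_exists[u] /fin_all_exists[v] h.
have -> : x = A *m curve_mx d c u v; last exact: rnc_limit_curve_mx.
by apply/matrixP => i j; rewrite h mxE; apply: eq_bigr => l _; rewrite mxE.
Qed.

End Limits.

(** * Minors and Gale duality *)

Section Enum.

Lemma ltn_lift n (h : 'I_n.+1) (i j : 'I_n) : (lift h i < lift h j)%N = (i < j)%N.
Proof. by rewrite /= /bump; lia. Qed.

Lemma enum_set_sorted n (A : {set 'I_n}) :
  sorted (fun i j : 'I_n => (i < j)%N) (enum A).
Proof.
have -> : enum A = filter (mem A) (enum 'I_n) by rewrite {1}/enum_mem enumT.
apply: sorted_filter => [i j l|]; first exact: ltn_trans.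
by have := iota_ltn_sorted 0 n; rewrite -val_enum_ord sorted_map.
Qed.

Lemma enum_set_eq n (A : {set 'I_n}) (s : seq 'I_n) :
  sorted (fun i j : 'I_n => (i < j)%N) s -> s =i A -> enum A = s.
Proof.
move=> ss sA; apply: (irr_sorted_eq (leT := fun i j : 'I_n => (i < j)%N)) => //.
- by move=> i j l; exact: ltn_trans.
- by move=> i; exact: ltnn.
- exact: enum_set_sorted.
- by move=> i; rewrite mem_enum sA.
Qed.

Lemma S_seq n (A : {set 'I_n}) i0 :
  S_ A = (\sum_(0 <= l < size (enum A)) (nth i0 (enum A) l - l))%N.
Proof.
rewrite /S_ -cardE big_mkord; apply: eq_bigr => l _.
by rewrite (enum_val_nth i0).
Qed.

Lemma cols_seq (R : nzRingType) m n r (M : 'M[R]_(m, n)) (A : {set 'I_n})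
    (i0 : 'I_n) (i : 'I_m) (l : 'I_r) : #|A| = r ->
  cols r M A i l = M i (nth i0 (enum A) l).
Proof. by move=> cA; rewrite mxE (nth_map i0) // -cardE cA. Qed.

End Enum.

Section Minors.

Variable R : comNzRingType.

Definition sel_mx n (a b c : 'I_n) : 'M[R]_(3, n) :=
  \matrix_(i, j) (j == nth a [:: a; b; c] i)%:R.

(* Up to sign, the maximal minor on the columns other than a, b, c; it is     *)
(* alternating in (a, b, c).                                                  *)
Definition cominor d (x : 'M[R]_(d.+1, d.+4)) a b c : R :=
  \det (col_mx (sel_mx a b c) x : 'M[R]_(3 + d.+1)).

Lemma det_unit_row m (M : 'M[R]_m.+1) a : (forall j, M ord0 j = (j == a)%:R) ->
  \det M = (-1) ^+ a * \det (\matrix_(i, j) M (lift ord0 i) (lift a j)).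
Proof.
move=> M0; rewrite (expand_det_row _ ord0) (bigD1 a) //= big1 ?addr0 => [|j ne].
  rewrite M0 eqxx mul1r /cofactor add0n; congr (_ * \det _).
  by apply/matrixP => i j; rewrite !mxE.
by rewrite M0 (negPf ne) mul0r.
Qed.

Lemma det_unit_col m (M : 'M[R]_m.+1) i0 a :
  (forall i, M i a = (i == i0)%:R) ->
  \det M = (-1) ^+ (i0 + a) * \det (\matrix_(i, j) M (lift i0 i) (lift a j)).
Proof.
move=> M0; rewrite (expand_det_col _ a) (bigD1 i0) //= big1 ?addr0 => [|j ne].
  rewrite M0 eqxx mul1r /cofactor; congr (_ * \det _).
  by apply/matrixP => i j; rewrite !mxE.
by rewrite M0 (negPf ne) mul0r.
Qed.

Lemma col_sel0 d (x : 'M[R]_(d.+1, d.+4)) a b c j :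
  (col_mx (sel_mx a b c) x : 'M[R]_(3 + d.+1, d.+4)) ord0 j = (j == a)%:R.
Proof.
by rewrite (_ : ord0 = lshift d.+1 (0 : 'I_3)) ?col_mxEu ?mxE //; exact: val_inj.
Qed.

Lemma col_sel1 d (x : 'M[R]_(d.+1, d.+4)) a b c j :
  (col_mx (sel_mx a b c) x : 'M[R]_(3 + d.+1, d.+4)) (lift ord0 ord0) j = (j == b)%:R.
Proof.
by rewrite (_ : lift _ _ = lshift d.+1 (1 : 'I_3)) ?col_mxEu ?mxE //; exact: val_inj.
Qed.

Lemma col_sel2 d (x : 'M[R]_(d.+1, d.+4)) a b c j :
  (col_mx (sel_mx a b c) x : 'M[R]_(3 + d.+1, d.+4))
    (lift ord0 (lift ord0 ord0)) j = (j == c)%:R.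
Proof.
by rewrite (_ : lift _ _ = lshift d.+1 (2 : 'I_3)) ?col_mxEu ?mxE //; exact: val_inj.
Qed.

Lemma col_sel3 d (x : 'M[R]_(d.+1, d.+4)) a b c i j :
  (col_mx (sel_mx a b c) x : 'M[R]_(3 + d.+1, d.+4))
    (lift ord0 (lift ord0 (lift ord0 i))) j = x i j.
Proof.
by rewrite (_ : lift _ _ = rshift 3 i) ?col_mxEd //; exact: val_inj.
Qed.

(** The three unit rows are expanded one after the other; b and c are positions counted after the
    earlier deletions, so they give the sign directly. *)
Lemma cominorE d (x : 'M[R]_(d.+1, d.+4)) a (b : 'I_d.+3) (c : 'I_d.+2) :
  cominor x a (lift a b) (lift a (lift b c)) = (-1) ^+ (a + b + c) *
    \det (\matrix_(i, l) x i (lift a (lift b (lift c l)))).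
Proof.
rewrite /cominor (det_unit_row (col_sel0 x _ _ _)).
rewrite (det_unit_row (a := b)) => [|j]; last first.
  by rewrite mxE col_sel1 (inj_eq lift_inj).
rewrite (det_unit_row (a := c)) => [|j]; last first.
  by rewrite 2!mxE col_sel2 !(inj_eq lift_inj).
rewrite !mulrA -!exprD; congr (_ * \det _).
by apply/matrixP => i j; rewrite 3!mxE col_sel3 mxE.
Qed.

Lemma lift_triple m (i j l : 'I_m.+3) : (i < j)%N -> (j < l)%N ->
  exists (b : 'I_m.+2) (c : 'I_m.+1), [/\ j = lift i b, l = lift i (lift b c),
    (b = j - 1 :> nat)%N & (c = l - 2 :> nat)%N].
Proof.
move=> ij jl.
have nij : i != j by rewrite -val_eqE /=; lia.
have nil : i != l by rewrite -val_eqE /=; lia.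
have [b jb] : exists b : 'I_m.+2, j = lift i b by case: (unlift_some nij) => b; exists b.
have [l1 ll] : exists b : 'I_m.+2, l = lift i b by case: (unlift_some nil) => b'; exists b'.
have ej : (b = j - 1 :> nat)%N.
  by move: ij (congr1 val jb) => /=; rewrite /bump; lia.
have el : (l1 = l - 1 :> nat)%N.
  by move: ij jl (congr1 val ll) => /=; rewrite /bump; lia.
have nbl : b != l1 by apply/eqP => /(congr1 val) /=; rewrite ej el; lia.
have [c lc] : exists c : 'I_m.+1, l1 = lift b c by case: (unlift_some nbl) => c; exists c.
exists b, c; split=> //; first by rewrite -lc.
by move: (congr1 val lc) => /=; rewrite /bump; lia.
Qed.

(** The sign of [mhat] is that of the Laplace expansion: S_J is i + (j - 1) + (l - 2), the exponent
    in [cominorE]. The remaining common sign disappears from psi, whose monomials have four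
    factors. *)
Lemma mhatE d (x : 'M[R]_(d.+1, d.+4)) (i j l : 'I_d.+4) : (i < j)%N -> (j < l)%N ->
  mhat x [set i; j; l] = (-1) ^+ d.+1 * cominor x i j l.
Proof.
move=> ij jl; have [b [c [jb lc eb ec]]] := lift_triple ij jl.
have eJ : enum [set i; j; l] = [:: i; j; l].
  apply: enum_set_eq => [|y]; first by rewrite /= ij jl.
  by rewrite !inE orbA.
have eS : S_ [set i; j; l] = (i + b + c)%N.
  by rewrite (S_seq _ i) eJ unlock /= eb ec; lia.
rewrite /mhat eS jb lc cominorE mulrA -exprD -addnA addnC addn1; congr (_ * \det _).
set s := [seq lift i (lift b (lift c h)) | h <- enum 'I_d.+1].
have eC : enum (~: [set i; j; l]) = s.
  apply: enum_set_eq.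
    rewrite sorted_map (eq_sorted (e' := fun h h' : 'I_d.+1 => (h < h')%N)).
      by have := iota_ltn_sorted 0 d.+1; rewrite -val_enum_ord sorted_map.
    by move=> h h'; rewrite /= /bump; lia.
  move=> y; rewrite !inE; apply/mapP/idP => [[h _ ->]|].
    by rewrite jb lc !(inj_eq lift_inj) !negb_or ![lift _ _ == _]eq_sym !neq_lift.
  rewrite !negb_or => /andP[/andP[yi yj] yl].
  rewrite eq_sym in yi; have [y1 e1 _] := unlift_some yi.
  have ny1 : b != y1 by apply: contra yj => /eqP ey; rewrite jb e1 ey.
  have [y2 e2 _] := unlift_some ny1.
  have ny2 : c != y2 by apply: contra yl => /eqP ey; rewrite lc e1 e2 ey.
  have [y3 e3 _] := unlift_some ny2.
  by exists y3; rewrite ?mem_enum // e1 e2 e3.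
apply/matrixP => h g; rewrite (cols_seq _ i); last first.
  by rewrite cardE -jb -lc eC size_map -cardE card_ord.
by rewrite -jb -lc eC mxE (nth_map ord0) -?cardE ?card_ord // nth_ord_enum.
Qed.

(** The bracket D is abstract so that the same expression serves complementary minors of x and 3 x 3
    minors of its dual. *)
Definition conic_expr (T : Type) (D : T -> T -> T -> R) a b c d e f :=
  D a b c * D a d e * D b d f * D c e f - D a b d * D a c e * D b c f * D d e f.

Lemma conic_expr_scale (T : Type) D D' r (a b c d e f : T) :
  (forall a b c, D a b c = r * D' a b c) ->
  conic_expr D a b c d e f = r ^+ 4 * conic_expr D' a b c d e f.
Proof. by move=> DD; rewrite /conic_expr !DD; ring. Qed.

Lemma psiE d (x : 'M[R]_(d.+1, d.+4)) (I : {set 'I_d.+4}) i1 i2 i3 i4 i5 i6 :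
  enum I = [:: i1; i2; i3; i4; i5; i6] ->
  psi x I = conic_expr (cominor x) i1 i2 i3 i4 i5 i6.
Proof.
move=> eI; have := enum_set_sorted I; rewrite eI /=.
case/and5P=> l12 l23 l34 l45 /andP[l56 _].
have e4 : ((-1) ^+ d.+1) ^+ 4 = 1 :> R by rewrite -exprM mulnC exprM -signr_odd expr1n.
rewrite /psi eI /= !mhatE; try by lia.
rewrite -[RHS]mul1r -[X in X * conic_expr _ _ _ _ _ _ _]e4 /conic_expr; ring.
Qed.

End Minors.

(** * Six points on a conic, Gale duals and projection from a point *)

Section ConicDet.

Variable R : comNzRingType.

(** A determinant that unfolds by computation, which lets [ring] decide identities between explicit
    determinants. *)
Fixpoint laplace n (f : nat -> nat -> R) : R :=
  if n is n'.+1 then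
    foldr (fun j s => (if odd j then -1 else 1) * f 0%N j *
      laplace n' (fun a b => f a.+1 (if Nat.ltb b j then b else b.+1)) + s)
      0 (iota 0 n)
  else 1.

Lemma laplaceE n (f : nat -> nat -> R) : \det (\matrix_(i < n, j < n) f i j) = laplace n f.
Proof.
have lebE m p : Nat.leb m p = (m <= p)%N by elim: m p => [|m IHm] [|p] //=.
elim: n f => [|n IHn] f; first by rewrite det_mx00.
rewrite (expand_det_row _ ord0) /=.
transitivity (\sum_(0 <= j < n.+1) ((if odd j then -1 else 1) * f 0%N j *
      laplace n (fun a b => f a.+1 (if Nat.ltb b j then b else b.+1)))).
  rewrite big_mkord; apply: eq_bigr => j _; rewrite mxE /cofactor add0n -signr_odd.
  rewrite mulrCA mulrA; congr (_ * _); first by case: odd; rewrite ?expr1 ?expr0.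
  rewrite -IHn; congr (\det _); apply/matrixP => a b; rewrite !mxE /=.
  by congr (f _ _); rewrite /bump [Nat.ltb _ _]lebE ltnNge; case: leqP.
by rewrite unlock.
Qed.

Definition det3 n (y : 'M[R]_(3, n)) a b c : R :=
  \det (\matrix_(i < 3, l < 3) y l (nth a [:: a; b; c] i)).

Definition explicit_det3 (a b c : nat -> R) : R :=
  a 0%N * (b 1%N * c 2%N - b 2%N * c 1%N) - a 1%N * (b 0%N * c 2%N - b 2%N * c 0%N)
  + a 2%N * (b 0%N * c 1%N - b 1%N * c 0%N).

Lemma det3E n (y : 'M[R]_(3, n)) a b c :
  det3 y a b c = explicit_det3 (fun l => y (inord l) a) (fun l => y (inord l) b)
    (fun l => y (inord l) c).
Proof.
transitivity (laplace 3 (fun i l => y (inord l) (nth a [:: a; b; c] i))).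
  by rewrite -laplaceE; congr (\det _); apply/matrixP => i l; rewrite !mxE inord_val.
by rewrite /explicit_det3 /=; ring.
Qed.

Definition quad_monomial (a : nat -> R) (j : nat) : R :=
  match j with
  | 0 => a 0%N * a 0%N | 1 => a 1%N * a 1%N | 2 => a 2%N * a 2%N
  | 3 => a 0%N * a 1%N | 4 => a 0%N * a 2%N | _ => a 1%N * a 2%N
  end.

Definition quad_mx n (y : 'M[R]_(3, n)) : 'M[R]_(n, 6) :=
  \matrix_(i, j) quad_monomial (fun l => y (inord l) i) j.

(** The classical bracket form of the condition that six points lie on a conic, here a polynomial
    identity in 18 variables. *)
Lemma laplace_quad (a b c d e f : nat -> R) :
  laplace 6 (fun i => match i with
    | 0 => quad_monomial a | 1 => quad_monomial b | 2 => quad_monomial c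
    | 3 => quad_monomial d | 4 => quad_monomial e | _ => quad_monomial f end) =
  - conic_expr explicit_det3 a b c d e f.
Proof.
rewrite /conic_expr /explicit_det3 /quad_monomial /laplace; cbn.
move: (a 0%N) (a 1%N) (a 2%N) (b 0%N) (b 1%N) (b 2%N) (c 0%N) (c 1%N) (c 2%N)
  (d 0%N) (d 1%N) (d 2%N) (e 0%N) (e 1%N) (e 2%N) (f 0%N) (f 1%N) (f 2%N) => *.
ring.
Qed.

Lemma det_quad_mx n (y : 'M[R]_(3, n)) a b c d e f :
  \det (rowsub (fun i : 'I_6 => nth a [:: a; b; c; d; e; f] i) (quad_mx y)) =
  - conic_expr (det3 y) a b c d e f.
Proof.
have -> : conic_expr (det3 y) a b c d e f = conic_expr explicit_det3
    (fun l => y (inord l) a) (fun l => y (inord l) b) (fun l => y (inord l) c)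
    (fun l => y (inord l) d) (fun l => y (inord l) e) (fun l => y (inord l) f).
  by rewrite /conic_expr !det3E.
rewrite -laplace_quad -laplaceE; congr (\det _); apply/matrixP => i j.
by rewrite !mxE; case: i => [[|[|[|[|[|[|i]]]]]] hi].
Qed.

Notation "''o' i" := (@Ordinal 6 i isT) (at level 0, i at level 0).

(** Among six columns the complement of a triple is again a triple, so a complementary minor is
    itself a signed bracket. *)
Lemma cominor6 (r : 'M[R]_(3, 6)) (a : 'I_6) (b : 'I_5) (c : 'I_4) b1 c1 e f g :
  b1 = lift a b -> c1 = lift a (lift b c) -> e = lift a (lift b (lift c ord0)) ->
  f = lift a (lift b (lift c (inord 1))) -> g = lift a (lift b (lift c (inord 2))) ->
  cominor r a b1 c1 = (-1) ^+ (a + b + c) * det3 r e f g.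
Proof.
move=> -> -> -> -> ->; rewrite (@cominorE _ 2) -det_tr; congr (_ * \det _).
apply/matrixP => i l; rewrite !mxE; congr (r _ _).
case: i => [[|[|[|i]]] hi] //=; do 3 congr lift; apply: val_inj => //=.
  by rewrite inordK.
by rewrite inordK.
Qed.

(* A conic passes through six points of the plane iff one passes through *)
(* their Gale dual.                                                       *)
Lemma conic_expr_cominor (r : 'M[R]_(3, 6)) :
  conic_expr (cominor r) 'o0 'o1 'o2 'o3 'o4 'o5 =
  - conic_expr (det3 r) 'o0 'o1 'o2 'o3 'o4 'o5.
Proof.
have h := @cominor6 r.
(* With the index equations stated on values in [nat], each of the eight complements is checked by
   computation. *)
have E := (fun a b c b1 c1 e f g h1 h2 h3 h4 h5 => h a b c b1 c1 e f g
  (val_inj h1) (val_inj h2) (val_inj h3) (val_inj h4) (val_inj h5)).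
rewrite /conic_expr.
rewrite (E 'o0 (@Ordinal 5 0 isT) (@Ordinal 4 0 isT) 'o1 'o2 'o3 'o4 'o5) /= ?inordK //.
rewrite (E 'o0 (@Ordinal 5 2 isT) (@Ordinal 4 2 isT) 'o3 'o4 'o1 'o2 'o5) /= ?inordK //.
rewrite (E 'o1 (@Ordinal 5 2 isT) (@Ordinal 4 3 isT) 'o3 'o5 'o0 'o2 'o4) /= ?inordK //.
rewrite (E 'o2 (@Ordinal 5 3 isT) (@Ordinal 4 3 isT) 'o4 'o5 'o0 'o1 'o3) /= ?inordK //.
rewrite (E 'o0 (@Ordinal 5 0 isT) (@Ordinal 4 1 isT) 'o1 'o3 'o2 'o4 'o5) /= ?inordK //.
rewrite (E 'o0 (@Ordinal 5 1 isT) (@Ordinal 4 2 isT) 'o2 'o4 'o1 'o3 'o5) /= ?inordK //.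
rewrite (E 'o1 (@Ordinal 5 1 isT) (@Ordinal 4 3 isT) 'o2 'o5 'o0 'o3 'o4) /= ?inordK //.
rewrite (E 'o3 (@Ordinal 5 3 isT) (@Ordinal 4 3 isT) 'o4 'o5 'o0 'o1 'o2) /= ?inordK //.
by rewrite /= -!(signr_odd _ (_ + _)) /=; ring.
Qed.

Lemma det3_sel n (y : 'M[R]_(3, n)) a b c :
  \det (sel_mx R a b c *m y^T) = det3 y a b c.
Proof.
congr (\det _); apply/matrixP => i l; rewrite !mxE.
rewrite (bigD1 (nth a [:: a; b; c] i)) //= big1 ?addr0 => [|j ne].
  by rewrite !mxE eqxx mul1r.
by rewrite !mxE (negPf ne) mul0r.
Qed.

(** Multiplying the bordered matrix of x by (y^T | z) gives a block triangular matrix, with diagonal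
    blocks the selected columns of y and the identity. The factor det (y^T | z) is the same for all
    triples. *)
Lemma cominor_gale d (x : 'M[R]_(d.+1, d.+4)) (y : 'M[R]_(3, d.+4))
    (z : 'M[R]_(d.+4, d.+1)) a b c : x *m y^T = 0 -> x *m z = 1%:M ->
  cominor x a b c * \det (row_mx y^T z : 'M[R]_(3 + d.+1)) = det3 y a b c.
Proof.
move=> xy xz; rewrite /cominor -(@det_mulmx _ (3 + d.+1)).
by rewrite mul_col_row xy xz (@det_ublock _ 3 d.+1) det1 mulr1 det3_sel.
Qed.

(** The coordinate change (f; P) sends column j to the first unit vector. Expanding the bordered
    matrix along that column leaves the bordered matrix of the projected points; the unit entry is
    in row 3, just below the selector rows. *)
Lemma cominor_project (x : 'M[R]_(4, 7)) (f : 'rV[R]_4) (P : 'M[R]_(3, 4)) j a b c :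
  f *m col j x = 1 -> P *m col j x = 0 ->
  \det (col_mx f P : 'M[R]_(1 + 3)) * cominor x (lift j a) (lift j b) (lift j c) =
  (-1) ^+ (3 + j) * cominor (col' j (P *m x)) a b c.
Proof.
move=> fj Pj; pose A : 'M[R]_4 := col_mx f P.
pose B : 'M[R]_(3 + 4) := block_mx 1%:M 0 0 A.
have -> : \det (col_mx f P : 'M_(1 + 3)) = \det B.
  by rewrite (@det_lblock _ 3 4) det1 mul1r.
rewrite /cominor -(@det_mulmx _ (3 + 4)) mul_block_col !mul0mx mul1mx addr0 add0r.
have Aj : A *m col j x = delta_mx 0 0.
  rewrite /A (@mul_col_mx _ 1 3) fj Pj; apply/matrixP => i l; rewrite !ord1.
  case: (@split_ordP 1 3 i) => i' ->.
    by rewrite (@col_mxEu _ 1 3) !ord1 !mxE.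
  by rewrite (@col_mxEd _ 1 3) !mxE.
pose i0 : 'I_7 := rshift 3 (ord0 : 'I_4).
rewrite (@det_unit_col _ 6 _ i0 j) => [|i].
  congr (_ * \det _); apply/matrixP => i l; rewrite mxE.
  case: (@split_ordP 3 3 i) => i' ->.
    have -> : lift i0 (lshift 3 i') = lshift 4 i'.
      by apply: val_inj; rewrite /= /bump; have := ltn_ord i'; lia.
    rewrite (@col_mxEu _ 3 4) (@col_mxEu _ 3 3) !mxE.
    case: i' => [[|[|[|i']]] hi] //=; by rewrite (inj_eq lift_inj).
  have -> : lift i0 (rshift 3 i') = rshift 3 (lift ord0 i').
    by apply: val_inj; rewrite /= /bump; lia.
  rewrite (@col_mxEd _ 3 4) (@col_mxEd _ 3 3) /A (@mul_col_mx _ 1 3).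
  have -> : lift ord0 i' = rshift 1 i' by exact: val_inj.
  by rewrite (@col_mxEd _ 1 3) [RHS]mxE.
case: (@split_ordP 3 4 i) => i' ->.
  rewrite (@col_mxEu _ 3 4) mxE.
  have -> : (lshift 4 i' == i0) = false.
    by rewrite -val_eqE /=; have := ltn_ord i'; lia.
  case: i' => [[|[|[|i']]] hi] //=; by rewrite (negPf (neq_lift _ _)).
rewrite (@col_mxEd _ 3 4).
have -> : (A *m x) i' j = (A *m col j x) i' 0 by rewrite !mxE; apply: eq_bigr => l _; rewrite !mxE.
by rewrite Aj mxE andbT -!val_eqE.
Qed.

End ConicDet.

(** * A conic through all points of a plane configuration *)

Section ConicThrough.

Variable F : fieldType.

Lemma gale_unitmx r m (x : 'M[F]_(m, r + m)) (y : 'M[F]_(r, r + m))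
    (z : 'M[F]_(r + m, m)) : x *m y^T = 0 -> x *m z = 1%:M -> row_free y ->
  row_mx y^T z \in unitmx.
Proof.
move=> xy xz fy; rewrite -unitmx_tr -row_free_unit -kermx_eq0.
set K := kermx _; have : K *m (row_mx y^T z)^T = 0 by exact: mulmx_ker.
rewrite -[K]hsubmxK tr_row_mx trmxK mul_row_col => e.
have K2 : rsubmx K = 0.
  have := congr1 (mulmx^~ x^T) e; rewrite mulmxDl mul0mx -!mulmxA.
  by rewrite -[y *m _]trmxK trmx_mul trmxK xy trmx0 mulmx0 add0r -trmx_mul xz trmx1 mulmx1.
move: e; rewrite K2 mul0mx addr0 => e.
have -> : lsubmx K = 0 by apply: (row_free_inj fy); rewrite e mul0mx.
by rewrite row_mx0.
Qed.

Definition conic_fun (c : 'cV[F]_6) (v : 'cV[F]_3) : F :=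
  \sum_(j < 6) quad_monomial (fun l => v (inord l) 0) j * c j 0.

(** Conics through the columns form the kernel of [quad_mx y]. If this matrix had full column rank,
    six independent rows taken in increasing order would have a nonzero determinant, which
    [det_quad_mx] equates up to sign with a vanishing expression. *)
Lemma conic_through n (y : 'M[F]_(3, n)) :
  (forall i1 i2 i3 i4 i5 i6 : 'I_n, (i1 < i2)%N -> (i2 < i3)%N -> (i3 < i4)%N ->
     (i4 < i5)%N -> (i5 < i6)%N -> conic_expr (det3 y) i1 i2 i3 i4 i5 i6 = 0) ->
  exists2 c : 'cV[F]_6, c != 0 & forall i, conic_fun c (col i y) = 0.
Proof.
move=> hy; have [full|nfull] := boolP (row_full (quad_mx y)).
  pose f := fullrankfun full; pose I := [set f i | i in 'I_6].
  have cI : #|I| = 6 by rewrite card_imset ?card_ord //; exact: fullrankfun_inj.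
  have := enum_set_sorted I; have := mem_enum I; move: cI; rewrite cardE.
  case eI: (enum I) => [|i1 [|i2 [|i3 [|i4 [|i5 [|i6 [|? ?]]]]]]] // _ mI /=.
  case/and5P=> l12 l23 l34 l45 /andP[l56 _].
  have := hy _ _ _ _ _ _ l12 l23 l34 l45 l56.
  move/eqP; rewrite -oppr_eq0 -det_quad_mx => /eqP d0.
  set g := (fun _ => _) in d0.
  have : (rowsub f (quad_mx y) <= rowsub g (quad_mx y))%MS.
    apply/row_subP => i; rewrite row_rowsub.
    have /(nthP i1)[l ll <-] : f i \in [:: i1; i2; i3; i4; i5; i6].
      by rewrite mI; apply: imset_f.
    by apply: (eq_row_sub (Ordinal ll)); rewrite row_rowsub.
  move=> /mxrankS; rewrite (eqP (_ : row_free (rowsub f _))); last first.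
    by rewrite row_free_unit; exact: fullrowsub_unit.
  move=> r6; have : rowsub g (quad_mx y) \in unitmx.
    by rewrite -row_full_unit /row_full eqn_leq rank_leq_col.
  by rewrite unitmxE d0 unitr0.
have : cokermx (quad_mx y) != 0.
  apply: contra nfull => /eqP c0; rewrite /row_full eqn_leq rank_leq_col /=.
  by have := mxrank_coker (quad_mx y); rewrite c0 mxrank0; lia.
case/matrix0Pn => i [j cij].
exists (col j (cokermx (quad_mx y))).
  by apply/eqP => /matrixP/(_ i 0); rewrite mxE [RHS]mxE => e; rewrite e eqxx in cij.
move=> l; have /matrixP/(_ l j) := mulmx_coker (quad_mx y); rewrite mxE [RHS]mxE => e.
rewrite -[RHS]e; apply: eq_bigr => h _; rewrite [col j _ _ _]mxE; congr (_ * _).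
rewrite mxE.
by case: h => [[|[|[|[|[|[|h]]]]]] hh] //=; rewrite !mxE.
Qed.

End ConicThrough.

(** * Classification of conics *)

Section LinearAlgebra.

Lemma sum_inord (V : nmodType) n (F : 'I_n.+1 -> V) :
  \sum_(i < n.+1) F i = \sum_(0 <= i < n.+1) F (inord i).
Proof. by rewrite big_mkord; apply: eq_bigr => i _; rewrite inord_val. Qed.

Lemma sum3 (V : nmodType) (F : 'I_3 -> V) :
  \sum_(i < 3) F i = F (inord 0) + F (inord 1) + F (inord 2).
Proof. by rewrite sum_inord !big_nat_recr //= big_nil add0r. Qed.

Lemma sum4 (V : nmodType) (F : 'I_4 -> V) :
  \sum_(i < 4) F i = F (inord 0) + F (inord 1) + F (inord 2) + F (inord 3).
Proof. by rewrite sum_inord !big_nat_recr //= big_nil add0r. Qed.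

Variable k : fieldType.

Lemma complete_cols r s (V : 'M[k]_(r + s, r)) : \rank V = r ->
  (* The matrix C below comes from the rank normal form of V and has V as its first r columns; B is
     its inverse. *)
  exists2 B : 'M[k]_(r + s), B \in unitmx & B *m V = col_mx 1%:M 0.
Proof.
move=> rV; pose C := col_ebase V *m block_mx (row_ebase V) 0 0 1%:M.
have uC : C \in unitmx.
  rewrite unitmx_mul col_ebase_unit unitmxE det_lblock det1 mulr1 -unitmxE.
  exact: row_ebase_unit.
exists (invmx C); first by rewrite unitmx_inv.
have -> : V = C *m col_mx 1%:M 0.
  rewrite /C -mulmxA mul_block_col !mulmx1 !mul0mx !addr0.
  rewrite -{1}[V]mulmx_ebase -mulmxA; congr (_ *m _).
  rewrite rV; have -> : @pid_mx k (r + s) r r = col_mx 1%:M 0.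
    exact: pid_mx_col.
  by rewrite mul_col_mx !mul1mx mul0mx add0r.
by rewrite mulKmx.
Qed.

Lemma inj_row_free_cols m n (f : 'rV[k]_m) (y : 'M[k]_(m, n)) : row_free y ->
  (forall j, (f *m col j y) 0 0 = 0) -> f = 0.
Proof.
move=> fy h; apply: (row_free_inj fy); rewrite mul0mx.
apply/rowP => j; have := h j; rewrite !mxE => e; rewrite -[RHS]e.
by apply: eq_bigr => i _; rewrite !mxE.
Qed.

End LinearAlgebra.

Section ConicClassification.

Variable k : closedFieldType.

Definition qform n (S : 'M[k]_n) (v : 'cV[k]_n) : k := (v^T *m S *m v) 0 0.

Lemma qform_mul m n (S : 'M[k]_m) (P : 'M[k]_(m, n)) v :
  qform S (P *m v) = qform (P^T *m S *m P) v.
Proof. by rewrite /qform trmx_mul !mulmxA. Qed.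

Local Notation "v `_ i" := (v (inord i) 0) : ring_scope.

Lemma qform3E (S : 'M[k]_3) v : let s i j := S (inord i) (inord j) in
  qform S v = s 0%N 0%N * v`_0 * v`_0 + s 1%N 1%N * v`_1 * v`_1
  + s 2%N 2%N * v`_2 * v`_2 + (s 0%N 1%N + s 1%N 0%N) * v`_0 * v`_1
  + (s 0%N 2%N + s 2%N 0%N) * v`_0 * v`_2 + (s 1%N 2%N + s 2%N 1%N) * v`_1 * v`_2.
Proof. by rewrite /qform /= mxE sum3 !mxE !sum3 !mxE; ring. Qed.

Definition mk3 (a b c : k) : 'cV[k]_3 := \col_i nth 0 [:: a; b; c] i.

Lemma mk3E a b c : ((mk3 a b c)`_0 = a) * ((mk3 a b c)`_1 = b) * ((mk3 a b c)`_2 = c).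
Proof. by rewrite !mxE !inordK. Qed.

(** S is upper triangular instead of symmetric, which covers characteristic 2. The values at e_i and
    e_i + e_j determine all six coefficients, so some value is nonzero. *)
Lemma conic_qform (c : 'cV[k]_6) : c != 0 ->
  exists S, (forall v, qform S v = conic_fun c v) /\ exists v, qform S v != 0.
Proof.
move=> c0; pose s (i j : nat) := match i, j with
  | 0, 0 => c`_0 | 1, 1 => c`_1 | 2, 2 => c`_2
  | 0, 1 => c`_3 | 0, 2 => c`_4 | 1, 2 => c`_5 | _, _ => 0 end.
pose S : 'M[k]_3 := \matrix_(i, j) s i j.
have SE v : qform S v = c`_0 * v`_0 * v`_0 + c`_1 * v`_1 * v`_1 + c`_2 * v`_2 * v`_2
    + c`_3 * v`_0 * v`_1 + c`_4 * v`_0 * v`_2 + c`_5 * v`_1 * v`_2.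
  by rewrite qform3E !mxE !inordK //= !addr0.
exists S; split=> [v|].
  by rewrite SE /conic_fun sum_inord !big_nat_recr //= big_nil !inordK //=; ring.
have [|h] := boolP [exists i : 'I_6, qform S (nth 0 [:: mk3 1 0 0; mk3 0 1 0; mk3 0 0 1;
   mk3 1 1 0; mk3 1 0 1; mk3 0 1 1] i) != 0]; first by case/existsP => i hi; eexists; exact: hi.
case/negP: c0; apply/eqP/matrixP => i j; rewrite ord1 mxE.
have {}h i' : (i' < 6)%N -> qform S (nth 0 [:: mk3 1 0 0; mk3 0 1 0; mk3 0 0 1;
   mk3 1 1 0; mk3 1 0 1; mk3 0 1 1] i') = 0.
  move=> hi; apply/eqP; apply: contraR h => hh.
  by apply/existsP; exists (Ordinal hi).
have := (h 0 isT, h 1 isT, h 2 isT, h 3 isT, h 4 isT, h 5 isT)%N.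
rewrite /= !SE !mk3E !(mulr0, mulr1, addr0, add0r).
case=> [[[[[e0 e1] e2] +] +] +]; rewrite e0 e1 e2 !(addr0, add0r) => e3 e4 e5.
suff hc m : (m < 6)%N -> c`_m = 0 by rewrite -[i]inord_val hc.
by case: m => [|[|[|[|[|[|m]]]]]].
Qed.

Lemma binary_quad_split (a b c : k) : exists l1 m1 l2 m2, forall y z,
  a * y * y + b * y * z + c * z * z = (l1 * y + m1 * z) * (l2 * y + m2 * z).
Proof.
have [->|a0] := eqVneq a 0.
  by exists 0, 1, b, c => y z; ring.
have [r] := @solve_monicpoly k 2 (fun i => if i is 0%N then - c / a else - b / a) isT.
rewrite !big_ord_recl big_ord0 /= expr0 expr1 addr0 mulr1 => er.
exists 1, (- r), a, (a * r + b) => y z.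
have -> : c = - a * r ^+ 2 - b * r by rewrite er; field.
by ring.
Qed.

Lemma mx3_unit (f : nat -> nat -> k) :
  explicit_det3 (f 0%N) (f 1%N) (f 2%N) != 0 ->
  (\matrix_(i < 3, j < 3) f i j) \in unitmx.
Proof.
rewrite unitmxE unitfE laplaceE /= /explicit_det3 => h.
by apply: contraNneq h => h; rewrite -[X in _ == X]h; apply/eqP; ring.
Qed.

(** With z moved to (1, 0, 0) the form is w0 (al w1 + be w2) plus a binary form in w1, w2. If the
    linear factor is zero, the binary form splits. Otherwise dividing by it leaves a constant times
    a square: constant zero gives two lines, constant nonzero the standard conic after an explicit
    coordinate change. No square is completed, so characteristic 2 is included. *)
Lemma conic_classification (S : 'M[k]_3) z : z != 0 -> qform S z = 0 ->
  (exists v, qform S v != 0) ->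
  (exists f g : 'rV[k]_3, [/\ f != 0, g != 0 &
     forall v, qform S v = (f *m v) 0 0 * (g *m v) 0 0]) \/
  (exists A : 'M[k]_3, [/\ A \in unitmx, A *m z = mk3 1 0 0 &
     forall v, qform S v = 0 -> (A *m v)`_1 ^+ 2 = (A *m v)`_0 * (A *m v)`_2]).
Proof.
move=> z0 qz [v0 qv0].
have [B uB Bz] : exists2 B : 'M[k]_3, B \in unitmx & B *m z = mk3 1 0 0.
  have [|B uB Bz] := @complete_cols k 1 2 z.
    by rewrite -mxrank_tr rank_rV trmx_eq0 z0.
  exists B => //; rewrite Bz; apply/matrixP => i j; rewrite ord1.
  case: (@split_ordP 1 2 i) => i' ->; rewrite !(@col_mxEu _ 1 2, @col_mxEd _ 1 2).
    by rewrite ord1 !mxE.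
  by rewrite !mxE /=; case: i' => [[|[|]]].
pose T := (invmx B)^T *m S *m invmx B.
have qT v : qform S v = qform T (B *m v) by rewrite -qform_mul mulKmx.
have splits (f g : 'rV[k]_3) : (forall w, qform T w = (f *m w) 0 0 * (g *m w) 0 0) ->
    exists f g : 'rV[k]_3, [/\ f != 0, g != 0 &
     forall v, qform S v = (f *m v) 0 0 * (g *m v) 0 0].
  move=> h; have e v : qform S v = (f *m B *m v) 0 0 * (g *m B *m v) 0 0.
    by rewrite qT h !mulmxA.
  exists (f *m B), (g *m B); split=> //; apply: contraNneq qv0 => h0.
    by rewrite e h0 mul0mx mxE mul0r.
  by rewrite e h0 mul0mx [X in _ * X]mxE mulr0.
have smooth (M : 'M[k]_3) : M \in unitmx -> M *m mk3 1 0 0 = mk3 1 0 0 ->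
    (forall w, qform T w = 0 -> (M *m w)`_1 ^+ 2 = (M *m w)`_0 * (M *m w)`_2) ->
    exists A : 'M[k]_3, [/\ A \in unitmx, A *m z = mk3 1 0 0 &
     forall v, qform S v = 0 -> (A *m v)`_1 ^+ 2 = (A *m v)`_0 * (A *m v)`_2].
  move=> uM Me h; exists (M *m B); split; first by rewrite unitmx_mul uM.
    by rewrite -mulmxA Bz.
  by move=> v; rewrite qT => /h; rewrite !mulmxA.
move: qz; rewrite qT Bz; move: (qform3E T) => /=.
set a0 : k := T _ _; set a1 : k := T (inord 1) (inord 1).
set a2 : k := T (inord 2) (inord 2); set al := _ + _; set be := T (inord 0) (inord 2) + _.
set de := T (inord 1) (inord 2) + _ => TE.
rewrite TE !mk3E !(mulr0, mulr1, addr0) => a00.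
have {a00}TE w : qform T w = w`_0 * (al * w`_1 + be * w`_2)
    + (a1 * w`_1 * w`_1 + de * w`_1 * w`_2 + a2 * w`_2 * w`_2).
  by rewrite TE a00; ring.
have lin a b c (w : 'cV_3) : ((mk3 a b c)^T *m w) 0 0 = a * w`_0 + b * w`_1 + c * w`_2.
  by rewrite mxE sum3 ![(_^T) _ _]mxE !mk3E.
have linM (f : nat -> nat -> k) (w : 'cV_3) i : (i < 3)%N ->
    ((\matrix_(i < 3, j < 3) f i j) *m w)`_i =
    f i 0%N * w`_0 + f i 1%N * w`_1 + f i 2%N * w`_2.
  by move=> hi; rewrite mxE sum3 !mxE !inordK.
have e1E (f : nat -> nat -> k) : f 0%N 0%N = 1 -> f 1%N 0%N = 0 -> f 2%N 0%N = 0 ->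
    (\matrix_(i < 3, j < 3) f i j) *m mk3 1 0 0 = mk3 1 0 0.
  move=> f0 f1 f2; apply/matrixP => i j; rewrite ord1 -[i]inord_val linM //.
  rewrite !mk3E !mulr0 !addr0 mulr1 mxE inordK //.
  by case: i => [[|[|[|i]]] hi].
have [al0|al0] := eqVneq al 0; last first.
  (* The remainder: the binary form at the root w1 = - be / al, w2 = 1 of the linear factor. *)
  pose ka := a1 * be ^+ 2 / al ^+ 2 - de * be / al + a2.
  pose p := de / al - 2%:R * a1 * be / al ^+ 2.
  have TE' w : qform T w = (al * w`_1 + be * w`_2) *
      (w`_0 + a1 / al ^+ 2 * (al * w`_1 + be * w`_2) + p * w`_2) + ka * w`_2 ^+ 2.
    by rewrite TE /p /ka; field.
  have [ka0|ka0] := eqVneq ka 0.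
    left; apply: (splits (mk3 0 al be)^T (mk3 1 (a1 / al) (a1 * be / al ^+ 2 + p))^T) => w.
    by rewrite !lin TE' ka0; field.
  right; pose f (i j : nat) := nth 0 (nth [::] [:: [:: 1; a1 / al; a1 * be / al ^+ 2 + p];
     [:: 0; 0; 1]; [:: 0; - al / ka; - be / ka]] i) j.
  apply: (smooth (\matrix_(i, j) f i j)).
  - apply: mx3_unit; rewrite /explicit_det3 /f /=.
    rewrite [X in X != 0](_ : _ = al / ka); last by ring.
    by rewrite mulf_neq0 ?invr_neq0.
  - exact: e1E.
  move=> w; rewrite TE' !linM // /f /= => e.
  apply: (mulfI ka0); rewrite -[LHS]addr0 -[X in _ + X]oppr0 -[X in _ - X]e.
  by field; rewrite ka0 al0.
have [be0|be0] := eqVneq be 0.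
  left; have [l1 [m1 [l2 [m2 h]]]] := binary_quad_split a1 de a2.
  apply: (splits (mk3 0 l1 m1)^T (mk3 0 l2 m2)^T) => w.
  by rewrite !lin TE al0 be0 h; ring.
have TE' w : qform T w = be * w`_2 * (w`_0 + de / be * w`_1 + a2 / be * w`_2)
   + a1 * w`_1 ^+ 2.
  by rewrite TE al0; field.
have [ka0|ka0] := eqVneq a1 0.
  left; apply: (splits (mk3 0 0 be)^T (mk3 1 (de / be) (a2 / be))^T) => w.
  by rewrite !lin TE' ka0; ring.
right; pose f (i j : nat) := nth 0 (nth [::] [:: [:: 1; de / be; a2 / be];
   [:: 0; 1; 0]; [:: 0; 0; - be / a1]] i) j.
apply: (smooth (\matrix_(i, j) f i j)).
- apply: mx3_unit; rewrite /explicit_det3 /f /=.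
  rewrite [X in X != 0](_ : _ = - be / a1); last by ring.
  by rewrite mulf_neq0 ?invr_neq0 ?oppr_eq0.
- exact: e1E.
move=> w; rewrite TE' !linM // /f /= => e.
apply: (mulfI ka0); rewrite -[LHS]addr0 -[X in _ + X]oppr0 -[X in _ - X]e.
by field; rewrite ka0 be0.
Qed.

(** The separate factor r lets the zero triple also receive a nonzero parameter (u, v). *)
Lemma conic_param (a b c : k) : b ^+ 2 = a * c -> exists r u v,
  [/\ a = r * u ^+ 2, b = r * (u * v), c = r * v ^+ 2 & (u != 0) || (v != 0)].
Proof.
have [->|a0] := eqVneq a 0 => e.
  have -> : b = 0 by apply/eqP; rewrite -sqrf_eq0 e mul0r.
  by exists c, 0, 1; rewrite oner_neq0 orbT; split=> //; ring.
exists a, 1, (b / a); rewrite oner_neq0; split=> //; [ring|by field|].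
by rewrite expr_div_n e; field.
Qed.

End ConicClassification.

(** * d + 4 points *)

Section Gale.

Variable k : closedFieldType.

Lemma rVpoly_horner d (v : 'rV[k]_d) t : (rVpoly v).[t] = \sum_(i < d) v 0 i * t ^+ i.
Proof.
rewrite /rVpoly horner_poly; apply: eq_bigr => i _.
by rewrite insubT // => lt; congr (v _ _ * _); apply: val_inj.
Qed.

Lemma poly0_of_roots n (l : 'I_n -> k) (p : {poly k}) : injective l ->
  (size p <= n)%N -> (forall j, p.[l j] = 0) -> p = 0.
Proof.
move=> il sp hp; apply/eqP/contraT => p0.
have := @max_poly_roots _ p [seq l j | j <- enum 'I_n] p0.
rewrite size_map size_enum_ord map_inj_uniq ?enum_uniq // => lt.
suff : (n < size p)%N by rewrite ltnNge sp.
by apply: lt => //; apply/allP => _ /mapP[j _ ->]; rewrite rootE hp.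
Qed.

(** Vandermonde: a relation between rows is a polynomial of degree at most d with n > d roots. *)
Lemma curve_mx_row_free d n (c l : 'I_n -> k) : (d < n)%N -> injective l ->
  (forall j, c j != 0) -> row_free (curve_mx d c (fun=> 1) l).
Proof.
move=> dn il c0; apply: inj_row_free => v hv.
suff : rVpoly v = 0 by move=> v0; rewrite -[v]rVpolyK v0 linear0.
apply: (poly0_of_roots il) => [|j]; first exact: leq_trans (size_poly _ _) dn.
have /rowP/(_ j) := hv; rewrite !mxE => e; apply: (mulfI (c0 j)).
rewrite rVpoly_horner mulr0 -[RHS]e mulr_sumr; apply: eq_bigr => i _.
by rewrite mxE expr1n mul1r mulrCA.
Qed.

Definition node_prod n (l : 'I_n -> k) j := \prod_(i | i != j) (l j - l i).

Lemma node_prod_neq0 n (l : 'I_n -> k) j : injective l -> node_prod l j != 0.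
Proof.
move=> il; rewrite prodf_seq_neq0; apply/allP => i _; apply/implyP => ne.
by rewrite subr_eq0; apply: contra ne => /eqP/il->.
Qed.

(* The top coefficient of the Lagrange interpolation of X^e. *)
Lemma sum_pow_node_prod n (l : 'I_n.+1 -> k) e : injective l -> (e < n)%N ->
  \sum_j l j ^+ e / node_prod l j = 0.
Proof.
move=> il en; pose q j := \prod_(i | i != j) ('X - (l i)%:P).
have qE j : q j = \prod_(i <- enum (predC1 j)) ('X - (l i)%:P) by rewrite big_enum.
have q_size j : size (q j) = n.+1.
  by rewrite qE size_prod_XsubC -cardE cardC1 card_ord.
have q_monic j : q j \is monic by rewrite qE; exact: monic_prod_XsubC.
pose p := \sum_j (l j ^+ e / node_prod l j) *: q j - 'X^e.
have p0 : p = 0.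
  apply: (poly0_of_roots il) => [|j].
    apply: leq_trans (size_polyD _ _) _; rewrite geq_max size_polyN size_polyXn.
    rewrite (leq_trans en) // andbT; apply: leq_trans (size_sum _ _ _) _.
    by apply/bigmax_leqP => j _; apply: leq_trans (size_scale_leq _ _) _; rewrite q_size.
  rewrite !hornerE horner_sum (bigD1 j) //= big1 ?addr0 => [|i ne].
    rewrite hornerZ; have -> : (q j).[l j] = node_prod l j.
      by rewrite horner_prod; apply: eq_bigr => i _; rewrite !hornerE.
    by rewrite divfK ?node_prod_neq0 // subrr.
  rewrite hornerZ; have -> : (q i).[l j] = 0; last by rewrite mulr0.
  rewrite horner_prod (bigD1 j) /=; last by rewrite eq_sym.
  by rewrite hornerXsubC subrr mul0r.
have := congr1 (fun p : {poly k} => p`_n) p0.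
rewrite coefB coefXn coef0 (gtn_eqF en) subr0 coef_sum => e0.
rewrite -[RHS]e0; apply: eq_bigr => j _; rewrite coefZ.
by have := q_monic j; rewrite monicE lead_coefE q_size => /eqP->; rewrite mulr1.
Qed.

(** Quantified over every x orthogonal to y, of any rank, so that y can be moved or deformed without
    choosing a dual. *)
Definition gale_limit d (y : 'M[k]_(3, d.+4)) :=
  forall x : 'M[k]_(d.+1, d.+4), x *m y^T = 0 -> rnc_limit x.

Lemma gale_limit_mull d (B : 'M[k]_3) (y : 'M[k]_(3, d.+4)) :
  B \in unitmx -> gale_limit y -> gale_limit (B *m y).
Proof.
move=> uB gy x; rewrite trmx_mul mulmxA => e; apply: gy.
by rewrite -[x *m _](mulmxK (_ : B^T \in unitmx)) ?unitmx_tr // e mul0mx.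
Qed.

(** Each entry is a sum of l_j^(i + e) / [node_prod] over d + 4 nodes, with i + e at most d + 2,
    below the top degree d + 3 of interpolation. *)
Lemma curve_gale d (w l : 'I_d.+4 -> k) : injective l -> (forall j, w j != 0) ->
  curve_mx d (fun j => (w j * node_prod l j)^-1) (fun=> 1) l *m
    (curve_mx 2 w (fun=> 1) l)^T = 0.
Proof.
move=> il w0; apply/matrixP => i e; rewrite mxE [RHS]mxE.
rewrite -[RHS](@sum_pow_node_prod _ l (i + e) il); last first.
  by have := ltn_ord i; have := ltn_ord e; lia.
apply: eq_bigr => j _; rewrite !mxE !expr1n exprD.
by have := w0 j; have := node_prod_neq0 j il => ? ?; field; apply/andP.
Qed.

(** The rows of V are orthogonal to C, and since (d + 4) - 3 = d + 1 they span everything orthogonal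
    to C; so x is A V for some A. *)
Lemma gale_limit_curve d (w l : 'I_d.+4 -> k) : injective l ->
  (forall j, w j != 0) -> gale_limit (curve_mx 2 w (fun=> 1) l).
Proof.
move=> il w0 x xy; set C := curve_mx _ _ _ _ in xy.
pose V := curve_mx d (fun j => (w j * node_prod l j)^-1) (fun=> 1) l.
have VC : V *m C^T = 0 by exact: curve_gale.
have rC : \rank C = 3 by apply/eqP; apply: curve_mx_row_free.
have rV : \rank V = d.+1.
  apply/eqP; apply: curve_mx_row_free => // [|j]; first by lia.
  by rewrite invr_neq0 // mulf_neq0 ?node_prod_neq0.
have sV : (V <= kermx C^T)%MS by apply/sub_kermxP.
have : (kermx C^T <= V)%MS.
  by rewrite -(mxrank_leqif_sup sV) mxrank_ker mxrank_tr rC rV; lia.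
move/(submx_trans _) => h; have /submxP[A ->] : (x <= V)%MS.
  by apply: h; apply/sub_kermxP.
exact: rnc_limit_curve_mx.
Qed.

Lemma row_free_generic m n (Y : k -> 'M[k]_(m, n)) : polymx Y ->
  row_free (Y 0) -> generically (fun t => row_free (Y t)).
Proof.
move=> pY /row_freeP[R YR].
have p : polyfun (fun t => \det (Y t *m R)).
  by apply: polyfun_det; exact: polymxM pY (polymx_cst R).
have p0 : \det (Y 0 *m R) != 0 by rewrite YR det1 oner_neq0.
apply: (generically_impl (polyfun_neq0 p p0)) => t.
rewrite -unitfE -unitmxE -row_free_unit /row_free => /eqP r.
by rewrite eqn_leq rank_leq_row -[X in (X <= _)%N]r mxrankM_maxl.
Qed.

(** With R a right inverse of Y 0, the adjugate of Y t R yields a polynomial family P t killed by Y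
    t on the left. Since P 0 = 1 - R Y 0, the matrix x (P 0)^T is x, so x is a limit of matrices
    orthogonal to Y t. *)
Lemma gale_limit0 d (Y : k -> 'M[k]_(3, d.+4)) y : polymx Y ->
  row_free y -> generically (fun t => gale_limit (Y t)) -> Y 0 = y -> gale_limit y.
Proof.
move=> pY fy gY Y0 x; have /row_freeP[R YR] := fy; rewrite -Y0 => xY.
pose M t := Y t *m R.
have pM : polymx M by exact: polymxM pY (polymx_cst R).
pose P t := \det (M t) *: 1%:M - R *m \adj (M t) *m Y t.
have pP : polymx P.
  apply: polymxD; first by apply: polymxZ (polymx_cst _); exact: polyfun_det.
  by apply/polymxN/polymxM => //; apply: polymxM (polymx_cst R) _; exact: polymx_adj.
have YP t : Y t *m P t = 0.
  rewrite mulmxBr -scalemxAr mulmx1 !mulmxA -/(M t) mul_mx_adj.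
  by rewrite mul_scalar_mx subrr.
apply: (@rnc_limit0 _ _ _ (fun t => x *m (P t)^T)).
- by apply: polymxM (polymx_cst x) _; exact: polymx_tr.
- apply: (generically_impl gY) => t; apply.
  by rewrite -mulmxA -trmx_mul YP trmx0 mulmx0.
- rewrite /P /M Y0 YR det1 scale1r adj1 mulmx1 linearB /= trmx1 mulmxBr mulmx1.
  by rewrite trmx_mul mulmxA -Y0 xY mul0mx subr0.
Qed.

Lemma gale_limit_conic d (w u v : 'I_d.+4 -> k) :
  row_free (curve_mx 2 w u v) -> gale_limit (curve_mx 2 w u v).
Proof.
have [l il] := exists_injective k d.+4 => fy.
pose L (f g : 'I_d.+4 -> k) t j := (1 - t) * f j + t * g j.
apply: (@gale_limit0 _ (fun t => curve_mx 2 (L w (fun=> 1) t) (L u (fun=> 1) t) (L v l t))).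
- by apply: polyfun_curve => j; exact: polyfun_line.
- exact: fy.
- apply: (generically_impl (generic_curve w u v il)) => t [hc hu hv].
  rewrite curve_mx_affine //; apply: gale_limit_curve => // j.
  by rewrite mulf_neq0 ?hc ?expf_neq0 ?hu.
- by apply/matrixP => i j; rewrite !mxE /L !subr0 !mul1r !mul0r !addr0.
Qed.

Definition cols3 n (f : 'I_n -> k * k * k) : 'M[k]_(3, n) :=
  \matrix_(i, j) nth 0 [:: (f j).1.1; (f j).1.2; (f j).2] i.

(* The limit for s -> 0 of points on the smooth conics ab = s c^2. *)
Lemma gale_limit_lines d (e : 'I_d.+4 -> bool) (a c : 'I_d.+4 -> k) :
  (forall j, a j != 0) ->
  let y := cols3 (fun j => if e j then (a j, 0, c j) else (0, a j, c j)) in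
  row_free y -> gale_limit y.
Proof.
move=> a0 y fy.
pose q s j := s * (c j ^+ 2 / a j).
pose Y s := cols3 (fun j => if e j then (a j, q s j, c j) else (q s j, a j, c j)).
have pY : polymx Y.
  move=> i j; have pq : polyfun (fun s => s * (c j ^+ 2 / a j)).
    by apply: polyfunM; [exact: polyfun_id|exact: polyfun_cst].
  case: i => [[|[|[|i]]] hi] //; rewrite /Y /cols3.
  - apply: (@polyfun_ext _ (fun s => if e j then a j else q s j)).
      by case: (e j) => //; exact: polyfun_cst.
    by move=> s; rewrite mxE; case: (e j).
  - apply: (@polyfun_ext _ (fun s => if e j then q s j else a j)).
      by case: (e j) => //; exact: polyfun_cst.
    by move=> s; rewrite mxE; case: (e j).
  - apply: (@polyfun_ext _ (fun s => c j)); first exact: polyfun_cst.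
    by move=> s; rewrite mxE; case: (e j).
have Y0 : Y 0 = y.
  by apply/matrixP => i j; rewrite !mxE /q; case: (e j); rewrite mul0r.
apply: (gale_limit0 pY fy _ Y0).
have gY := row_free_generic pY (eq_ind_r (fun y => is_true (row_free y)) fy Y0).
have gs := polyfun_neq0 (t0 := 1) (polyfun_id k) (oner_neq0 k).
apply: (generically_impl (generically_and gY gs)) => s [fYs s0].
(* This matrix sends (u^2, u v, v^2) to (u^2, s v^2, u v), a parametrization of ab = s c^2. *)
pose P (i j : nat) := nth 0 (nth [::] [:: [:: 1; 0; 0]; [:: 0; 0; s]; [:: 0; 1; 0]] i) j.
pose B : 'M[k]_3 := \matrix_(i, j) P i j.
have uB : B \in unitmx.
  apply: mx3_unit; rewrite /explicit_det3 /P /= [X in X != 0](_ : _ = - s) ?oppr_eq0 //.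
  by ring.
have YE : Y s = B *m curve_mx 2 (fun j => if e j then (a j)^-1 else (s * a j)^-1)
    (fun j => if e j then a j else s * c j) (fun j => if e j then c j else a j).
  apply/matrixP => i j; rewrite [RHS]mxE sum3 !mxE !inordK // /q.
  have := a0 j => ?.
  case: i => [[|[|[|i]]] hi] //=; case: (e j) => /=; rewrite /P /=; field => //;
    by apply/andP.
rewrite YE; apply: gale_limit_mull => //; apply: gale_limit_conic.
move: fYs; rewrite YE /row_free => /eqP r.
by rewrite eqn_leq rank_leq_row -[X in (X <= _)%N]r mxrankM_maxr.
Qed.


(** Each point is moved off the node of the line pair along a line of the pair containing it, after
    which [gale_limit_lines] applies; rank 3 persists generically. *)
Lemma gale_limit_reducible d (y : 'M[k]_(3, d.+4)) : row_free y ->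
  (forall j, y (inord 0) j * y (inord 1) j = 0) -> gale_limit y.
Proof.
move=> fy y01; pose e j := y (inord 1) j == 0.
pose a j := if e j then y (inord 0) j else y (inord 1) j.
pose at_ t j := (1 - t) * a j + t * 1; pose c j := y (inord 2) j.
have pat j : polyfun (at_^~ j) by exact: polyfun_line.
pose Y t := cols3 (fun j => if e j then (at_ t j, 0, c j) else (0, at_ t j, c j)).
have pY : polymx Y.
  move=> i j; case: i => [[|[|[|i]]] hi] //; rewrite /Y /cols3.
  - apply: (@polyfun_ext _ (fun t => if e j then at_ t j else 0)).
      by case: (e j) => //; exact: polyfun_cst.
    by move=> s; rewrite mxE; case: (e j).
  - apply: (@polyfun_ext _ (fun t => if e j then 0 else at_ t j)).
      by case: (e j) => //; exact: polyfun_cst.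
    by move=> s; rewrite mxE; case: (e j).
  - apply: (@polyfun_ext _ (fun s => c j)); first exact: polyfun_cst.
    by move=> s; rewrite mxE; case: (e j).
have Y0 : Y 0 = y.
  apply/matrixP => i j; rewrite mxE /at_ /a subr0 mul1r mul0r addr0 /e.
  have := y01 j; case: eqP => [e1 _|/eqP e1 /eqP].
    rewrite -[i in RHS]inord_val; case: i => [[|[|[|i]]] hi] //=.
  rewrite mulf_eq0 (negPf e1) orbF => /eqP e0.
  by rewrite -[i in RHS]inord_val; case: i => [[|[|[|i]]] hi].
apply: (gale_limit0 pY fy _ Y0).
have gY := row_free_generic pY (eq_ind_r (fun y => is_true (row_free y)) fy Y0).
have ga := generically_forall (fun j => generic_line (a j) (oner_neq0 k)).
apply: (generically_impl (generically_and gY ga)) => t [ft at0].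
exact: gale_limit_lines.
Qed.

Theorem rnc_limit_of_psi d (x : 'M[k]_(d.+1, d.+4)) : row_free x ->
  (forall I : {set 'I_d.+4}, #|I| = 6%N -> psi x I = 0) -> rnc_limit x.
Proof.
move=> fx psi0.
have [y fy yx] : exists2 y : 'M[k]_(3, d.+4), row_free y & x *m y^T = 0.
  have r3 : \rank (kermx x^T) = 3.
    by rewrite mxrank_ker mxrank_tr (eqP fx); lia.
  have := row_base_free (kermx x^T); have : (row_base (kermx x^T) <= kermx x^T)%MS.
    by rewrite eq_row_base.
  move: (row_base _); rewrite r3 => y /sub_kermxP yx fy; exists y => //.
  by rewrite -[x]trmxK -trmx_mul yx trmx0.
have /row_freeP[z xz] := fx.
pose N : 'M[k]_(3 + d.+1) := row_mx y^T z.
have cE a b c : det3 y a b c = \det N * cominor x a b c.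
  by rewrite -(cominor_gale a b c yx xz) mulrC.
have [c c0 yc] : exists2 c : 'cV[k]_6, c != 0 & forall i, conic_fun c (col i y) = 0.
  apply: conic_through => i1 i2 i3 i4 i5 i6 l12 l23 l34 l45 l56.
  have eI : enum [set i in [:: i1; i2; i3; i4; i5; i6]] = [:: i1; i2; i3; i4; i5; i6].
    apply: enum_set_eq => [|i]; first by rewrite /= l12 l23 l34 l45 l56.
    by rewrite in_set.
  by rewrite (conic_expr_scale _ _ _ _ _ _ cE) -(psiE x eI) psi0 ?mulr0 // cardE eI.
have [S [SE S0]] := conic_qform c0.
have Sy j : qform S (col j y) = 0 by rewrite SE.
suff gy : gale_limit y by exact: gy yx.
have [j yj] : exists j, col j y != 0.
  apply/existsP; apply: contraT; rewrite negb_exists => /forallP y0.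
  move: fy; have -> : y = 0.
    by apply/matrixP => i j; have := y0 j; rewrite negbK => /eqP/matrixP/(_ i 0); rewrite !mxE.
  by rewrite /row_free mxrank0.
have [[f [g [f0 g0 fg]]]|[A [uA _ Ay]]] := conic_classification yj (Sy j) S0.
  (* The two lines are distinct: if g were a multiple of f, then f^2 would vanish on all columns of
     y, which span the plane. *)
  have ffg : row_free (col_mx f g).
    apply: inj_row_free => v; rewrite -[v]hsubmxK mul_row_col.
    set a := lsubmx v; set b := rsubmx v.
    rewrite [a]mx11_scalar [b]mx11_scalar !mul_scalar_mx.
    move: (a 0 0) (b 0 0) => {}a {}b e.
    have fz : f != 0 -> ~ (forall i, (f *m col i y) 0 0 ^+ 2 = 0).
      move=> /eqP nf h; apply: nf; apply: (inj_row_free_cols fy) => i.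
      by apply/eqP; rewrite -sqrf_eq0 h.
    have [b0|b0] := eqVneq b 0.
      move: e; rewrite b0 scale0r addr0 => /eqP; rewrite scaler_eq0 (negPf f0) orbF.
      by move=> /eqP->; rewrite -[LHS]/(row_mx (0%:M : 'M_1) (0%:M : 'M_1)) !raddf0 row_mx0.
    case: (fz f0) => i; have ge : g = (- (a / b)) *: f.
      apply: (scalerI b0); move/eqP: e; rewrite addrC addr_eq0 => /eqP->.
      by rewrite scalerA mulrN mulrCA divff // mulr1 scaleNr.
    have [a0|a0] := eqVneq a 0.
      by move: g0; rewrite ge a0 mul0r oppr0 scale0r eqxx.
    have := fg (col i y); rewrite Sy ge -scalemxAl [X in _ * X]mxE => /esym/eqP.
    rewrite mulrCA mulf_eq0 oppr_eq0 mulf_eq0 invr_eq0 (negPf a0) (negPf b0) /=.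
    by move=> /eqP.
  have [|B uB BV] := @complete_cols k 2 1 (col_mx f g)^T.
    by rewrite mxrank_tr; apply/eqP.
  pose M := invmx B^T.
  have uM : M \in unitmx by rewrite unitmx_inv unitmx_tr.
  have fgM : col_mx f g = usubmx (M : 'M_(2 + 1, 3)).
    have := congr1 trmx BV; rewrite trmx_mul trmxK => e.
    rewrite -[LHS](mulmxK (_ : B^T \in unitmx)) ?unitmx_tr // e.
    rewrite tr_col_mx trmx1 trmx0 -/M -{1}[M]vsubmxK (@mul_row_col _ _ 2 1).
    by rewrite mul1mx mul0mx addr0.
  have Mf l : M (inord 0) l = f 0 l.
    have /matrixP/(_ (lshift 1 0) l) := fgM; rewrite col_mxEu mxE => ->.
    by congr (M _ _); apply: val_inj; rewrite /= inordK.
  have Mg l : M (inord 1) l = g 0 l.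
    have /matrixP/(_ (rshift 1 0) l) := fgM; rewrite col_mxEd mxE => ->.
    by congr (M _ _); apply: val_inj; rewrite /= inordK.
  have -> : y = invmx M *m (M *m y) by rewrite mulKmx.
  apply: gale_limit_mull; first by rewrite unitmx_inv.
  apply: gale_limit_reducible => //.
    by rewrite /row_free eqmxMfull ?row_full_unit.
  move=> i; rewrite -[RHS](Sy i) fg !mxE; congr (_ * _); apply: eq_bigr => l _.
    by rewrite Mf !mxE.
  by rewrite Mg !mxE.
have /fin_all_exists[w] i := conic_param (Ay _ (Sy i)).
move=> /fin_all_exists[u] /fin_all_exists[v] h.
have Ayc : A *m y = curve_mx 2 w u v.
  apply/matrixP => i l; have [e0 e1 e2 _] := h l.
  have e : (A *m y) i l = (A *m col l y) i 0 by rewrite !mxE; apply: eq_bigr => *; rewrite !mxE.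
  rewrite e [RHS]mxE -{1}[i]inord_val; case: i {e} => [[|[|[|i]]] hi] //=.
  - by rewrite e0 subn0 expr0 mulr1.
  - by rewrite e2 expr0 mul1r.
have -> : y = invmx A *m (A *m y) by rewrite mulKmx.
apply: gale_limit_mull; rewrite ?unitmx_inv // Ayc; apply: gale_limit_conic.
  by rewrite -Ayc /row_free eqmxMfull ?row_full_unit.
Qed.

End Gale.

(** * Degenerate twisted cubics *)

Section CubicLimits.

Variable k : closedFieldType.

Lemma polyfun_if (e : bool) (f g : k -> k) : polyfun f -> polyfun g ->
  polyfun (fun t => if e then f t else g t).
Proof. by case: e. Qed.

Ltac polyfun := repeat first
  [exact: polyfun_cst | exact: polyfun_id | exact: polyfun_line
  | apply: polyfunD | apply: polyfunN | apply: polyfunM | apply: polyfunX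
  | apply: polyfun_if].

Definition mx4 n (f : 'I_n -> seq k) : 'M[k]_(4, n) := \matrix_(i, j) nth 0 (f j) i.

Ltac polyentries :=
  eapply polyfun_ext; [|move=> ?; rewrite mxE /=; reflexivity].

Lemma rnc_limit_cubics n (A : nat -> nat -> k) (x : 'M[k]_(4, n)) :
  (forall j, exists c u v, forall i, x i j = c * (A i 0%N * u ^+ 3 +
     A i 1%N * (u ^+ 2 * v) + A i 2%N * (u * v ^+ 2) + A i 3%N * v ^+ 3)) ->
  rnc_limit x.
Proof.
move=> h; apply: (@rnc_limit_cols _ _ _ (\matrix_(i, j) A i j)) => j.
have [c [u [v e]]] := h j; exists c, u, v => i.
by rewrite e sum4 !mxE !inordK //= ; ring.
Qed.

Definition chain_col (r : nat) (a b : k) : seq k :=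
  match r with 0 => [:: a; b; 0; 0] | 1 => [:: 0; a; b; 0] | _ => [:: 0; 0; a; b] end.

Definition star_col (r : nat) (a b : k) : seq k :=
  match r with 0 => [:: a; b; 0; 0] | 1 => [:: a; 0; b; 0] | _ => [:: a; 0; 0; b] end.

Ltac gen_s0 := apply: (generically_impl
  (polyfun_neq0 (t0 := 1) (polyfun_id k) (oner_neq0 k))) => s s0.

(** The curves [s u^3 : u^2 v : u v^2 : s v^3] for s -> 0. Parameters with v of order s, with u and
    v fixed, or with u of order s tend to the three lines of the chain. *)
Lemma chain_limit_generic n (r : 'I_n -> nat) (a b : 'I_n -> k) :
  (forall j, a j != 0) -> (forall j, b j != 0) ->
  rnc_limit (mx4 (fun j => chain_col (r j) (a j) (b j))).
Proof.
move=> a0 b0.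
pose X s := mx4 (fun j => match r j with
  | 0 => [:: a j; b j; s * (b j ^+ 2 / a j); s ^+ 3 * (b j ^+ 3 / a j ^+ 2)]
  | 1 => [:: s * (a j ^+ 2 / b j); a j; b j; s * (b j ^+ 2 / a j)]
  | _ => [:: s ^+ 3 * (a j ^+ 3 / b j ^+ 2); s * (a j ^+ 2 / b j); a j; b j] end).
apply: (@rnc_limit0 _ _ _ X).
- move=> [[|[|[|[|i]]]] hi] j //; polyentries;
    by case: (r j) => [|[|r']] /=; polyfun.
- gen_s0; apply: (rnc_limit_cubics (A := fun i l => if i == l then
    if (i == 0%N) || (i == 3) then s else 1 else 0)) => j.
  have := a0 j; have := b0 j => bj aj.
  pose c := match r j with 0 => a j / s | 1 => (a j * b j)^-1 | _ => b j / s end.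
  pose u := match r j with 0 => 1 | 1 => a j | _ => s * (a j / b j) end.
  pose v := match r j with 0 => s * (b j / a j) | 1 => b j | _ => 1 end.
  exists c, u, v => -[[|[|[|[|i]]]] hi] //; rewrite mxE /= /c /u /v;
    case: (r j) => [|[|r']] /=; field; rewrite ?s0 ?aj ?bj //.
- apply/matrixP => -[[|[|[|[|i]]]] hi] j //; rewrite !mxE /=;
    case: (r j) => [|[|r']] /=; by rewrite ?expr0n ?mul0r.
Qed.

Lemma chain_limit n (E : 'M[k]_4) (r : 'I_n -> nat) a b :
  rnc_limit (E *m mx4 (fun j => chain_col (r j) (a j) (b j))).
Proof.
apply: rnc_limit_mull.
pose lin (c : 'I_n -> k) t j := (1 - t) * c j + t * 1.
apply: (@rnc_limit0 _ _ _ (fun t => mx4 (fun j => chain_col (r j) (lin a t j) (lin b t j)))).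
- move=> [[|[|[|[|i]]]] hi] j //; polyentries;
    by case: (r j) => [|[|r']] /=; polyfun.
- have ga := generically_forall (fun j => generic_line (a j) (oner_neq0 k)).
  have gb := generically_forall (fun j => generic_line (b j) (oner_neq0 k)).
  apply: (generically_impl (generically_and ga gb)) => t [a0 b0].
  exact: chain_limit_generic.
- by apply/matrixP => i j; rewrite !mxE /lin subr0 !mul1r !mul0r !addr0.
Qed.

(* The curves [l1 l2 l3 : s m l2 l3 : s m l1 l3 : s m l1 l2] for s -> 0, with *)
(* l1 = u, l2 = v, l3 = u + v and m = u + w v.                               *)
Lemma star_limit_generic n (r : 'I_n -> nat) (a b : 'I_n -> k) :
  (forall j, b j != 0) -> rnc_limit (mx4 (fun j => star_col (r j) (a j) (b j))).
Proof.
move=> b0.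
(* The form m takes the values w, 1 and 1 - w at the roots of l1, l2 and l3, and none may vanish. *)
have [w [w0 w1]] : exists w : k, w != 0 /\ 1 - w != 0.
  have p1 : polyfun (fun w : k => 1 - w) by polyfun.
  have p10 : (1 : k) - 0 != 0 by rewrite subr0 oner_neq0.
  apply: generically_ex (generically_and _ (polyfun_neq0 p1 p10)).
  exact: (polyfun_neq0 (t0 := 1) (polyfun_id k) (oner_neq0 k)).
(* On branch r the parameter makes the corresponding linear form equal to s times [be], and the
   weight is [ga] / s; both are solved from the required limit a e_0 + b e_(r+1). *)
pose be j := match r j with
  | 0 => w * a j / b j | 1 => a j / b j | _ => (1 - w) * a j / b j end.
pose ga j := match r j with 0 => b j / w | 1 => b j | _ => - (b j / (1 - w)) end.
pose X s := mx4 (fun j => let p := s * be j in let q := be j in let g := ga j in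
  match r j with
  | 0 => let m := w + p in
     [:: g * (q * (1 + p)); g * (m * (1 + p)); g * (s * (m * (q * (1 + p))));
         g * (s * (m * q))]
  | 1 => let m := 1 + w * p in
     [:: g * (q * (1 + p)); g * (s * (m * (q * (1 + p)))); g * (m * (1 + p));
         g * (s * (m * q))]
  | _ => let m := 1 - w + w * p in
     [:: g * ((p - 1) * q); g * (s * (m * ((p - 1) * q))); g * (s * (m * q));
         g * (m * (p - 1))]
  end).
apply: (@rnc_limit0 _ _ _ X).
- move=> [[|[|[|[|i]]]] hi] j //; polyentries;
    by case: (r j) => [|[|r']] /=; polyfun.
- gen_s0; apply: (rnc_limit_cubics (A := fun i l => nth 0 (nth [::]
    [:: [:: 0; 1; 1; 0]; [:: 0; s; s * (1 + w); s * w]; [:: s; s * (1 + w); s * w; 0];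
        [:: 0; s; s * w; 0]] i) l)) => j.
  pose u := match r j with 0 => s * be j | _ => 1 end.
  pose v := match r j with 0 => 1 | 1 => s * be j | _ => s * be j - 1 end.
  exists (ga j / s), u, v => -[[|[|[|[|i]]]] hi] //; rewrite mxE /= /u /v;
    by case: (r j) => [|[|r']] /=; field.
- apply/matrixP => -[[|[|[|[|i]]]] hi] j //; rewrite !mxE /= /ga /be;
    case: (r j) => [|[|r']] /=; have bj := b0 j;
    field; by rewrite ?w0 ?w1 ?bj.
Qed.

Lemma star_limit n (E : 'M[k]_4) (r : 'I_n -> nat) a b :
  rnc_limit (E *m mx4 (fun j => star_col (r j) (a j) (b j))).
Proof.
apply: rnc_limit_mull.
pose lin (c : 'I_n -> k) t j := (1 - t) * c j + t * 1.
apply: (@rnc_limit0 _ _ _ (fun t => mx4 (fun j => star_col (r j) (a j) (lin b t j)))).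
- move=> [[|[|[|[|i]]]] hi] j //; polyentries;
    by case: (r j) => [|[|r']] /=; polyfun.
- apply: (generically_impl (generically_forall (fun j => generic_line (b j) (oner_neq0 k)))).
  by move=> t b0; exact: star_limit_generic.
- by apply/matrixP => i j; rewrite !mxE /lin subr0 !mul1r !mul0r !addr0.
Qed.

Definition lin_form (al be u v : k) := al * u + be * v.
Definition quad_form2 (p : k * k * k) (u v : k) :=
  p.1.1 * u ^+ 2 + p.1.2 * (u * v) + p.2 * v ^+ 2.

(* Points of the conic {[q(u, v) : u^2 : uv : v^2]} and of the line joining    *)
(* its point with al u + be v = 0 to [1 : 0 : 0 : 0].                         *)
Definition conic_line_col (al be : k) p (e : bool) (c u v a b : k) : seq k :=
  if e then [:: c * quad_form2 p u v; c * u ^+ 2; c * (u * v); c * v ^+ 2]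
  else [:: b * quad_form2 p be (- al) + a; b * be ^+ 2; - (b * (al * be)); b * al ^+ 2].

(* The curves [l q + s h^3 : l u^2 : l u v : l v^2] for s -> 0, where          *)
(* l = al u + be v and h = w1 u - w0 v takes the value 1 at the root of l.     *)
Lemma conic_line_limit_generic n (al be w0 w1 : k) p (e : 'I_n -> bool)
    (c u v a b : 'I_n -> k) : al * w0 + be * w1 = 1 ->
  (forall j, lin_form al be (u j) (v j) != 0) -> (forall j, a j != 0) ->
  rnc_limit (mx4 (fun j => conic_line_col al be p (e j) (c j) (u j) (v j) (a j) (b j))).
Proof.
move=> lw l0 a0; case: p => [[p0 p1] p2].
(* These parameters tend to the root (be, - al) of l, and l equals s b / a there, so that the weight
   a / s turns it into b. *)
pose us s j := be + s * (b j / a j * w0); pose vs s j := - al + s * (b j / a j * w1).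
pose h u v := w1 * u - w0 * v.
pose X s := mx4 (fun j => if e j then
    [:: c j * (quad_form2 (p0, p1, p2) (u j) (v j)
          + s * (h (u j) (v j) ^+ 3 / lin_form al be (u j) (v j)));
        c j * u j ^+ 2; c j * (u j * v j); c j * v j ^+ 2]
  else [:: b j * quad_form2 (p0, p1, p2) (us s j) (vs s j) + a j * h (us s j) (vs s j) ^+ 3;
        b j * us s j ^+ 2; b j * (us s j * vs s j); b j * vs s j ^+ 2]).
apply: (@rnc_limit0 _ _ _ X).
- move=> [[|[|[|[|i]]]] hi] j //; polyentries;
    by case: (e j) => /=; rewrite /us /vs /quad_form2 /h /=; polyfun.
- gen_s0; apply: (rnc_limit_cubics (A := fun i l => nth 0 (nth [::]
    [:: [:: al * p0 + s * w1 ^+ 3; al * p1 + be * p0 - s * (3%:R * w1 ^+ 2 * w0);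
            al * p2 + be * p1 + s * (3%:R * w1 * w0 ^+ 2); be * p2 - s * w0 ^+ 3];
        [:: al; be; 0; 0]; [:: 0; al; be; 0]; [:: 0; 0; al; be]] i) l)) => j.
  have := l0 j; have := a0 j => aj lj.
  exists (if e j then c j / lin_form al be (u j) (v j) else a j / s),
    (if e j then u j else us s j), (if e j then v j else vs s j).
  have ll : lin_form al be (us s j) (vs s j) = s * (b j / a j).
    have -> : s * (b j / a j) = s * (b j / a j) * (al * w0 + be * w1).
      by rewrite lw mulr1.
    by rewrite /lin_form /us /vs; ring.
  have bl : b j = a j / s * lin_form al be (us s j) (vs s j).
    by rewrite ll; field; rewrite s0 aj.
  case ej: (e j).
    by move: lj; rewrite /lin_form => lj [[|[|[|[|i]]]] hi] //;
      rewrite mxE ej /= /quad_form2 /h /lin_form /=; field.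
  move: ll bl; set U := us s j; set V := vs s j => _ bl.
  by move=> [[|[|[|[|i]]]] hi] //; rewrite mxE ej /= -/U -/V bl /quad_form2 /h /lin_form /=; field.
- apply/matrixP => i j; rewrite !mxE /conic_line_col; case: (e j).
    by rewrite mul0r addr0.
  rewrite /us /vs !mul0r !addr0; congr (nth _ [:: _ + _; _; _; _] _).
  - rewrite /h (_ : w1 * be - w0 * - al = 1) ?expr1n ?mulr1 //.
    by rewrite -lw; ring.
  - by ring.
  - by ring.
Qed.

Lemma conic_line_limit n (al be : k) p (e : 'I_n -> bool) (c u v a b : 'I_n -> k) :
  (al != 0) || (be != 0) ->
  rnc_limit (mx4 (fun j => conic_line_col al be p (e j) (c j) (u j) (v j) (a j) (b j))).
Proof.
move=> nz; have [w0 [w1 lw]] : exists w0 w1, al * w0 + be * w1 = 1.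
  case/orP: nz => z; first by exists al^-1, 0; rewrite mulfV // mulr0 addr0.
  by exists 0, be^-1; rewrite mulfV // mulr0 add0r.
pose ut t j := (1 - t) * u j + t * w0; pose vt t j := (1 - t) * v j + t * w1.
pose at_ t j := (1 - t) * a j + t * 1.
apply: (@rnc_limit0 _ _ _ (fun t => mx4 (fun j =>
  conic_line_col al be p (e j) (c j) (ut t j) (vt t j) (at_ t j) (b j)))).
- move=> [[|[|[|[|i]]]] hi] j //; polyentries;
    by case: (e j) => /=; rewrite /ut /vt /at_ /quad_form2; polyfun.
- have ga := generically_forall (fun j => generic_line (a j) (oner_neq0 k)).
  have gl := generically_forall (fun j => generic_line (lin_form al be (u j) (v j)) (oner_neq0 k)).
  apply: (generically_impl (generically_and ga gl)) => t [a0 l0].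
  apply: (conic_line_limit_generic _ _ _ _ lw) => // j.
  suff -> : lin_form al be (ut t j) (vt t j) =
    (1 - t) * lin_form al be (u j) (v j) + t * (al * w0 + be * w1) by rewrite lw.
  by rewrite /lin_form /ut /vt; ring.
- by apply/matrixP => i j; rewrite !mxE /ut /vt /at_ subr0 !mul1r !mul0r !addr0.
Qed.

(** The hypothesis is the vanishing of the cubic at the root (be, - al) of the linear form. *)
Lemma cubic_div_lin (al be k0 k1 k2 k3 : k) : (al != 0) || (be != 0) ->
  k0 * be ^+ 3 - k1 * (be ^+ 2 * al) + k2 * (be * al ^+ 2) - k3 * al ^+ 3 = 0 ->
  exists p, forall u v, k0 * u ^+ 3 + k1 * (u ^+ 2 * v) + k2 * (u * v ^+ 2) + k3 * v ^+ 3
    = lin_form al be u v * quad_form2 p u v.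
Proof.
have [->|al0] := eqVneq al 0 => /= [be0|_] e.
  have k00 : k0 = 0.
    move/eqP: e; rewrite !(expr0n, mulr0, subr0, addr0) mulf_eq0 expf_eq0.
    by rewrite (negPf be0) orbF => /eqP.
  exists (k1 / be, k2 / be, k3 / be) => u v.
  by rewrite k00 /lin_form /quad_form2 /=; field.
pose q0 := k0 / al; pose q1 := (k1 - be * q0) / al; pose q2 := (k2 - be * q1) / al.
exists (q0, q1, q2) => u v; rewrite /lin_form /quad_form2 /=.
have k3E : k3 = be * q2.
  apply: (mulfI (expf_neq0 3 al0)); apply/eqP; rewrite -subr_eq0 -oppr_eq0 -[X in _ == X]e.
  by apply/eqP; rewrite /q2 /q1 /q0; field.
by rewrite k3E /q2 /q1 /q0; field.
Qed.

(** Let K be the cubic with coefficients k0, ..., k3. If K is nonzero at the root of l, the points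
    lie on [K : l u^2 : l u v : l v^2], which passes through the vertex at that root. Otherwise K =
    l q, and they lie on the conic [q : u^2 : u v : v^2] and on the ruling over the root. *)
Lemma cone_curve_limit n (al be k0 k1 k2 k3 : k) (a c u v : 'I_n -> k) :
  (al != 0) || (be != 0) -> (forall j, (u j != 0) || (v j != 0)) ->
  (forall j, c j = 0 \/ a j * lin_form al be (u j) (v j) =
     c j * (k0 * u j ^+ 3 + k1 * (u j ^+ 2 * v j) + k2 * (u j * v j ^+ 2) + k3 * v j ^+ 3)) ->
  rnc_limit (mx4 (fun j => [:: a j; c j * u j ^+ 2; c j * (u j * v j); c j * v j ^+ 2])).
Proof.
move=> nz uv0 h; pose C u v := k0 * u ^+ 3 + k1 * (u ^+ 2 * v) + k2 * (u * v ^+ 2) + k3 * v ^+ 3.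
have root j : lin_form al be (u j) (v j) = 0 -> exists2 r, r != 0 & u j = r * be /\ v j = r * - al.
  rewrite /lin_form => l0; have [al0|al0] := eqVneq al 0.
    have be0 : be != 0 by move: nz; rewrite al0 eqxx.
    have vj : v j = 0 by move/eqP: l0; rewrite al0 mul0r add0r mulf_eq0 (negPf be0) => /eqP.
    exists (u j / be); last by rewrite divfK // vj al0 oppr0 mulr0.
    by rewrite mulf_neq0 ?invr_neq0 //; have := uv0 j; rewrite vj eqxx orbF.
  have uj : u j = - (be * v j) / al.
    by move/eqP: l0; rewrite addr_eq0 => /eqP <-; rewrite mulrAC mulfV ?mul1r.
  have vj : v j != 0.
    apply/eqP => vj; have := uv0 j; rewrite uj vj !(mulr0, oppr0, mul0r) eqxx //.
  exists (- (v j / al)); first by rewrite oppr_eq0 mulf_neq0 ?invr_neq0.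
  by rewrite uj; split; field.
have [C0|C0] := eqVneq (C be (- al)) 0.
  have [|p CE] := @cubic_div_lin al be k0 k1 k2 k3 nz.
    by rewrite -[RHS]C0 /C; ring.
  pose e j := (c j != 0) && (lin_form al be (u j) (v j) != 0).
  pose b j := if c j == 0 then 0 else
    if be == 0 then c j * v j ^+ 2 / al ^+ 2 else c j * u j ^+ 2 / be ^+ 2.
  have -> : mx4 (fun j => [:: a j; c j * u j ^+ 2; c j * (u j * v j); c j * v j ^+ 2])
     = mx4 (fun j => conic_line_col al be p (e j) (c j) (u j) (v j)
        (a j - b j * quad_form2 p be (- al)) (b j)).
    apply/matrixP => i j; rewrite !mxE /e /b /conic_line_col.
    have [cj|cj] /= := eqVneq (c j) 0; first by rewrite !mul0r !subr0 add0r oppr0 cj !mul0r.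
    have [lj|lj] /= := eqVneq (lin_form al be (u j) (v j)) 0.
      have [r r0 [-> ->]] := root _ lj; rewrite addrCA subrr addr0.
      have [be0|be0] := eqVneq be 0.
        have al0 : al != 0 by move: nz; rewrite be0 eqxx orbF.
        congr (nth 0 [:: _; _; _; _] i); rewrite ?be0; field => //.
      congr (nth 0 [:: _; _; _; _] i); field => //.
    case: (h j) => [e0|]; first by rewrite e0 eqxx in cj.
    rewrite CE => e1; congr (nth 0 [:: _; _; _; _] i).
    by apply: (mulIf lj); rewrite e1; ring.
  exact: conic_line_limit.
apply: (rnc_limit_cubics (A := fun i l => nth 0 (nth [::] [:: [:: k0; k1; k2; k3];
   [:: al; be; 0; 0]; [:: 0; al; be; 0]; [:: 0; 0; al; be]] i) l)) => j.
have [cj|cj] := eqVneq (c j) 0.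
  exists (a j / C be (- al)), be, (- al) => -[[|[|[|[|i]]]] hi] //; rewrite mxE /= ?cj /C.
  - by field.
  - by ring.
  - by ring.
  - by ring.
have lj : lin_form al be (u j) (v j) != 0.
  apply/eqP => lj; case: (h j) => [e0|]; first by rewrite e0 eqxx in cj.
  rewrite lj mulr0 => /esym/eqP; have [r r0 [-> ->]] := root _ lj.
  apply/negP; rewrite mulf_neq0 //.
  have := mulf_neq0 (expf_neq0 3 r0) C0; congr (_ != 0); rewrite /C; ring.
exists (c j / lin_form al be (u j) (v j)), (u j), (v j).
case: (h j) => [e0|hj]; first by rewrite e0 eqxx in cj.
have aj : a j = c j / lin_form al be (u j) (v j) * C (u j) (v j).
  by apply: (mulIf lj); rewrite hj /C; field.
move=> [[|[|[|[|i]]]] hi] //; rewrite mxE /=.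
- by rewrite aj.
all: by move: lj; rewrite /lin_form => lj; field.
Qed.

End CubicLimits.

(** * Points of P^3 on quadric cones *)

Section Cones.

Variable k : closedFieldType.

Lemma col_mul m n p (j : 'I_p) (A : 'M[k]_(m, n)) (B : 'M_(n, p)) :
  col j (A *m B) = A *m col j B.
Proof. by rewrite !colE mulmxA. Qed.

(* Every point of x is the vertex of a quadric cone through all of x. *)
Definition cone_cond n (x : 'M[k]_(4, n)) :=
  forall j (P : 'M[k]_(3, 4)), row_free P -> P *m col j x = 0 ->
  exists2 c : 'cV[k]_6, c != 0 & forall i, conic_fun c (P *m col i x) = 0.

Lemma cone_condM n A (x : 'M[k]_(4, n)) : A \in unitmx -> cone_cond x -> cone_cond (A *m x).
Proof.
move=> uA cx j P fP; rewrite col_mul mulmxA => Pj.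
have [|c c0 h] := cx j (P *m A) _ Pj.
  by rewrite /row_free mxrankMfree // row_free_unit.
by exists c => // i; rewrite col_mul mulmxA.
Qed.

Lemma conic_expr_eq (T T' : Type) (R : comNzRingType) (D : T -> T -> T -> R)
    (D' : T' -> T' -> T' -> R) h a b c d e f :
  (forall a b c, D (h a) (h b) (h c) = D' a b c) ->
  conic_expr D (h a) (h b) (h c) (h d) (h e) (h f) = conic_expr D' a b c d e f.
Proof. by move=> E; rewrite /conic_expr !E. Qed.

(** For j and six other points, [cominor_project] reads psi on the points projected from j, and
    [conic_expr_cominor] passes from complementary brackets to the brackets themselves, so the six
    images lie on a conic. Sextuples containing j are trivial, since j projects to 0. *)
Lemma cone_cond_of_psi n (x : 'M[k]_(4, n)) : (forall j, col j x != 0) ->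
  (forall (J : {set 'I_n}) (I : {set 'I_7}), #|J| = 7%N -> #|I| = 6%N ->
     psi (cols 7 x J : 'M_(3.+1, 3.+4)) I = 0) -> cone_cond x.
Proof.
move=> x0 psi0 j P fP Pj; pose r := P *m x.
have [i1 i2 i3 i4 i5 i6 l12 l23 l34 l45 l56|c c0 h] := @conic_through k n r; last first.
  by exists c => // i; rewrite -col_mul.
have rj l : r l j = 0.
  by have /matrixP/(_ l 0) := Pj; rewrite -col_mul !mxE.
pose s := [:: i1; i2; i3; i4; i5; i6].
have [js|js] := boolP (j \in s).
  by move: js; rewrite !inE => /or4P[|||/or3P[]] /eqP e;
    rewrite /conic_expr !det3E /explicit_det3 -!e !rj; ring.
have ss : sorted (fun i i' : 'I_n => (i < i')%N) s by rewrite /= l12 l23 l34 l45 l56.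
have us : uniq s.
  by apply: (sorted_uniq _ _ ss) => [a b c|a]; [exact: ltn_trans|exact: ltnn].
pose J := [set i in j :: s].
have cJ : #|J| = 7%N by rewrite cardsE; apply/card_uniqP; rewrite /= js.
have sJ := enum_set_sorted J.
have zJ : size (enum J) = 7%N by rewrite -cardE.
have jJ : j \in enum J by rewrite mem_enum inE mem_head.
have ltj : (index j (enum J) < 7)%N by rewrite -zJ index_mem.
pose j0 : 'I_7 := Ordinal ltj; pose x' := cols 7 x J.
have x'E i l : x' i l = x i (nth j (enum J) l) by exact: cols_seq.
have Jj0 : nth j (enum J) j0 = j by exact: nth_index.
have eS : [seq nth j (enum J) (lift j0 a) | a <- enum 'I_6] = s.
  rewrite -(enum_set_eq (A := [set i in s]) ss) => [|i]; last by rewrite in_set.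
  apply/esym/enum_set_eq.
    rewrite sorted_map; apply: (@sub_sorted _ (fun h h' : 'I_6 => (h < h')%N)).
      move=> a b ab; apply: (sorted_ltn_nth _ _ sJ); rewrite ?inE ?zJ ?ltn_ord ?ltn_lift //.
      by move=> ? ? ?; exact: ltn_trans.
    by have := iota_ltn_sorted 0 6; rewrite -val_enum_ord sorted_map.
  have uJ : uniq (enum J) by exact: enum_uniq.
  move=> i; rewrite inE; apply/mapP/idP => [[a _ ->]|si].
    have : nth j (enum J) (lift j0 a) \in J by rewrite -mem_enum mem_nth // zJ.
    rewrite inE in_cons => /orP[/eqP e|//].
    have /eqP := e; rewrite -{2}Jj0 nth_uniq ?zJ // => /eqP/val_inj/eqP.
    by rewrite eq_sym (negPf (neq_lift _ _)).
  have iJ : i \in enum J by rewrite mem_enum inE in_cons si orbT.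
  have lti : (index i (enum J) < 7)%N by rewrite -zJ index_mem.
  have ne : j0 != Ordinal lti.
    apply/eqP => /(congr1 (nth j (enum J) \o val)) /=; rewrite !nth_index // => e.
    by rewrite e si in js.
  by case: (unlift_some ne) => a ea _; exists a; rewrite ?mem_enum // -ea /= nth_index.
have Sa (a : 'I_6) : nth j (enum J) (lift j0 a) = nth j s a.
  by rewrite -eS (nth_map ord0) ?size_enum_ord // nth_ord_enum.
have [f fj] : exists f : 'rV[k]_4, f *m col j x = 1.
  have /eqP/matrixP h := x0 j; have [i xi] : exists i, x i j != 0.
    apply/existsP; apply: contraT; rewrite negb_exists => /forallP h'.
    by case: h => i i'; rewrite !mxE; apply/eqP; have := h' i; rewrite negbK.
  exists ((x i j)^-1 *: delta_mx 0 i); apply/matrixP => a b; rewrite !ord1.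
  by rewrite -scalemxAl -rowE !mxE mulVf.
have xj0 : col j0 x' = col j x.
  by apply/matrixP => a b; rewrite [LHS]mxE x'E Jj0 mxE.
have f1 : f *m col j0 x' = 1 by rewrite xj0.
have P1 : P *m col j0 x' = 0 by rewrite xj0.
pose de := \det (col_mx f P : 'M[k]_(1 + 3)).
have de0 : de != 0.
  rewrite -unitfE -unitmxE -row_free_unit; apply: inj_row_free => v.
  rewrite -[v]hsubmxK (@mul_row_col _ _ 1 3) => e.
  have v0 : lsubmx (v : 'M_(1, 1 + 3)) = 0.
    have := congr1 (mulmx^~ (col j x)) e; rewrite /= mulmxDl mul0mx -!mulmxA fj Pj.
    by rewrite mulmx0 addr0 mulmx1.
  move: e; rewrite v0 mul0mx add0r => e.
  have -> : rsubmx (v : 'M_(1, 1 + 3)) = 0 by apply: (row_free_inj fP); rewrite e mul0mx.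
  by rewrite row_mx0.
pose r' := col' j0 (P *m x'); pose la := (-1) ^+ (3 + j0) / de.
have cE a b c : cominor (x' : 'M_(3.+1, 3.+4)) (lift j0 a) (lift j0 b) (lift j0 c) =
    la * cominor (r' : 'M_(2.+1, 2.+4)) a b c.
  apply: (mulfI de0); rewrite (cominor_project a b c f1 P1) /la.
  by rewrite mulrA mulrCA divff ?mulr1.
have eI : enum (~: [set j0]) = [seq lift j0 a | a <- enum 'I_6].
  apply: enum_set_eq.
    rewrite sorted_map (eq_sorted (e' := fun h h' : 'I_6 => (h < h')%N)).
      by have := iota_ltn_sorted 0 6; rewrite -val_enum_ord sorted_map.
    by move=> a b; exact: ltn_lift.
  move=> i; rewrite !inE; apply/mapP/idP => [[a _ ->]|].
    by rewrite eq_sym neq_lift.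
  by rewrite eq_sym => /unlift_some[a -> _]; exists a; rewrite ?mem_enum.
have e6 : enum 'I_6 = [:: @Ordinal 6 0 isT; @Ordinal 6 1 isT; @Ordinal 6 2 isT;
    @Ordinal 6 3 isT; @Ordinal 6 4 isT; @Ordinal 6 5 isT].
  by apply: (inj_map val_inj); rewrite val_enum_ord.
have := psi0 J (~: [set j0]) cJ; rewrite -/x' cardE eI size_map size_enum_ord => /(_ erefl).
rewrite (psiE _ (eq_trans eI (congr1 _ e6))).
rewrite (@conic_expr_eq _ _ _ _ _ (lift j0) _ _ _ _ _ _ (fun a b c => erefl)).
rewrite (conic_expr_scale _ _ _ _ _ _ cE) (conic_expr_cominor r') mulrN => /eqP.
rewrite oppr_eq0 mulf_eq0 expf_eq0 /= mulf_eq0 signr_eq0 invr_eq0 (negPf de0) /=.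
move=> /eqP <-.
have r'E l (a : 'I_6) : r' l a = r l (nth j s a).
  rewrite mxE -Sa !mxE; apply: eq_bigr => i _; by rewrite x'E.
by rewrite /conic_expr !det3E /explicit_det3 !r'E.
Qed.

End Cones.

(** * Points on three lines *)

Section Lines.

Variable k : closedFieldType.

Definition ev m (f : 'rV[k]_m) (v : 'cV[k]_m) : k := (f *m v) 0 0.

Lemma evD m f (u v : 'cV[k]_m) : ev f (u + v) = ev f u + ev f v.
Proof. by rewrite /ev mulmxDr mxE. Qed.

Lemma evZ m f a (v : 'cV[k]_m) : ev f (a *: v) = a * ev f v.
Proof. by rewrite /ev -scalemxAr mxE. Qed.

Definition indep (f g : 'rV[k]_4) := f != 0 /\ exists v, ev f v = 0 /\ ev g v != 0.

Lemma ev_neq0 m (f : 'rV[k]_m) : f != 0 -> exists v, ev f v != 0.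
Proof.
move=> /matrix0Pn[i [j fj]]; exists (delta_mx j 0).
by rewrite /ev -colE mxE; rewrite ord1 in fj.
Qed.

Lemma indep_neq0 f g : indep f g -> g != 0.
Proof. by move=> [_ [v [_]]]; apply: contraNneq => ->; rewrite /ev mul0mx mxE. Qed.

Lemma indep_sym f g : indep f g -> indep g f.
Proof.
move=> fg; split; first exact: indep_neq0 fg.
have [f0 [v [fv gv]]] := fg; have [w fw] := ev_neq0 f0.
exists (w + (- (ev g w / ev g v)) *: v); rewrite !evD !evZ fv; split; last by rewrite mulr0 addr0.
by field.
Qed.

Lemma indepP f g : f != 0 -> indep f g \/ (forall v, ev f v = 0 -> ev g v = 0).
Proof.
move=> f0; have [h|h] := classic (exists v, ev f v = 0 /\ ev g v != 0); first by left.
by right=> v fv; apply/eqP/contraT => gv; case: h; exists v.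
Qed.

Lemma common_kernel (f g h : 'rV[k]_4) :
  exists2 v, v != 0 & [/\ ev f v = 0, ev g v = 0 & ev h v = 0].
Proof.
pose M := col_mx f (col_mx g h); have : cokermx M != 0.
  by rewrite -mxrank_eq0 mxrank_coker -lt0n subn_gt0; exact: leq_ltn_trans (rank_leq_row M) _.
case/matrix0Pn => i [j cij]; exists (col j (cokermx M)).
  by apply/eqP => /matrixP/(_ i 0); rewrite mxE [RHS]mxE => e; rewrite e eqxx in cij.
have : M *m col j (cokermx M) = 0 by rewrite !colE mulmxA mulmx_coker mul0mx.
rewrite mul_col_mx mul_col_mx -[0]vsubmxK => /eq_col_mx[e1].
rewrite -[dsubmx 0]vsubmxK => /eq_col_mx[e2 e3].
by rewrite /ev e1 e2 e3 !mxE.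
Qed.

Lemma indep_row_free f g : indep f g -> row_free (col_mx f g : 'M_(1 + 1, 4)).
Proof.
move=> fg; have [g0 [u [gu fu]]] := indep_sym fg; have [_ [v [fv gv]]] := fg.
apply: inj_row_free => w; rewrite -[w]hsubmxK mul_row_col => e.
have h z : (lsubmx w : 'M_(1, 1)) 0 0 * ev f z + (rsubmx w : 'M_(1, 1)) 0 0 * ev g z = 0.
  have := congr1 (fun M => (M *m z) 0 0) e; rewrite mulmxDl mul0mx mxE -!mulmxA.
  by rewrite [RHS]mxE => <-; rewrite /ev !mxE !big_ord1 !mxE.
have l0 : lsubmx w = 0 :> 'M_1.
  have /eqP := h u; rewrite gu mulr0 addr0 mulf_eq0 (negPf fu) orbF => /eqP e0.
  by apply/matrixP => i j; rewrite !ord1 e0 mxE.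
have r0 : rsubmx w = 0 :> 'M_1.
  have /eqP := h v; rewrite fv mulr0 add0r mulf_eq0 (negPf gv) orbF => /eqP e0.
  by apply/matrixP => i j; rewrite !ord1 e0 mxE.
by rewrite l0 r0 row_mx0.
Qed.

Lemma line_basis f g c : indep f g -> c != 0 -> ev f c = 0 -> ev g c = 0 ->
  exists e, forall v, ev f v = 0 -> ev g v = 0 -> exists a b, v = a *: c + b *: e.
Proof.
move=> /indep_row_free fg c0 fc gc.
have [|B uB BV] := @complete_cols k 2 2 (col_mx f g)^T.
  by rewrite mxrank_tr; apply/eqP.
have uT : B^T \in unitmx by rewrite unitmx_tr.
pose b2 : 'cV[k]_4 := B^T *m delta_mx (inord 2) 0.
pose b3 : 'cV[k]_4 := B^T *m delta_mx (inord 3) 0.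
have span v : ev f v = 0 -> ev g v = 0 -> exists p q, v = p *: b2 + q *: b3.
  move=> fv gv; have [w vw] : exists w : 'cV[k]_4, v = B^T *m w.
    by exists (invmx B^T *m v); rewrite mulKVmx.
  have w0 : col_mx f g *m v = 0.
    rewrite mul_col_mx -[RHS]col_mx0; congr col_mx;
      by apply/matrixP => i j; rewrite !ord1 [RHS]mxE.
  have := congr1 trmx BV; rewrite trmx_mul trmxK tr_col_mx trmx1 trmx0 => BT.
  rewrite vw mulmxA BT -[w](@vsubmxK _ 2 2) (@mul_row_col _ _ 2 2) mul1mx mul0mx addr0 in w0.
  have wi i : (i < 2)%N -> w (inord i) 0 = 0.
    move=> hi; have /matrixP/(_ (Ordinal hi) 0) := w0; rewrite !mxE => <-.
    by congr (w _ _); apply: val_inj; rewrite /= inordK //; lia.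
  exists (w (inord 2) 0), (w (inord 3) 0).
  rewrite vw /b2 /b3 !scalemxAr -mulmxDr; congr (_ *m _); apply/matrixP => i j.
  rewrite ord1 !mxE !andbT -[i]inord_val -!val_eqE /= !inordK //.
  case: i => [[|[|[|[|i]]]] hi] //=.
  - by rewrite [LHS]wi // !mulr0 addr0.
  - by rewrite [LHS]wi // !mulr0 addr0.
  - by rewrite mulr1 mulr0 addr0.
  - by rewrite mulr1 mulr0 add0r.
have [p [q cE]] := span _ fc gc.
have [p0|p0] := eqVneq p 0.
  have q0 : q != 0 by apply: contraNneq c0 => q0; rewrite cE p0 q0 !scale0r addr0.
  exists b2 => v fv gv; have [p' [q' ->]] := span _ fv gv.
  exists (q' / q), p'; rewrite cE p0 scale0r add0r scalerA divfK // addrC //.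
exists b3 => v fv gv; have [p' [q' ->]] := span _ fv gv.
exists (p' / p), (q' - p' / p * q); rewrite cE scalerDr !scalerA divfK //.
by rewrite scalerBl -[RHS]addrA; congr (_ + _); rewrite addrC subrK.
Qed.


Lemma chain_limit_cols n (x : 'M[k]_(4, n)) (E0 E1 E2 E3 : 'cV[k]_4) :
  (forall j, [\/ exists a b, col j x = a *: E0 + b *: E1,
     exists a b, col j x = a *: E1 + b *: E2 |
     exists a b, col j x = a *: E2 + b *: E3]) -> rnc_limit x.
Proof.
pose E : 'M[k]_4 := \matrix_(i, l) nth E0 [:: E0; E1; E2; E3] l i 0.
move=> h; have /fin_all_exists[r] j : exists (r : nat) a b, col j x =
    (nth 0 (chain_col r a b) 0 *: E0 + nth 0 (chain_col r a b) 1 *: E1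
     + nth 0 (chain_col r a b) 2 *: E2 + nth 0 (chain_col r a b) 3 *: E3).
  by case: (h j) => -[a [b ->]]; [exists 0%N|exists 1%N|exists 2%N]; exists a, b;
    rewrite /= !scale0r ?addr0 ?add0r.
move=> /fin_all_exists[a] /fin_all_exists[b] xE.
have -> : x = E *m mx4 (fun j => chain_col (r j) (a j) (b j)); last exact: chain_limit.
apply/matrixP => i j; have /matrixP/(_ i 0) := xE j; rewrite mxE => ->.
by rewrite [RHS]mxE sum4 !mxE !inordK //=; ring.
Qed.

Lemma star_limit_cols n (x : 'M[k]_(4, n)) (E0 E1 E2 E3 : 'cV[k]_4) :
  (forall j, [\/ exists a b, col j x = a *: E0 + b *: E1,
     exists a b, col j x = a *: E0 + b *: E2 |
     exists a b, col j x = a *: E0 + b *: E3]) -> rnc_limit x.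
Proof.
pose E : 'M[k]_4 := \matrix_(i, l) nth E0 [:: E0; E1; E2; E3] l i 0.
move=> h; have /fin_all_exists[r] j : exists (r : nat) a b, col j x =
    (nth 0 (star_col r a b) 0 *: E0 + nth 0 (star_col r a b) 1 *: E1
     + nth 0 (star_col r a b) 2 *: E2 + nth 0 (star_col r a b) 3 *: E3).
  by case: (h j) => -[a [b ->]]; [exists 0%N|exists 1%N|exists 2%N]; exists a, b;
    rewrite /= !scale0r ?addr0 ?add0r.
move=> /fin_all_exists[a] /fin_all_exists[b] xE.
have -> : x = E *m mx4 (fun j => star_col (r j) (a j) (b j)); last exact: star_limit.
apply/matrixP => i j; have /matrixP/(_ i 0) := xE j; rewrite mxE => ->.
by rewrite [RHS]mxE sum4 !mxE !inordK //=; ring.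
Qed.

(** The middle line f = h = 0 meets the first line in c, inside the plane f, and the last in c',
    inside the plane h. If c and c' are proportional the lines concur and form a star; otherwise
    they form a chain with inner vertices c and c'. *)
Lemma three_lines_limit n (x : 'M[k]_(4, n)) f h g1 g3 :
  indep f g1 -> indep f h -> indep h g3 ->
  (forall j, let on f g := ev f (col j x) = 0 /\ ev g (col j x) = 0 in
     [\/ on f g1, on f h | on h g3]) -> rnc_limit x.
Proof.
move=> fg1 fh hg3 hx.
have [c c0 [fc hc g1c]] := common_kernel f h g1.
have [c' c'0 [fc' hc' g3c']] := common_kernel f h g3.
have [e1 E1] := line_basis fg1 c0 fc g1c.
have [e2 E2] := line_basis fh c0 fc hc.
have [e3 E3] := line_basis hg3 c'0 hc' g3c'.
have [a [b c'E]] := E2 _ fc' hc'; have [b0|b0] := eqVneq b 0.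
  have a0 : a != 0.
    by apply: contraNneq c'0 => a0; rewrite c'E a0 b0 !scale0r addr0.
  apply: (@star_limit_cols _ _ c e1 e2 e3) => j.
  case: (hx j) => -[h1 h2]; [constructor 1; exact: E1|constructor 2; exact: E2|].
  have [p [q ->]] := E3 _ h1 h2; constructor 3; exists (p * a), q.
  by rewrite c'E b0 scale0r addr0 scalerA.
apply: (@chain_limit_cols _ _ e1 c c' e3) => j; case: (hx j) => -[h1 h2].
- by have [p [q ->]] := E1 _ h1 h2; constructor 1; exists q, p; rewrite addrC.
- have [p [q ->]] := E2 _ h1 h2; constructor 2; exists (p - q / b * a), (q / b).
  by rewrite c'E scalerDr !scalerA divfK // addrA scalerBl subrK.
- by constructor 3; exact: E3.
Qed.

Definition spanning n (x : 'M[k]_(4, n)) :=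
  forall f : 'rV[k]_4, f != 0 -> exists j, ev f (col j x) != 0.

Definition two_planes n (x : 'M[k]_(4, n)) j f g :=
  [/\ f != 0, g != 0, ev f (col j x) = 0, ev g (col j x) = 0 &
      forall i, ev f (col i x) * ev g (col i x) = 0].

Lemma two_planes_sym n (x : 'M[k]_(4, n)) j f g : two_planes x j f g -> two_planes x j g f.
Proof. by case=> ? ? ? ? h; split=> // i; rewrite mulrC. Qed.

Lemma two_planesP n (x : 'M[k]_(4, n)) j f g i : two_planes x j f g ->
  ev f (col i x) = 0 \/ ev g (col i x) = 0.
Proof.
by case=> _ _ _ _ /(_ i) /eqP; rewrite mulf_eq0 => /orP[] /eqP; [left|right].
Qed.

Lemma line_span f g c c' h : indep f g -> c != 0 -> ev f c = 0 -> ev g c = 0 ->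
  ev f c' = 0 -> ev g c' = 0 -> ev h c = 0 -> ev h c' != 0 ->
  forall v, ev f v = 0 -> ev g v = 0 -> exists a b, v = a *: c + b *: c'.
Proof.
move=> fg c0 fc gc fc' gc' hc hc' v fv gv.
have [e E] := line_basis fg c0 fc gc; have [a [b c'E]] := E _ fc' gc'.
have b0 : b != 0.
  by apply: contraNneq hc' => b0; rewrite c'E b0 scale0r addr0 evZ hc mulr0.
have [p [q ->]] := E _ fv gv; exists (p - q / b * a), (q / b).
by rewrite c'E scalerDr !scalerA divfK // addrA scalerBl subrK.
Qed.

(** * Configurations all of whose cones are pairs of planes *)

Section TwoPlanes.

Variables (n : nat) (x : 'M[k]_(4, n)).
Hypothesis x_span : spanning x.
Hypothesis x_neq0 : forall j, col j x != 0.
Hypothesis x_planes : forall j, exists f g, two_planes x j f g.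

(** All points off the plane f lie on the line g = h = 0. Split the cone at one of them, b: one of
    its planes contains every point off f, and both planes cut f in lines carrying the remaining
    points. *)
Lemma limit_plane_line j0 f g a h : two_planes x j0 f g ->
  ev g (col a x) != 0 -> ev h (col a x) = 0 -> h != 0 ->
  (forall i, ev f (col i x) != 0 -> ev h (col i x) = 0) -> rnc_limit x.
Proof.
move=> fg ga ha h0 Bh; have [f0 g0 _ _ _] := fg.
have hg : indep h g by split=> //; exists (col a x).
have Bg i : ev f (col i x) != 0 -> ev g (col i x) = 0.
  by move/eqP => fi; case: (two_planesP i fg).
have [b fb] := x_span f0.
have [f' [g' [fg' Bf']]] : exists f' g', two_planes x b f' g' /\
    forall i, ev f (col i x) != 0 -> ev f' (col i x) = 0.
  have [f' [g' fg']] := x_planes b; have [f'0 g'0 f'b g'b _] := fg'.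
  have [Bf'|/not_all_ex_not[b2 nb2]] :=
    classic (forall i, ev f (col i x) != 0 -> ev f' (col i x) = 0).
    by exists f', g'.
  exists g', f'; split=> [|i fi]; first exact: two_planes_sym.
  have [fb2 /eqP f'b2] := imply_to_and _ _ nb2.
  case: (two_planesP i fg') => // f'i.
  have g'b2 : ev g' (col b2 x) = 0 by case: (two_planesP b2 fg') => // /eqP; rewrite (negPf f'b2).
  (* The plane g' contains b and b2, which span the line g = h = 0, hence it contains all points off
     f. *)
  have [p [q iE]] := line_span hg (x_neq0 b) (Bh _ fb) (Bg _ fb) (Bh _ fb2) (Bg _ fb2)
    f'b f'b2 (Bh _ fi) (Bg _ fi).
  by rewrite iE evD !evZ g'b g'b2 !mulr0 addr0.
have [f'0 g'0 f'b g'b _] := fg'.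
have f'f : indep f' f by split=> //; exists (col b x).
have g'f : indep g' f by split=> //; exists (col b x).
(* The independent forms g and h cannot both be multiples of f'. *)
have [g3 f'g3 Bg3] : exists2 g3, indep f' g3 &
    forall i, ev f (col i x) != 0 -> ev g3 (col i x) = 0.
  have [f'g|f'g] := indepP g f'0; first by exists g.
  have [f'h|f'h] := indepP h f'0; first by exists h.
  have [_ [v [hv gv]]] := hg; have [w fw] := ev_neq0 f'0.
  have [_ [v' [gv' hv']]] := indep_sym hg.
  pose u := v + (- (ev f' v / ev f' v')) *: v'.
  have [f'v'|f'v'] := eqVneq (ev f' v') 0.
    by move: hv'; rewrite f'h // eqxx.
  have f'u : ev f' u = 0 by rewrite /u evD evZ; field.
  have := f'g _ f'u; rewrite /u evD evZ gv' mulr0 addr0 => gv0.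
  by rewrite gv0 eqxx in gv.
apply: (three_lines_limit (indep_sym g'f) (indep_sym f'f) f'g3) => j.
have [fj|fj] := eqVneq (ev f (col j x)) 0; last first.
  by constructor 3; split; [exact: Bf'|exact: Bg3].
by case: (two_planesP j fg') => e; [constructor 2|constructor 1].
Qed.

(** Points off g lie in the plane f. If the cone at one of them has f as a component, the points off
    f lie on a line. Otherwise the cone at such a point a cuts f and g in lines, and three of these
    carry all points unless both lines in f are needed, by points a2 and a3 off g; then the cone at
    a3 would have to contain f, a contradiction. *)
Lemma limit_two_planes (j0 : 'I_n) : rnc_limit x.
Proof.
have [f [g fg]] := x_planes j0; have [f0 g0 f1 g1 _] := fg.
have [[a [fa [ga [ha [pa dep]]]]]|ndep] := classic (exists a fa, ev g (col a x) != 0 /\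
    exists ga, two_planes x a fa ga /\ (forall v, ev f v = 0 -> ev fa v = 0)).
  have [fa0 ga0 _ gaa _] := pa.
  apply: (limit_plane_line (h := ha) fg ga gaa ga0) => i fi.
  case: (two_planesP i pa) => // fai.
  have [v fav] := ev_neq0 fa0; case/negP: fav; apply/eqP.
  have : ev fa (v + (- (ev f v / ev f (col i x))) *: col i x) = 0.
    by apply: dep; rewrite evD evZ; field.
  by rewrite evD evZ fai mulr0 addr0.
have ind a fa ga : ev g (col a x) != 0 -> two_planes x a fa ga -> indep f fa.
  move=> ga0 pa; have [//|dep] := indepP fa f0.
  by case: ndep; exists a, fa; split=> //; exists ga.
have Af a : ev g (col a x) != 0 -> ev f (col a x) = 0.
  by move/eqP => gan; case: (two_planesP a fg).
have [a ga] := x_span g0; have fa := Af _ ga.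
have [fa' [ga' [pa fa1]]] : exists fa ga, two_planes x a fa ga /\ ev fa (col j0 x) = 0.
  have [fa' [ga' pa]] := x_planes a.
  case: (two_planesP j0 pa) => e; first by exists fa', ga'.
  by exists ga', fa'; split=> //; exact: two_planes_sym.
have [fa'0 ga'0 fa'a ga'a _] := pa.
have ffa := ind _ _ _ ga pa; have fga := ind _ _ _ ga (two_planes_sym pa).
have fag : indep fa' g by split=> //; exists (col a x).
have gag : indep ga' g by split=> //; exists (col a x).
have [[a2 [ga2 fa2 ga'2]]|n2] := classic (exists a2, [/\ ev g (col a2 x) != 0,
    ev fa' (col a2 x) = 0 & ev ga' (col a2 x) != 0]); last first.
  apply: (three_lines_limit (indep_sym fga) gag (indep_sym fag)) => j.
  have [gj|gj] := eqVneq (ev g (col j x)) 0.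
    by case: (two_planesP j pa) => e; [constructor 3|constructor 2].
  constructor 1; split; last exact: Af.
  apply/eqP/contraT => ga'j; case: n2; exists j; split=> //.
  by case: (two_planesP j pa) => // e; rewrite e eqxx in ga'j.
have [[a3 [ga3 ga'3 fa3]]|n3] := classic (exists a3, [/\ ev g (col a3 x) != 0,
    ev ga' (col a3 x) = 0 & ev fa' (col a3 x) != 0]); last first.
  apply: (three_lines_limit (indep_sym ffa) fag (indep_sym gag)) => j.
  have [gj|gj] := eqVneq (ev g (col j x)) 0.
    by case: (two_planesP j pa) => e; [constructor 2|constructor 3].
  constructor 1; split; last exact: Af.
  apply/eqP/contraT => fa'j; case: n3; exists j; split=> //.
  by case: (two_planesP j pa) => // e; rewrite e eqxx in fa'j.
have [f3 [g3 [p3 f31]]] : exists f3 g3, two_planes x a3 f3 g3 /\ ev f3 (col j0 x) = 0.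
  have [f3 [g3 p3]] := x_planes a3.
  case: (two_planesP j0 p3) => e; first by exists f3, g3.
  by exists g3, f3; split=> //; exact: two_planes_sym.
have [f30 g30 f33 g33 _] := p3.
have span v : ev f v = 0 -> exists p q r, v = p *: col j0 x + q *: col a x + r *: col a3 x.
  move=> fv; pose r := ev fa' v / ev fa' (col a3 x).
  have [||p [q pq]] := line_span ffa (x_neq0 j0) f1 fa1 fa fa'a g1 ga
    (v := v + (- r) *: col a3 x).
  - by rewrite evD evZ fv Af // mulr0 addr0.
  - by rewrite evD evZ /r; field.
  by exists p, q, r; rewrite -pq -addrA -scalerDl addNr scale0r addr0.
have absurd h : (forall v, ev f v = 0 -> ev h v = 0) -> indep f h -> False.
  by move=> dep [_ [v [/dep-> /eqP]]].
(* The plane f is spanned by the columns j0, a and a3, and f3 already vanishes on j0 and a3. *)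
have f3a : ev f3 (col a x) != 0.
  apply/eqP => f3a; apply: (absurd f3) (ind _ _ _ ga3 p3) => v /span[p [q [r ->]]].
  by rewrite !evD !evZ f31 f3a f33 !mulr0 !addr0.
have g3a : ev g3 (col a x) = 0.
  by case: (two_planesP a p3) => // e; rewrite e eqxx in f3a.
have [p [q a2E]] := line_span ffa (x_neq0 j0) f1 fa1 fa fa'a g1 ga (Af _ ga2) fa2.
have p0 : p != 0.
  by apply: contraNneq ga'2 => p0; rewrite a2E p0 scale0r add0r evZ ga'a mulr0.
have q0 : q != 0.
  by apply: contraNneq ga2 => q0; rewrite a2E q0 scale0r addr0 evZ g1 mulr0.
have f32 : ev f3 (col a2 x) != 0 by rewrite a2E evD !evZ f31 mulr0 add0r mulf_neq0.
have g32 : ev g3 (col a2 x) = 0.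
  by case: (two_planesP a2 p3) => // e; rewrite e eqxx in f32.
have g31 : ev g3 (col j0 x) = 0.
  move/eqP: g32; rewrite a2E evD !evZ g3a mulr0 addr0 mulf_eq0 (negPf p0).
  by move=> /eqP.
case: (absurd g3 _ (ind _ _ _ ga3 (two_planes_sym p3))) => v /span[p' [q' [r ->]]].
by rewrite !evD !evZ g31 g3a g33 !mulr0 !addr0.
Qed.

End TwoPlanes.

End Lines.

(** * Points on an irreducible cone *)

Section SmoothCone.

Variable k : closedFieldType.

Lemma row_free_spanning n (x : 'M[k]_(4, n)) : row_free x -> spanning x.
Proof.
move=> fx f f0; apply: NNPP => h; case/eqP: f0.
apply: (inj_row_free_cols fx) => j; apply/eqP/contraT => fj.
by case: h; exists j.
Qed.

Lemma rnc_limit_unit n A (x : 'M[k]_(4, n)) : A \in unitmx ->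
  rnc_limit (A *m x) -> rnc_limit x.
Proof. by move=> uA gx; rewrite -(mulKmx uA x); exact: rnc_limit_mull. Qed.

Definition vec4 (a b c d : k) : 'cV[k]_4 := \col_i nth 0 [:: a; b; c; d] i.

Local Notation "v `_ i" := (v (inord i) 0) : ring_scope.

Lemma vec4E a b c d : ((vec4 a b c d)`_0 = a) * ((vec4 a b c d)`_1 = b) *
  ((vec4 a b c d)`_2 = c) * ((vec4 a b c d)`_3 = d).
Proof. by rewrite !mxE !inordK. Qed.

Lemma vec4_eta (v : 'cV[k]_4) : v = vec4 (v`_0) (v`_1) (v`_2) (v`_3).
Proof.
apply/matrixP => i j; rewrite ord1 mxE -{1}[i]inord_val.
by case: i => [[|[|[|[|i]]]] hi].
Qed.

Lemma two_cols_normal (u v : 'cV[k]_4) : u != 0 -> (forall a, v != a *: u) ->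
  exists2 B : 'M[k]_4, B \in unitmx & B *m u = vec4 1 0 0 0 /\ B *m v = vec4 0 1 0 0.
Proof.
move=> u0 vu; have fr : row_free (row_mx u v : 'M_(4, 1 + 1))^T.
  apply: inj_row_free => w; rewrite -[w]hsubmxK tr_row_mx (@mul_row_col _ _ 1 1).
  rewrite [lsubmx w]mx11_scalar [rsubmx w]mx11_scalar !mul_scalar_mx.
  move: (lsubmx w 0 0) (rsubmx w 0 0) => a b e.
  have {}e : a *: u + b *: v = 0.
    by apply: (can_inj trmxK); rewrite linearD !linearZ /= e trmx0.
  have b0 : b = 0.
    apply/eqP/contraT => b0; case/eqP: (vu (- (a / b))).
    apply: (scalerI b0); rewrite scalerA mulrN mulrCA mulfV // mulr1 scaleNr.
    by apply/eqP; rewrite -addr_eq0 addrC e.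
  have a0 : a = 0.
    by move/eqP: e; rewrite b0 scale0r addr0 scaler_eq0 (negPf u0) orbF => /eqP.
  by rewrite a0 b0 !raddf0 row_mx0.
have [|B uB BV] := @complete_cols k 2 2 (row_mx u v).
  by rewrite -mxrank_tr; apply/eqP.
exists B => //.
have {}BV : row_mx (B *m u) (B *m v) = col_mx 1%:M 0 :> 'M_(2 + 2, 1 + 1).
  by rewrite -mul_mx_row.
split.
  have := congr1 lsubmx BV; rewrite row_mxKl => ->.
  by apply/matrixP => i j; rewrite ord1 !mxE; case: splitP => l /= il; rewrite !mxE il;
    case: l il => [[|[|l]] hl].
have := congr1 rsubmx BV; rewrite row_mxKr => ->.
by apply/matrixP => i j; rewrite ord1 !mxE; case: splitP => l /= il; rewrite !mxE il;
  case: l il => [[|[|l]] hl].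
Qed.

(** Projection from point j turns the cone into a plane conic through the image of m. A split conic
    lifts to two planes through j; otherwise the projected coordinates are normalized and the
    coordinate along the vertex is left alone. *)
Lemma smooth_normal_form n (x : 'M[k]_(4, n)) j m : cone_cond x ->
  col j x != 0 -> (forall a, col m x != a *: col j x) ->
  (exists f g, two_planes x j f g) \/
  exists2 A : 'M[k]_4, A \in unitmx & [/\ A *m col j x = vec4 1 0 0 0,
    A *m col m x = vec4 0 1 0 0 & forall i, let y := A *m col i x in
      y`_2 ^+ 2 = y`_1 * y`_3].
Proof.
move=> cx xj xm; have [B uB [Bj Bm]] := two_cols_normal xj xm.
pose P : 'M[k]_(3, 1 + 3) := row_mx 0 1%:M.
have PE v : P *m v = mk3 (v`_1) (v`_2) (v`_3).
  rewrite -[v](@vsubmxK _ 1 3) (@mul_row_col _ _ 1 3) mul0mx mul1mx add0r vsubmxK.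
  apply/matrixP => i l; rewrite ord1 !mxE.
  case: i => [[|[|[|i]]] hi] //=; congr (v _ _); apply: val_inj; by rewrite /= inordK.
have fP : row_free P.
  by apply/row_freeP; exists P^T; rewrite /P tr_row_mx (@mul_row_col _ _ 1 3) trmx0
    mul0mx trmx1 mul1mx add0r.
have [|c c0 xc] := cone_condM uB cx (j := j) fP.
  by rewrite col_mul Bj PE !vec4E; apply/matrixP => i l; rewrite !mxE; case: i => [[|[|[|i]]] hi].
have [S [SE S0]] := conic_qform c0.
have xS i : qform S (P *m (B *m col i x)) = 0 by rewrite SE -col_mul xc.
have zE : P *m (B *m col m x) = mk3 1 0 0 by rewrite Bm PE !vec4E.
have z0 : mk3 1 0 0 != 0 :> 'cV[k]_3.
  by apply/eqP => /matrixP/(_ 0 0); rewrite !mxE /= => /eqP; rewrite oner_eq0.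
have zS : qform S (mk3 1 0 0) = 0 by rewrite -zE.
have Pj : P *m (B *m col j x) = 0.
  by rewrite Bj PE !vec4E; apply/matrixP => i l; rewrite !mxE; case: i => [[|[|[|i]]] hi].
have [[f [g [f0 g0 fg]]]|[A [uA Ae Ay]]] := conic_classification z0 zS S0.
  left; exists (f *m P *m B), (g *m P *m B).
  have nz h : h != 0 -> h *m P *m B != 0.
    apply: contraNneq => e; apply/eqP/(row_free_inj fP); rewrite mul0mx.
    by apply: (can_inj (mulmxK uB)); rewrite mul0mx.
  split; rewrite ?nz // /ev -?mulmxA ?Pj ?mulmx0 ?mxE //.
  by move=> i; rewrite -!mulmxA -fg xS.
right; pose A4 : 'M[k]_(1 + 3) := block_mx 1%:M 0 0 A.
have uA4 : A4 \in unitmx by rewrite unitmxE det_lblock det1 mul1r -unitmxE.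
have A4E (v : 'cV[k]_4) : let y := A *m (P *m v) in A4 *m v = vec4 (v`_0) (y`_0) (y`_1) (y`_2).
  move=> y; have -> : A4 *m v = col_mx ((v`_0)%:M : 'M_1) y.
    have vE : v = col_mx ((v`_0)%:M : 'M_(1, 1)) (P *m v).
      rewrite -{1}[v](@vsubmxK _ 1 3); apply: (congr2 (@col_mx _ 1 3 1)).
        apply/matrixP => a b; rewrite !ord1 !mxE mulr1n; congr (v _ _).
        by apply: val_inj; rewrite /= inordK.
      by rewrite -[in RHS](@vsubmxK _ 1 3 _ v) (@mul_row_col _ _ 1 3) mul0mx mul1mx add0r.
    by rewrite {1}vE /A4 (@mul_block_col _ 1 3) mul1mx !mul0mx addr0 add0r.
  apply/matrixP => a b; rewrite ord1 mxE; case: splitP => l /= al; rewrite !mxE al.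
    by rewrite ord1 mulr1n.
  by rewrite -[l]inord_val; case: l al => [[|[|[|l]]] hl] //= _; rewrite inordK.
exists (A4 *m B); first by rewrite unitmx_mul uA4.
split=> [||i y]; rewrite -?mulmxA ?A4E.
- by rewrite Pj Bj mulmx0 vec4E !mxE.
- by rewrite zE Ae Bm vec4E !mk3E.
- by rewrite /y -mulmxA A4E !vec4E; apply: Ay.
Qed.

(** The points lie on three rulings of the cone, which concur at the vertex. *)
Lemma cone_star_limit n (y : 'M[k]_(4, n)) l1 m1 l2 m2 (a c u v : 'I_n -> k) :
  (forall i, col i y = vec4 (a i) (c i * u i ^+ 2) (c i * (u i * v i)) (c i * v i ^+ 2)) ->
  (l1 != 0) || (m1 != 0) -> (l2 != 0) || (m2 != 0) ->
  (forall i, c i = 0 \/ v i = 0 \/ l1 * u i + m1 * v i = 0 \/ l2 * u i + m2 * v i = 0) ->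
  rnc_limit y.
Proof.
move=> yE n1 n2 h.
pose R l m := vec4 0 (m ^+ 2) (- (l * m)) (l ^+ 2).
have lin a' b c' d p q r s t t' : a' = t * p -> b = t' * q -> c' = t' * r -> d = t' * s ->
    vec4 a' b c' d = t *: vec4 p 0 0 0 + t' *: vec4 0 q r s.
  move=> -> -> -> ->; apply/matrixP => -[[|[|[|[|i]]]] hi] j //; rewrite !mxE /=; ring.
have line l m i : (l != 0) || (m != 0) -> v i != 0 -> l * u i + m * v i = 0 ->
    exists p q, col i y = p *: vec4 1 0 0 0 + q *: R l m.
  move=> nz vi e; have l0 : l != 0.
    apply/eqP => l0; move/eqP: e; rewrite l0 mul0r add0r mulf_eq0 (negPf vi) orbF => /eqP m0.
    by move: nz; rewrite l0 m0 eqxx.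
  have ue : u i = - (m * v i) / l.
    by move/eqP: e; rewrite addr_eq0 => /eqP <-; rewrite mulrAC mulfV ?mul1r.
  exists (a i), (c i * (v i / l) ^+ 2); rewrite yE; apply: lin; rewrite ?mulr1 // ?ue; by field.
apply: (@star_limit_cols _ _ _ (vec4 1 0 0 0) (vec4 0 1 0 0) (R l1 m1) (R l2 m2)) => i.
have [v0|v0] := eqVneq (v i) 0.
  constructor 1; exists (a i), (c i * u i ^+ 2); rewrite yE v0; apply: lin; ring.
case: (h i) => [c0|[e|[e|e]]].
- constructor 1; exists (a i), 0; rewrite yE c0; apply: lin; ring.
- by rewrite e eqxx in v0.
- by constructor 2; exact: line.
- by constructor 3; exact: line.
Qed.

Lemma nonzero_split (a b c : k) : (a, b, c) != (0, 0, 0) ->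
  exists l1 m1 l2 m2, [/\ (l1 != 0) || (m1 != 0), (l2 != 0) || (m2 != 0) &
  forall y z, a * y * y + b * y * z + c * z * z = (l1 * y + m1 * z) * (l2 * y + m2 * z)].
Proof.
move=> nz; have [l1 [m1 [l2 [m2 h]]]] := binary_quad_split a b c.
exists l1, m1, l2, m2; suff nz' : ~ (forall p q, a * p * p + b * p * q + c * q * q = 0).
  split=> //; rewrite -negb_and; apply/negP => /andP[/eqP e1 /eqP e2].
    by apply: nz' => p q; rewrite h e1 e2 !mul0r addr0 mul0r.
  by apply: nz' => p q; rewrite h e1 e2 !mul0r addr0 mulr0.
move=> e; case/eqP: nz.
have a0 : a = 0 by have := e 1 0; rewrite !(mulr1, mulr0, addr0).
have c0 : c = 0 by have := e 0 1; rewrite !(mulr1, mulr0, add0r).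
have b0 : b = 0 by have := e 1 1; rewrite a0 c0 !(mulr1, mul0r, addr0, add0r).
by rewrite a0 b0 c0.
Qed.

(** On an unsplit cone the points are [a : c u^2 : c u v : c v^2], and the cone of vertex m becomes
    c v (a l + c v q) = 0 with l linear and q quadratic in (u, v). If l is zero, the points lie on
    three rulings. If no point is alone on its ruling, comparing two points of one ruling gives l =
    0 away from v = 0. If m is alone on its ruling, a l = - c v q holds off the vertex and
    [cone_curve_limit] applies. *)
Theorem rnc_limit_of_cones n (x : 'M[k]_(4, n)) : row_free x ->
  (forall j, col j x != 0) -> cone_cond x -> rnc_limit x.
Proof.
move=> fx x0 cx; have sx := row_free_spanning fx.
have [planes|/not_all_ex_not[j nj]] := classic (forall j, exists f g, two_planes x j f g).
  have [j _] : exists j, ev (delta_mx 0 0) (col j x) != 0.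
    by apply: sx; apply/matrix0Pn; exists 0, 0; rewrite mxE !eqxx oner_neq0.
  exact: (limit_two_planes sx x0 planes j).
have [m0 xm0] : exists m, forall a, col m x != a *: col j x.
  have [f f0 fj] : exists2 f : 'rV[k]_4, f != 0 & ev f (col j x) = 0.
    have [v v0 [h _ _]] := common_kernel (col j x)^T (col j x)^T (col j x)^T.
    exists v^T; rewrite ?trmx_eq0 // /ev.
    by rewrite -[col j x]trmxK -trmx_mul mxE.
  have [m fm] := sx f f0; exists m => a.
  by apply: contraNneq fm => ->; rewrite evZ fj mulr0.
pose isolated m := forall i s t, col i x = s *: col j x + t *: col m x -> s = 0 \/ t = 0.
have [m [xm miso]] : exists m, (forall a, col m x != a *: col j x) /\
    (isolated m \/ forall m', (forall a, col m' x != a *: col j x) -> ~ isolated m').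
  have [[m [xm im]]|h] := classic (exists m, (forall a, col m x != a *: col j x) /\ isolated m).
    by exists m; split=> //; left.
  by exists m0; split=> //; right=> m' xm' im'; case: h; exists m'.
have [//|[A uA [Aj Am Ay]]] := smooth_normal_form cx (x0 j) xm.
apply: (rnc_limit_unit uA); pose y := A *m x.
have yE i : col i y = A *m col i x by rewrite col_mul.
have /fin_all_exists[c] i := conic_param (Ay i).
move=> /fin_all_exists[u] /fin_all_exists[v] h.
pose a i : k := (A *m col i x)`_0.
have ycol i : col i y = vec4 (a i) (c i * u i ^+ 2) (c i * (u i * v i)) (c i * v i ^+ 2).
  by have [e1 e2 e3 _] := h i; rewrite yE -e1 -e2 -e3 /a -vec4_eta.
pose P : 'M[k]_(3, 4) := \matrix_(i, l) (l == nth 0 [:: 0; 2; 3]%N i :> nat)%:R.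
have PE v' : P *m v' = mk3 (v'`_0) (v'`_2) (v'`_3).
  apply/matrixP => i l; rewrite ord1 mxE sum4 !mxE !inordK //.
  by case: i => [[|[|[|i]]] hi] //=; rewrite !(mul1r, mul0r, addr0, add0r).
have fP : row_free P.
  apply/row_freeP; exists P^T; apply/matrixP => i l; rewrite mxE sum4 !mxE !inordK //.
  by case: i => [[|[|[|i]]] hi] //; case: l => [[|[|[|l]]] hl] //=;
    rewrite !(mul1r, mul0r, mulr0, mulr1, addr0, add0r).
have [|q q0 yq] := cone_condM uA cx (j := m) fP.
  by rewrite -/y yE Am PE !vec4E; apply/matrixP => i l; rewrite !mxE; case: i => [[|[|[|i]]] hi].
have qE i : q`_0 * a i ^+ 2 + q`_1 * (c i * (u i * v i)) ^+ 2 + q`_2 * (c i * v i ^+ 2) ^+ 2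
   + q`_3 * a i * (c i * (u i * v i)) + q`_4 * a i * (c i * v i ^+ 2)
   + q`_5 * (c i * (u i * v i)) * (c i * v i ^+ 2) = 0.
  rewrite -[RHS](yq i) -/y ycol PE !vec4E /conic_fun.
  by rewrite sum_inord !big_nat_recr //= big_nil !inordK //= !mk3E; ring.
have cj0 : c j = 0.
  have := ycol j; rewrite yE Aj => /matrixP e.
  have := e (inord 1) 0; have := e (inord 3) 0; rewrite !vec4E.
  have [_ _ _] := h j; move=> /orP[] nz /esym/eqP + /esym/eqP;
    rewrite !mulf_eq0 ?expf_eq0 /= ?(negPf nz) ?orbF.
    by move=> _ /eqP.
  by move=> /eqP.
(* The cone of vertex m contains point j, which is (1, 0, 0, 0). *)
have q00 : q`_0 = 0.
  have aj : a j = 1 by rewrite /a Aj vec4E.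
  by have := qE j; rewrite cj0 aj !mul0r !mulr0 !expr0n /= !mulr0 !addr0 expr1n mulr1.
have {}qE i : c i * v i * (a i * lin_form (q`_3) (q`_4) (u i) (v i)
    + c i * v i * (q`_1 * u i ^+ 2 + q`_5 * (u i * v i) + q`_2 * v i ^+ 2)) = 0.
  by rewrite -[RHS](qE i) q00 /lin_form; ring.
have [nl|] := boolP ((q`_3 != 0) || (q`_4 != 0)); last first.
  rewrite negb_or !negbK => /andP[/eqP q3 /eqP q4].
  have nz : (q`_1, q`_5, q`_2) != (0, 0, 0).
    apply: contraNneq q0 => -[q1 q5 q2]; apply/eqP/matrixP => i l.
    rewrite ord1 mxE -[i]inord_val.
    by case: i => [[|[|[|[|[|[|i]]]]]] hi].
  have [l1 [m1 [l2 [m2 [n1 n2 e]]]]] := nonzero_split nz.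
  apply: (cone_star_limit ycol n1 n2) => i.
  have /eqP := qE i; rewrite q3 q4 /lin_form !mul0r addr0 mulr0 add0r.
  have -> : q`_1 * u i ^+ 2 + q`_5 * (u i * v i) + q`_2 * v i ^+ 2
    = (l1 * u i + m1 * v i) * (l2 * u i + m2 * v i) by rewrite -e; ring.
  rewrite !mulf_eq0 -!orbA => /or3P[/eqP|/eqP|]; [by left|by right; left|].
  case/or4P=> /eqP; [by left|by right; left|by right; right; left|by right; right; right].
(* Replacing point i by s j + t i multiplies the equation by t^2 and adds s t c v l, which must
   therefore vanish. *)
have noniso i : ~ isolated i -> (forall a, col i x != a *: col j x) ->
    c i = 0 \/ v i = 0 \/ lin_form (q`_3) (q`_4) (u i) (v i) = 0.
  move=> ni xi; apply: NNPP => ne.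
  have ci : c i != 0 by apply/eqP => e; apply: ne; left.
  have vi : v i != 0 by apply/eqP => e; apply: ne; right; left.
  apply: ni => i' s t i'E; have [->|s0] := eqVneq s 0; first by left.
  have [->|t0] := eqVneq t 0; first by right.
  case: ne; right; right.
  have yi' : col i' y = s *: vec4 1 0 0 0 + t *: col i y.
    by rewrite !yE i'E mulmxDr -!scalemxAr Aj.
  have /matrixP E := yi'; rewrite !ycol in E.
  have := E (inord 0) 0; have := E (inord 2) 0; have := E (inord 3) 0.
  have := E (inord 1) 0; rewrite !mxE !inordK //= !mulr0 !add0r mulr1 => e1 e3 e2 e0.
  pose Q a y2 y3 := a * (q`_3 * y2 + q`_4 * y3)
    + (q`_1 * y2 * y2 + q`_5 * y2 * y3 + q`_2 * y3 * y3).
  have QE l : Q (a l) (c l * (u l * v l)) (c l * v l ^+ 2) = 0.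
    by rewrite -[RHS](qE l) /Q /lin_form; ring.
  have := QE i'; rewrite e0 e2 e3.
  have -> : Q (s + t * a i) (t * (c i * (u i * v i))) (t * (c i * v i ^+ 2))
    = t ^+ 2 * Q (a i) (c i * (u i * v i)) (c i * v i ^+ 2)
      + s * t * (c i * v i * lin_form (q`_3) (q`_4) (u i) (v i)).
    by rewrite /Q /lin_form; ring.
  rewrite QE mulr0 add0r => /eqP; rewrite !mulf_eq0 (negPf s0) (negPf t0) (negPf ci) (negPf vi) /=.
  by move=> /eqP.
case: miso => [im|nm]; last first.
  apply: (cone_star_limit ycol nl nl) => i.
  have [xi|/not_all_ex_not[b /negP]] := classic (forall a, col i x != a *: col j x).
    case: (noniso i (nm i xi) xi) => [|[|]]; [by left|by right; left|by right; right; left].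
  rewrite negbK => /eqP xi; left.
  have /matrixP e := ycol i; have := e (inord 1) 0; have := e (inord 3) 0.
  rewrite yE xi -scalemxAr Aj !mxE !inordK //= !mulr0.
  have [_ _ _] := h i; move=> /orP[] nz /esym/eqP + /esym/eqP;
    rewrite !mulf_eq0 ?expf_eq0 /= ?(negPf nz) ?orbF.
    by move=> _ /eqP.
  by move=> /eqP.
have yE4 : y = mx4 (fun j => [:: a j; c j * u j ^+ 2; c j * (u j * v j); c j * v j ^+ 2]).
  by apply/matrixP => i l; have /matrixP/(_ i 0) := ycol l; rewrite [LHS]mxE !mxE => ->.
rewrite -/y yE4; apply: (@cone_curve_limit _ _ (q`_3) (q`_4) 0 (- q`_1) (- q`_5) (- q`_2))
  => // [i|i].
  by have [_ _ _] := h i.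
have [->|ci] := eqVneq (c i) 0; [by left|right].
have [vi|vi] := eqVneq (v i) 0.
  have ui : u i != 0 by have [_ _ _] := h i; rewrite vi eqxx orbF.
  have xiE : col i x = a i *: col j x + (c i * u i ^+ 2) *: col m x.
    apply: (can_inj (mulKmx uA)); rewrite -yE ycol mulmxDr -!scalemxAr Aj Am vi.
    by apply/matrixP => -[[|[|[|[|l]]]] hl] l' //; rewrite !mxE /=; ring.
  case: (im _ _ _ xiE) => [->|/eqP]; first by rewrite vi; ring.
  by rewrite mulf_eq0 expf_eq0 (negPf ci) (negPf ui).
have /eqP := qE i; rewrite !mulf_eq0 (negPf ci) (negPf vi) /= addr_eq0 => /eqP ->.
by ring.
Qed.

End SmoothCone.

(** * Subschemes *)

Section PsiVanishing.

Variable k : closedFieldType.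

Lemma polyfun_cominor d (X : k -> 'M[k]_(d.+1, d.+4)) a b c : polymx X ->
  polyfun (fun t => cominor (X t) a b c).
Proof.
move=> pX; apply: polyfun_det => i j.
case: (@split_ordP 3 d.+1 i) => i' ->.
  apply: (@polyfun_ext _ (fun=> sel_mx k a b c i' j)); first exact: polyfun_cst.
  by move=> t; rewrite (@col_mxEu _ 3 d.+1).
by apply: (@polyfun_ext _ (fun t => X t i' j)) => // t; rewrite (@col_mxEd _ 3 d.+1).
Qed.

(** Limits follow from [polyfun_eq0]. Points on a rational normal curve have a Gale dual on the
    standard conic, where the bracket expression vanishes identically; [cominor_gale] carries this
    back. *)
Lemma rnc_limit_psi d (x : 'M[k]_(d.+1, d.+4)) (I : {set 'I_d.+4}) :
  rnc_limit x -> #|I| = 6 -> psi x I = 0.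
Proof.
move=> gx; rewrite cardE.
case eI: (enum I) => [|i1 [|i2 [|i3 [|i4 [|i5 [|i6 [|? ?]]]]]]] // _.
rewrite (psiE x eI); elim: gx {eI} => [A c l uA c0 il|X D pX D0 _ IH]; last first.
  apply: (@polyfun_eq0 _ (fun t => conic_expr (cominor (X t)) i1 i2 i3 i4 i5 i6)).
    by apply: polyfunD; last apply: polyfunN;
      do 3 (apply: polyfunM; last exact: polyfun_cominor); exact: polyfun_cominor.
  by exists D.
(* With these weights, the dual weights in [curve_gale] are the given c. *)
set z := A *m _; pose w j := (c j * node_prod l j)^-1.
have w0 j : w j != 0 by rewrite invr_neq0 // mulf_neq0 ?node_prod_neq0.
pose y := curve_mx 2 w (fun=> 1) l.
have zy : z *m y^T = 0.
  rewrite /z -mulmxA; have := curve_gale il w0.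
  have -> : curve_mx d (fun j => (w j * node_prod l j)^-1) (fun=> 1) l = curve_mx d c (fun=> 1) l.
    apply/matrixP => i j; rewrite !mxE; congr (_ * _).
    by rewrite /w invfM invrK mulfK // node_prod_neq0.
  by move=> ->; rewrite mulmx0.
have fz : row_free z.
  rewrite /row_free eqmxMfull ?row_full_unit //; apply: curve_mx_row_free => //; lia.
have /row_freeP[z' zz'] := fz.
pose N : 'M[k]_(3 + d.+1) := row_mx y^T z'.
have N0 : \det N != 0.
  by rewrite -unitfE -unitmxE; apply: (gale_unitmx zy zz'); exact: curve_mx_row_free.
have cE a b c' : det3 y a b c' = \det N * cominor z a b c'.
  by rewrite -(cominor_gale a b c' zy zz') mulrC.
apply: (mulfI (expf_neq0 4 N0)); rewrite mulr0 -(conic_expr_scale _ _ _ _ _ _ cE).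
by rewrite /conic_expr !det3E /explicit_det3 !mxE !inordK // !expr1n; ring.
Qed.

End PsiVanishing.

(** * Minors and psi under ring morphisms and column selection *)

Section Morphisms.

Lemma cols_map (R S : nzRingType) (g : {rmorphism R -> S}) m n r
    (M : 'M[R]_(m, n)) (K : {set 'I_n}) :
  map_mx g (cols r M K) = cols r (map_mx g M) K.
Proof.
apply/matrixP => i l; rewrite !mxE.
have [lt|le] := ltnP l #|K|.
  have j0 : 'I_n by case: (enum_val (Ordinal lt)) => u hu; exists u.
  by rewrite !(nth_map j0) -?cardE // mxE.
by rewrite !nth_default ?size_map -?cardE // rmorph0.
Qed.

Lemma psi_map (R S : comNzRingType) (g : {rmorphism R -> S}) d
    (M : 'M[R]_(d.+1, d.+4)) (I : {set 'I_d.+4}) :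
  g (psi M I) = psi (map_mx g M) I.
Proof.
have mE J : g (mhat M J) = mhat (map_mx g M) J.
  by rewrite /mhat /max_minor rmorphM rmorphXn rmorphN1 -det_map_mx cols_map.
rewrite /psi; move: (mhat M) (mhat (map_mx g M)) mE => m m' mE.
by rewrite rmorphB !rmorphM !mE.
Qed.

Lemma cols_cols (R : nzRingType) m n r s (M : 'M[R]_(m, n)) (J : {set 'I_n})
    (K : {set 'I_r}) (j0 : 'I_n) : #|J| = r -> #|K| = s ->
  exists2 K' : {set 'I_n}, #|K'| = s & cols s (cols r M J) K = cols s M K'.
Proof.
move=> cJ cK; pose h (l : 'I_r) := nth j0 (enum J) l.
have sJ := enum_set_sorted J; have zJ : size (enum J) = r by rewrite -cardE.
have hi : injective h.
  move=> a b /eqP; rewrite /h nth_uniq ?zJ ?enum_uniq // => /eqP; exact: val_inj.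
exists [set h l | l in K]; first by rewrite card_imset.
have eK : enum [set h l | l in K] = [seq h l | l <- enum K].
  apply: enum_set_eq => [|i]; last first.
    by apply/mapP/imsetP => -[l lK ->]; exists l; rewrite // ?mem_enum // -mem_enum.
  rewrite sorted_map; apply: (@sub_sorted _ (fun a b : 'I_r => (a < b)%N)).
    move=> a b ab; apply: (sorted_ltn_nth _ _ sJ); rewrite ?inE ?zJ //.
    by move=> ? ? ?; exact: ltn_trans.
  exact: enum_set_sorted.
apply/matrixP => i l; have lt : (l < #|K|)%N by rewrite cK.
have r0 : 'I_r by exact: (enum_val (Ordinal lt)).
rewrite (cols_seq _ r0) // (cols_seq _ j0) // (cols_seq _ j0); last by rewrite card_imset.
by rewrite eK (nth_map r0) // -cardE.
Qed.

End Morphisms.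

(** * Ideals, evaluation at points and the comparison of V, Y and W *)

Section Subschemes.

Variables (k : closedFieldType) (d n : nat).

Lemma ideal_gen_sub (E : coord_ring k d n -> Prop) f : E f -> ideal_gen E f.
Proof.
move=> Ef; exists [:: (1, f)]; last by rewrite big_seq1 mul1r.
by move=> ag; rewrite inE => /eqP->.
Qed.

Lemma zeros_ideal_mono (E E' : coord_ring k d n -> Prop) f :
  (forall g, E g -> ideal_gen E' g) -> zeros_ideal E f -> zeros_ideal E' f.
Proof.
move=> EE' h c; have [N [s hs e]] := h c; exists N; rewrite e big_seq.
apply: (big_ind (ideal_gen E')); [exact: ideal_gen0|exact: ideal_genD|].
by move=> ag /hs /EE'; exact: ideal_genM.
Qed.

Lemma eval_coord_mx (x : 'M[k]_(d.+1, n)) :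
  map_mx (meval (fun l => mxvec x 0 l)) (coord_mx k d n) = x.
Proof. by apply/matrixP => i j; rewrite !mxE mevalXU mxvecE. Qed.

(** Some chart contains the point, and there saturation only multiplies f by a power of a nonzero
    value. *)
Lemma eval_zeros (E : coord_ring k d n -> Prop) (x : 'M[k]_(d.+1, n)) f :
  (forall j, col j x != 0) -> (forall g, E g -> eval_at x g = 0) ->
  zeros_ideal E f -> eval_at x f = 0.
Proof.
move=> x0 Ex hf.
have /fin_all_exists[c hc] j : exists i, x i j != 0.
  by have /matrix0Pn[i [l]] := x0 j; rewrite mxE; exists i.
have [N [s hs e]] := hf c; have := congr1 (eval_at x) e.
rewrite /eval_at rmorphM rmorphXn /= raddf_sum /= big_seq big1 => [/eqP|ag /hs /Ex h].
  rewrite mulf_eq0 expf_eq0 => /orP[/andP[_]|/eqP //].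
  rewrite rmorph_prod prodf_seq_eq0 => /hasP[j _ /andP[_]].
  by rewrite [coord_mx _ _ _ _ _]mxE /= mevalXU mxvecE (negPf (hc j)).
by rewrite rmorphM /= [meval _ ag.2]h mulr0.
Qed.

Lemma eval_W (x : 'M[k]_(d.+1, n)) (J : {set 'I_n}) (I : {set 'I_d.+4}) :
  eval_at x (psi (cols d.+4 (coord_mx k d n) J) I) = psi (cols d.+4 x J) I.
Proof. by rewrite /eval_at psi_map cols_map eval_coord_mx. Qed.

Lemma polyfun_eval (X : k -> 'M[k]_(d.+1, n)) f : polymx X ->
  polyfun (fun t => eval_at (X t) f).
Proof.
move=> pX; apply: (@polyfun_ext _ (fun t => \sum_(m <- msupp f) f@_m *
    \prod_(l < d.+1 * n) (mxvec (X t) 0 l) ^+ m l)); last first.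
  by move=> t; rewrite /eval_at mevalE.
apply: polyfun_sum => m; apply: polyfunM; first exact: polyfun_cst.
apply: polyfun_prod => l; apply: polyfunX; case/mxvec_indexP: l => i j.
by apply: (polyfun_ext (pX i j)) => t; rewrite mxvecE.
Qed.

Lemma vline_scale (V : vectType k) (v : V) c : c != 0 -> <[c *: v]>%VS = <[v]>%VS.
Proof.
move=> c0; apply/eqP; rewrite eqEsubv -!memvE memvZ ?memv_line //=.
by rewrite -[v in v \in _](scalerK c0) memvZ ?memv_line.
Qed.

(** Limits are [polyfun_eq0] applied to f along the arc. The generating points form a configuration
    in U: they are distinct because the first two coordinates, available for d > 0, recover the
    parameter. *)
Lemma vanishing_rnc_limit f (x : 'M[k]_(d.+1, n)) : (0 < d)%N ->
  vanishing_forms (@U_locus k d n) f -> rnc_limit x -> eval_at x f = 0.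
Proof.
move=> d0 [_ hf]; elim=> [A c l uA c0 il|X D pX D0 _ IH]; last first.
  by apply: (polyfun_eq0 (polyfun_eval f pX)); exists D.
set C := curve_mx _ _ _ _; set x0 := A *m C.
have colC j : col j C = c j *: veronese_map d (\col_i (if i == 0 then 1 else l j)).
  by apply/matrixP => i a; rewrite !mxE /= expr1n.
have colx j : col j x0 = A *m col j C by rewrite col_mul.
have colx0 j : col j x0 != 0.
  apply/eqP => e; have : col j C = 0 by apply: (can_inj (mulKmx uA)); rewrite -colx e mulmx0.
  move/matrixP/(_ 0 0); rewrite !mxE expr1n expr0 !mulr1 => /eqP; exact/negP.
have dim1 j : \dim <[col j x0]>%VS == 1%N by rewrite dim_vline colx0.
pose p : config k d n := fun j => exist _ <[col j x0]>%VS (dim1 j).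
apply: (hf p) => //; split=> [i j /(congr1 val) /= e|].
  have /vlineP[a ea] : col i x0 \in <[col j x0]>%VS by rewrite -e memv_line.
  have : col i C = a *: col j C.
    by apply: (can_inj (mulKmx uA)); rewrite -scalemxAr -!colx.
  move/matrixP => eC; have := eC 0 0; have := eC (inord 1) 0.
  rewrite !mxE !inordK // !expr1n !expr0 !expr1 !mul1r !mulr1 => e1 e0.
  have a0 : a * c j != 0 by rewrite -e0.
  by apply: il; apply: (mulfI a0); rewrite -[RHS]mulrA -e1 e0.
exists (fun q => exists2 v : 'cV[k]_2, v != 0 & val q = <[A *m veronese_map d v]>%VS).
  by exists A.
move=> j; exists (\col_i (if i == 0 then 1 else l j)).
  by apply/eqP => /matrixP/(_ 0 0); rewrite !mxE /= => /eqP; rewrite oner_eq0.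
by rewrite /= colx colC -scalemxAr vline_scale.
Qed.

Lemma W_equations_V f : W_equations f -> vanishing_forms (@U_locus k d n) f.
Proof.
move=> Wf; split; first exact: W_equations_homog.
case: Wf => J [I [cJ cI ->]] p x [_ [C [A uA hC] hp]] hx; rewrite eval_W.
apply: rnc_limit_psi => //; apply: (@rnc_limit_cols _ _ _ A) => l.
have lt : (l < #|J|)%N by rewrite cJ.
have j0 : 'I_n by exact: (enum_val (Ordinal lt)).
set j := nth j0 (enum J) l.
have [v v0 vE] := (hC (p j)).1 (hp j).
have /vlineP[c ec] : col j x \in <[A *m veronese_map d v]>%VS by rewrite -vE hx memv_line.
exists c, (v 0 0), (v 1 0) => i; rewrite (cols_seq _ j0) //.
have /matrixP/(_ i 0) := ec; rewrite mxE => ->.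
by rewrite scalemxAr mxE; apply: eq_bigr => h _; rewrite !mxE.
Qed.

(** Every factor of psi is a signed maximal minor of the coordinate matrix, so the last factor of
    each product puts it in the ideal. *)
Lemma W_equations_Y f : (0 < n)%N -> W_equations f -> ideal_gen (@Y_equations k d n) f.
Proof.
move=> n0 [J [I [cJ cI ->]]]; set M := cols _ _ _.
have minor a b c : uniq [:: a; b; c] -> ideal_gen (@Y_equations k d n) (mhat M [set a; b; c]).
  move=> /=; rewrite !inE !andbT negb_or => /andP[/andP[ab ac] bc].
  apply: ideal_genM; apply: ideal_gen_sub.
  have c3 : #|[set a; b; c]| = 3.
    by rewrite -setUA cardsU1 cards2 !inE negb_or ab ac bc.
  have cC : #|~: [set a; b; c]| = d.+1.
    by have := cardsC [set a; b; c]; rewrite c3 card_ord => -[].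
  have [K cK KE] := cols_cols (coord_mx k d n) (Ordinal n0) cJ cC.
  by exists K; [exact: cK|rewrite /M /max_minor KE].
have uI : uniq (enum I) by exact: enum_uniq.
have sI : size (enum I) = 6%N by rewrite -cardE.
have mn a b c : (0 < a <= 6)%N -> (0 < b <= 6)%N -> (0 < c <= 6)%N -> uniq [:: a; b; c] ->
    ideal_gen (@Y_equations k d n) (mhat M [set nth ord0 (enum I) a.-1;
      nth ord0 (enum I) b.-1; nth ord0 (enum I) c.-1]).
  move=> ha hb hc; rewrite /= !inE !negb_or !andbT => h; apply: minor.
  rewrite /= !inE !negb_or !andbT !nth_uniq ?sI //; lia.
rewrite /psi; move: (mhat M) mn => m mn; apply: ideal_genD.
  by apply: ideal_genM; exact: (mn 3 5 6).
by rewrite -mulN1r; do 2 apply: ideal_genM; exact: (mn 4 5 6).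
Qed.

Lemma hcoords_neq0 (x : 'M[k]_(d.+1, n)) p j : hcoords x p -> col j x != 0.
Proof.
move=> hx; have := valP (p j); rewrite /= -[sval (p j)]/(val (p j)) hx.
by rewrite dim_vline; case: (col j x != 0).
Qed.

Lemma hcoords_ex (p : config k d n) : exists x, hcoords x p.
Proof.
exists (\matrix_(i, j) vpick (val (p j)) i 0) => j.
have -> : col j (\matrix_(i, j) vpick (val (p j)) i 0) = vpick (val (p j)).
  by apply/matrixP => i a; rewrite ord1 !mxE.
apply/eqP; rewrite eq_sym eqEdim -memvE memv_pick dim_vline vpick0 -dimv_eq0.
by rewrite (eqP (valP (p j))).
Qed.

Lemma hcoords_scale (x y : 'M[k]_(d.+1, n)) p : hcoords x p -> hcoords y p ->
  exists c, forall j, c j != 0 /\ col j x = c j *: col j y.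
Proof.
move=> hx hy; apply: (@fin_all_exists _ _ (fun j c => c != 0 /\ col j x = c *: col j y)) => j.
have /vlineP[c xE] : col j x \in <[col j y]>%VS by rewrite -hy hx memv_line.
exists c; split=> //; apply: contraNneq (hcoords_neq0 j hx) => c0.
by rewrite xE c0 scale0r.
Qed.

Lemma max_minor_rank (x : 'M[k]_(d.+1, n)) (K : {set 'I_n}) :
  ~~ row_free x -> #|K| = d.+1 -> max_minor x K = 0.
Proof.
move=> nx cK; apply/eqP/contraT; rewrite -unitfE -unitmxE -row_free_unit => fK.
case/negP: nx; rewrite /row_free eqn_leq rank_leq_row -{1}(eqP fK).
rewrite -mxrank_tr -[X in (_ <= X)%N]mxrank_tr.
apply: mxrankS; apply/row_subP => l.
have lt : (l < #|K|)%N by rewrite cK.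
have j0 : 'I_n by exact: (enum_val (Ordinal lt)).
apply: (eq_row_sub (nth j0 (enum K) l)); apply/rowP => i.
by rewrite !mxE -(cols_seq x j0 i l cK) mxE.
Qed.

Lemma row_free_scale (x y : 'M[k]_(d.+1, n)) c :
  (forall j, col j x = c j *: col j y) -> row_free x -> row_free y.
Proof.
move=> xy; have -> : x = y *m diag_mx (\row_j c j).
  apply/matrixP => i j; have /matrixP/(_ i 0) := xy j.
  by rewrite mul_mx_diag !mxE => ->; rewrite mulrC.
rewrite /row_free => /eqP r; by rewrite eqn_leq rank_leq_row -[X in (X <= _)%N]r mxrankM_maxl.
Qed.

Lemma rnc_limit_of_W (x : 'M[k]_(d.+1, n)) : (forall j, col j x != 0) ->
  row_free x -> d = 3%N \/ n = d.+4 ->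
  (forall (J : {set 'I_n}) (I : {set 'I_d.+4}), #|J| = d.+4 -> #|I| = 6%N ->
     psi (cols d.+4 x J) I = 0) -> rnc_limit x.
Proof.
move=> x0 fx [d3|nd] h.
  move: x x0 fx h; rewrite d3 => x x0 fx h.
  by apply: rnc_limit_of_cones => //; apply: cone_cond_of_psi.
move: x x0 fx h; rewrite nd => x x0 fx h.
apply: rnc_limit_of_psi => // I cI.
have := h setT I; rewrite cardsT card_ord => /(_ erefl cI).
suff -> : cols d.+4 x setT = x by [].
apply/matrixP => i l; rewrite (cols_seq _ ord0) ?cardsT ?card_ord //.
by rewrite enum_setT -enumT nth_ord_enum.
Qed.

End Subschemes.

Theorem theorem1p2 (k : closedFieldType) (d n : nat)
    (hd : (3 <= d)%N) (hn : (d.+4 <= n)%N) :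
  subscheme (sunion (V_scheme k d n) (Y_scheme k d n)) (W_scheme k d n) /\
  (d = 3%N \/ n = d.+4 ->
   forall p : config k d n,
     point_of (V_scheme k d n) p \/ point_of (Y_scheme k d n) p <->
     point_of (W_scheme k d n) p).
Proof.
have n0 : (0 < n)%N by exact: leq_trans hn.
have d0 : (0 < d)%N by exact: leq_trans hd.
have sub : subscheme (sunion (V_scheme k d n) (Y_scheme k d n)) (W_scheme k d n).
  move=> f Wf; split; apply: zeros_ideal_mono Wf => g Wg.
    exact/ideal_gen_sub/W_equations_V.
  exact: W_equations_Y.
split=> // hdn p; split=> [[] hp f /sub[fV fY]|hW]; [exact: hp|exact: hp|].
have [x hx] := hcoords_ex p.
have x0 j := hcoords_neq0 j hx.
(* Points of W with coordinates of full rank are put in V, the others in Y; other coordinates y of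
   the same point differ by nonzero column factors. *)
have [fx|nfx] := boolP (row_free x).
  left=> f fV y hy; apply: (eval_zeros _ _ fV) => [j|g gV].
    exact: hcoords_neq0 hy.
  have [c hc] := hcoords_scale hx hy; apply: (vanishing_rnc_limit d0 gV).
  apply: (rnc_limit_unscale (fun j => (hc j).1) (fun j => (hc j).2)).
  apply: (rnc_limit_of_W x0 fx hdn) => J I cJ cI; rewrite -eval_W.
  apply: (hW _ _ x hx) => c'; exists 0%N; rewrite expr0 mul1r.
  by apply: ideal_gen_sub; exists J, I.
right=> f fY y hy; apply: (eval_zeros _ _ fY) => [j|g [K cK ->]].
  exact: hcoords_neq0 hy.
have [c hc] := hcoords_scale hy hx.
have -> : eval_at y (max_minor (coord_mx k d n) K) = max_minor y K.
  by rewrite /eval_at /max_minor -det_map_mx cols_map eval_coord_mx.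
apply: max_minor_rank => //; apply: contra nfx.
exact: (row_free_scale (fun j => (hc j).2)).
Qed.
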